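(* Let $d,p\geq 2$ be natural numbers, let $G_\infty=\mathbb{Z}[1/p]^d$ (discrete), let $\sigma$ be a normalized $\mathbb{T}$-valued $2$-cocycle of $G_\infty$, let $\gamma_1,\dots,\gamma_{d+1}$ be anticommuting self-adjoint unitaries on a Hermitian space $E$, and let $D_\infty=\sum_{j=1}^d X_j\otimes\gamma_j+M_F\otimes\gamma_{d+1}$, where $X_j$ is multiplication by the $j$-th coordinate function and $M_F$ is multiplication by $F(z)=p^{\min\{n\in\mathbb{N}:p^nz\in\mathbb{Z}^d\}}$. Then the spectral triple $\left(C^*(G_\infty,\sigma),\ \ell^2(G_\infty)\otimes E,\ D_\infty\right)$ is metric.
   Context: $\mathbb{N}=\{0,1,2,\dots\}$. $\mathbb{Z}[1/p]=\{m/p^n:m\in\mathbb{Z},n\in\mathbb{N}\}$, and $G_\infty=\mathbb{Z}[1/p]^d$ with the discrete topology. For $z=(z_1,\dots,z_d)\in G_\infty$ put $x_j(z)=z_j$, $F(z)=p^{\min\{n\in\mathbb{N}:\,(p^nz_1,\dots,p^nz_d)\in\mathbb{Z}^d\}}$ and $L(z)=\sqrt{\sum_{j=1}^d|x_j(z)|^2+F(z)^2}$. Let $H=\{f\in\ell^2(G_\infty):\sum_{z\in G_\infty}L(z)^2|f(z)|^2<\infty\}$. On $H$, $X_jf=x_jf$ and $M_Ff=Ff$ (pointwise multiplication). A Hermitian space is a (nonzero) finite-dimensional complex inner product space; $\gamma_1,\dots,\gamma_{d+1}$ are self-adjoint unitaries on $E$ with $\gamma_j\gamma_k=-\gamma_k\gamma_j$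 for $j\neq k$. The operator $D_\infty$ has domain $\mathrm{dom}(D_\infty)=H\otimes E$. A $\mathbb{T}$-valued $2$-cocycle of $G_\infty$ is a map $\sigma:G_\infty\times G_\infty\to\mathbb{T}$ with $\sigma(g,h)\sigma(g+h,k)=\sigma(g,h+k)\sigma(h,k)$; it is normalized when $\sigma(g,-g)=1$ for all $g$. The left regular $\sigma$-projective representation on $\ell^2(G_\infty)$ is $(\lambda_\infty(g)\xi)(h)=\sigma(g,h-g)\xi(h-g)$, and for finitely supported $f$, $\lambda_\infty(f)=\sum_gf(g)\lambda_\infty(g)$. $C^*(G_\infty,\sigma)$ is the operator-norm closure of $\{\lambda_\infty(f):f \text{ finitely supported}\}$; it acts on $\ell^2(G_\infty)\otimes E$ by $a\otimes 1_E$. A spectral triple $(A,\mathscr{H},D)$ is a unital C*-algebra $A$ represented on a Hilbert space $\mathscr{H}$ together with a self-adjoint operator $D$ on $\mathscr{H}$ with compact resolvent such that the set of $a\in A$ with $a\,\mathrm{dom}(D)\subseteq\mathrm{dom}(D)$ and $[D,a]$ bounded contains a dense $*$-subalgebra of $A$. It is metric when the (a priori extended pseudo-)metric $\mathrm{mk}_D(\varphi,\psi)=\sup\{|\varphi(a)-\psi(a)|: a\in A,\ a\,\mathrm{dom}(D)\subseteq\mathrm{dom}(D),\ \|[D,a]\|\leq 1\}$ on the state space of $A$ is an actual metric that metrizes the weak$^*$ topology. *)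

(* Defs.v *)
From HB Require Import structures.
From mathcomp Require Import all_boot all_order all_algebra finmap.
From mathcomp Require Import all_classical all_reals all_analysis.
From mathcomp Require Import complex ring lra.

Set Implicit Arguments.
Unset Strict Implicit.
Unset Printing Implicit Defensive.

Import Order.TTheory GRing.Theory Num.Theory Num.Def.
Import numFieldNormedType.Exports.
Local Open Scope classical_set_scope.
Local Open Scope ring_scope.


Section summation.
Variables (R : realType) (T : choiceType).
Implicit Types (f g : T -> R) (c : R) (h k : T -> R[i]).

(* Unconditional sum of an absolutely summable family: the sum of its positive
   part minus the sum of its negative part. *)
Definition rsum f : R :=
  fine (\esum_(t in setT) (EFin \o f)^\+ t - \esum_(t in setT) (EFin \o f)^\- t)%E.

Definition csum h : R[i] := (rsum (fun t => complex.Re (h t)) +i*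
                             rsum (fun t => complex.Im (h t)))%C.

Definition rsummable f := summable setT (EFin \o f).
Definition csummable h := rsummable (fun t => complex.Re (h t)) &&
                          rsummable (fun t => complex.Im (h t)).

Let ge0_summable f : (forall t, 0 <= f t) ->
  rsummable f = (\esum_(t in setT) (f t)%:E < +oo)%E.
Proof.
move=> f0; rewrite /rsummable /summable; congr (_ < _)%E.
by apply: eq_esum => t _ /=; rewrite ger0_norm.
Qed.

Lemma rsummable_le f g : (forall t, `|f t| <= g t) ->
  (\esum_(t in setT) (g t)%:E < +oo)%E -> rsummable f.
Proof.
move=> fg; apply: le_lt_trans; apply: le_esum => t _ /=.
by rewrite lee_fin.
Qed.

Lemma rsummableD f g : rsummable f -> rsummable g -> rsummable (fun t => f t + g t).
Proof. exact: summableD. Qed.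

Lemma rsummableN f : rsummable f -> rsummable (fun t => - f t).
Proof. by rewrite /rsummable summableN. Qed.

Let esumZ_le c (a : T -> \bar R) : 0 <= c -> (forall t, 0 <= a t)%E ->
  (\esum_(t in setT) (c%:E * a t) <= c%:E * \esum_(t in setT) a t)%E.
Proof.
move=> c0 a0; rewrite {1}/esum; apply: ge_ereal_sup => x.
move=> -[A [finA _] <-].
rewrite -(ge0_mule_fsumr c%:E A a0)//; apply: lee_wpmul2l; rewrite ?lee_fin//.
by apply: ereal_sup_ubound; exists A.
Qed.

Lemma esumZ c (a : T -> \bar R) : 0 <= c -> (forall t, 0 <= a t)%E ->
  (\esum_(t in setT) (c%:E * a t) = c%:E * \esum_(t in setT) a t)%E.
Proof.
move=> c0 a0; have [->|cn0] := eqVneq c 0.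
  by rewrite mul0e esum1// => t _; rewrite mul0e.
have {cn0}c0 : 0 < c by rewrite lt_def cn0.
apply/eqP; rewrite eq_le (esumZ_le (ltW c0) a0) /=.
have ca0 t : (0 <= c%:E * a t)%E by apply: mule_ge0 => //; rewrite lee_fin ltW.
have := @esumZ_le c^-1 (fun t => c%:E * a t)%E; rewrite invr_ge0 ltW// => /(_ isT ca0).
have -> : (\esum_(t in setT) (c^-1%:E * (c%:E * a t)) = \esum_(t in setT) a t)%E.
  by apply: eq_esum => t _; rewrite muleA -EFinM mulVf ?gt_eqF// mul1e.
move=> h; have c0e : (0 <= c%:E)%E by rewrite lee_fin ltW.
have := lee_wpmul2l c0e h.
by rewrite muleA -EFinM mulfV ?gt_eqF// mul1e.
Qed.

Lemma rsummableZ c f : rsummable f -> rsummable (fun t => c * f t).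
Proof.
rewrite /rsummable /summable => sf.
under eq_esum do rewrite /= normrM EFinM.
rewrite (@esumZ `|c| (fun t => `|f t|%:E))//.
by rewrite lte_mul_pinfty.
Qed.

Let rsumBE f g : (forall t, 0 <= f t) -> (forall t, 0 <= g t) ->
  rsummable f -> rsummable g ->
  rsum (fun t => f t - g t) =
  fine (\esum_(t in setT) (f t)%:E) - fine (\esum_(t in setT) (g t)%:E).
Proof.
move=> f0 g0 sf sg; rewrite /rsum.
rewrite (_ : EFin \o _ = (EFin \o f) \- (EFin \o g))%E; last first.
  by apply/funext => t /=; rewrite EFinB.
rewrite esumB//= ?fineB//.
- by rewrite ge0_fin_numE -?ge0_summable// esum_ge0// => t _; rewrite lee_fin.
- by rewrite ge0_fin_numE -?ge0_summable// esum_ge0// => t _; rewrite lee_fin.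
- by move=> t _; rewrite lee_fin.
- by move=> t _; rewrite lee_fin.
Qed.

Let pos f t := Num.max (f t) 0.
Let neg f t := Num.max (- f t) 0.
Let pos0 f t : 0 <= pos f t. Proof. by rewrite le_max lexx orbT. Qed.
Let neg0 f t : 0 <= neg f t. Proof. by rewrite le_max lexx orbT. Qed.
Let posnegE f : f = fun t => pos f t - neg f t.
Proof.
apply/funext => t; rewrite /pos /neg; have [f0|f0] := leP 0 (f t).
  by rewrite max_r ?oppr_le0// subr0.
by rewrite max_l ?oppr_ge0 ?(ltW f0)// sub0r opprK.
Qed.
Let pos_sum f : rsummable f -> rsummable (pos f).
Proof.
move=> sf; apply: rsummable_le sf => t; rewrite (ger0_norm (pos0 f t)).
by rewrite /pos /neg ge_max ler_norm normr_ge0.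
Qed.
Let neg_sum f : rsummable f -> rsummable (neg f).
Proof.
move=> sf; apply: rsummable_le sf => t; rewrite (ger0_norm (neg0 f t)).
by rewrite /pos /neg ge_max -normrN ler_norm normr_ge0.
Qed.
Let fineD_sum f g : (forall t, 0 <= f t) -> (forall t, 0 <= g t) ->
  rsummable f -> rsummable g ->
  fine (\esum_(t in setT) (f t + g t)%:E) =
  fine (\esum_(t in setT) (f t)%:E) + fine (\esum_(t in setT) (g t)%:E).
Proof.
move=> f0 g0; rewrite !ge0_summable// => sf sg.
under eq_esum do rewrite EFinD.
rewrite esumD ?fineD//; try by move=> t _; rewrite lee_fin.
- by rewrite ge0_fin_numE// esum_ge0// => t _; rewrite lee_fin.
- by rewrite ge0_fin_numE// esum_ge0// => t _; rewrite lee_fin.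
Qed.

Lemma rsumD f g : rsummable f -> rsummable g ->
  rsum (fun t => f t + g t) = rsum f + rsum g.
Proof.
move=> sf sg; have pf := pos_sum sf; have nf := neg_sum sf.
have pg := pos_sum sg; have ng := neg_sum sg.
rewrite [in RHS](posnegE f) [in RHS](posnegE g) !rsumBE//.
rewrite addrACA -opprD -!fineD_sum//.
rewrite -rsumBE//; first congr rsum.
- apply/funext => t; rewrite opprD addrACA.
  by rewrite [in LHS](posnegE f) [in LHS](posnegE g).
- by move=> t; rewrite addr_ge0.
- by move=> t; rewrite addr_ge0.
- by apply: rsummableD; exact: pos_sum.
- by apply: rsummableD; exact: neg_sum.
Qed.

Lemma rsumN f : rsum (fun t => - f t) = - rsum f.
Proof.
rewrite /rsum (_ : EFin \o _ = \- (EFin \o f))%E; last by apply/funext.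
rewrite funeposN funenegN.
have : (forall t, 0 <= (EFin \o f)^\+ t)%E by [].
have : (forall t, 0 <= (EFin \o f)^\- t)%E by [].
move: (EFin \o f)^\+%E (EFin \o f)^\-%E => p n n0 p0.
have := @esum_ge0 _ _ setT p (fun t _ => p0 t).
have := @esum_ge0 _ _ setT n (fun t _ => n0 t).
case: (esum _ p) => [x||]; case: (esum _ n) => [y||]//=; rewrite ?oppr0//.
by rewrite opprB.
Qed.

Lemma ge0_rsum f : (forall t, 0 <= f t) ->
  rsum f = fine (\esum_(t in setT) (f t)%:E).
Proof.
move=> f0; rewrite /rsum [X in (_ - X)%E]esum1; last first.
  by move=> t _; rewrite (@ge0_funenegE _ _ setT) ?inE// => ? _ /=; rewrite lee_fin.
rewrite sube0; congr fine; apply: eq_esum => t _.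
by rewrite (@ge0_funeposE _ _ setT)// ?inE// => ? _ /=; rewrite lee_fin.
Qed.

Let rsumZ_ge0 c f : 0 <= c -> rsummable f ->
  rsum (fun t => c * f t) = c * rsum f.
Proof.
move=> c0 sf.
have H g : (forall t, 0 <= g t) -> rsummable g ->
   fine (\esum_(t in setT) (c * g t)%:E) = c * fine (\esum_(t in setT) (g t)%:E).
  move=> g0; rewrite ge0_summable// => sg.
  under eq_esum do rewrite EFinM.
  rewrite esumZ// ?fineM//.
  by rewrite ge0_fin_numE// esum_ge0// => t _; rewrite lee_fin.
have pf := pos_sum sf; have nf := neg_sum sf.
rewrite [in RHS](posnegE f) rsumBE// mulrBr -!H//.
rewrite -rsumBE; first congr rsum.
- by apply/funext => t; rewrite -mulrBr [in LHS](posnegE f).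
- by move=> t; rewrite mulr_ge0.
- by move=> t; rewrite mulr_ge0.
- by apply: rsummableZ; exact: pos_sum.
- by apply: rsummableZ; exact: neg_sum.
Qed.

Lemma rsumZ c f : rsummable f -> rsum (fun t => c * f t) = c * rsum f.
Proof.
move=> sf; have [c0|c0] := leP 0 c; first exact: rsumZ_ge0.
rewrite -[c]opprK mulNr -rsumZ_ge0 ?oppr_ge0 ?ltW// -rsumN; congr rsum.
by apply/funext => t; rewrite mulNr.
Qed.

Lemma csumD h k : csummable h -> csummable k ->
  csum (fun t => h t + k t) = csum h + csum k.
Proof.
move=> /andP[? ?] /andP[? ?]; apply/eqP; rewrite eq_complex/=.
apply/andP; split; apply/eqP; rewrite -rsumD//; congr rsum; apply/funext => t.
- by case: (h t) (k t) => [? ?] [? ?].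
- by case: (h t) (k t) => [? ?] [? ?].
Qed.

Lemma csummableZ (z : R[i]) h : csummable h -> csummable (fun t => z * h t).
Proof.
move=> /andP[sr si]; case: z => x y; apply/andP; split.
- have := rsummableD (rsummableZ x sr) (rsummableN (rsummableZ y si)).
  by congr (is_true (rsummable _)); apply/funext => t; case: (h t).
- have := rsummableD (rsummableZ x si) (rsummableZ y sr).
  by congr (is_true (rsummable _)); apply/funext => t; case: (h t).
Qed.

Lemma csumZ (z : R[i]) h : csummable h -> csum (fun t => z * h t) = z * csum h.
Proof.
move=> /andP[sr si]; case: z => x y; apply/eqP; rewrite eq_complex/=.
apply/andP; split; apply/eqP.
- rewrite -!rsumZ// -rsumN -rsumD ?rsummableN ?rsummableZ//.
  by congr rsum; apply/funext => t; case: (h t).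
- rewrite -!rsumZ// -rsumD ?rsummableZ//.
  by congr rsum; apply/funext => t; case: (h t).
Qed.

Lemma csum_conj h : csum (fun t => conjC (h t)) = conjC (csum h).
Proof.
apply/eqP; rewrite eq_complex/= -rsumN; apply/andP; split; apply/eqP; congr rsum.
- by apply/funext => t; case: (h t).
- by apply/funext => t; case: (h t).
Qed.

End summation.


Section inner_product_norm.
Variables (R : realType) (V : lmodType R[i]) (ip : {dot V for conjC}).
Implicit Types x y : V.

Definition hnorm x : R := Num.sqrt (complex.Re (ip x x)).

Lemma Re_ip_ge0 x : 0 <= complex.Re (ip x x).
Proof. by have := dnorm_ge0 ip x; rewrite lecE => /andP[]. Qed.

Lemma Im_ip_eq0 x : complex.Im (ip x x) = 0.
Proof. by have := dnorm_ge0 ip x; rewrite lecE => /andP[/eqP]. Qed.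

Lemma sqr_hnorm x : hnorm x ^+ 2 = complex.Re (ip x x).
Proof. by rewrite sqr_sqrtr// Re_ip_ge0. Qed.

Lemma ip_conj x y : ip x y = conjC (ip y x).
Proof. by have := hermC ip x y; rewrite expr0 mul1r. Qed.

Lemma Re_ipD x y : complex.Re (ip (x + y) (x + y)) =
  complex.Re (ip x x) + complex.Re (ip y y) + complex.Re (ip x y) *+ 2.
Proof.
rewrite dnormD; move: (ip x x) (ip y y) (ip x y) => [a b] [c d] [e f] /=.
by rewrite mulr2n.
Qed.

Lemma Re_ip_le x y : `|complex.Re (ip x y)| <= hnorm x ^+ 2 + hnorm y ^+ 2.
Proof.
rewrite !sqr_hnorm; have := Re_ip_ge0 (x + y); rewrite Re_ipD => h1.
have := Re_ip_ge0 (x + - y); rewrite Re_ipD linearNl linearNr opprK linearNr.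
have -> : complex.Re (- ip x y) = - complex.Re (ip x y) by case: (ip x y).
have := Re_ip_ge0 x; have := Re_ip_ge0 y.
move: (complex.Re _) (complex.Re (ip y y)) (complex.Re (ip x y)) h1 => a b c.
rewrite ler_norml; lra.
Qed.

Lemma Im_ip_le x y : `|complex.Im (ip x y)| <= hnorm x ^+ 2 + hnorm y ^+ 2.
Proof.
have := Re_ip_le x ('i%C *: y); rewrite !sqr_hnorm dnormZ linearZr_LR /=.
have -> : `|'i%C : R[i]| = 1 by rewrite normc_def /= expr0n expr1n add0r sqrtr1.
rewrite expr1n mul1r.
suff -> : complex.Re (conjC 'i%C * ip x y) = complex.Im (ip x y) by [].
by case: (ip x y) => a b /=; rewrite mul0r mulN1r opprK add0r.
Qed.

Lemma sqr_hnorm_lin (k : R[i]) x y : hnorm (k *: x + y) ^+ 2 <=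
  3 * (complex.Re (`|k| ^+ 2) * hnorm x ^+ 2 + hnorm y ^+ 2).
Proof.
have -> : complex.Re (`|k| ^+ 2) * hnorm x ^+ 2 = hnorm (k *: x) ^+ 2.
  rewrite !sqr_hnorm dnormZ normc_def -rmorphXn; case: (ip x x) => a b /=.
  by rewrite mul0r subr0.
have := Re_ip_le (k *: x) y; rewrite ler_norml !sqr_hnorm Re_ipD => /andP[_].
lra.
Qed.

End inner_product_norm.


Section l2.
Variables (R : realType) (T : choiceType) (V : lmodType R[i]).
Variable (ip : {dot V for conjC}).

Definition square_summable : {pred T -> V} := fun f =>
  (\esum_(t in setT) (hnorm ip (f t) ^+ 2)%:E < +oo)%E.

Lemma square_summable_submod : GRing.submod_closed square_summable.
Proof.
split=> [|k f g]; rewrite !unfold_in.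
  rewrite esum1 ?ltry// => t _.
  by rewrite sqr_hnorm linear0r.
move=> sf sg.
pose c := complex.Re (`|k| ^+ 2).
have c0 : 0 <= c by rewrite /c normc_def -rmorphXn /= sqr_ge0.
apply: (@le_lt_trans _ _ (\esum_(t in setT)
   (3%:E * (c%:E * (hnorm ip (f t) ^+ 2)%:E + (hnorm ip (g t) ^+ 2)%:E)))%E).
  by apply: le_esum => t _; rewrite lee_fin sqr_hnorm_lin.
have f0 t : (0 <= (hnorm ip (f t) ^+ 2)%:E)%E by rewrite lee_fin sqr_ge0.
have g0 t : (0 <= (hnorm ip (g t) ^+ 2)%:E)%E by rewrite lee_fin sqr_ge0.
have cf0 t : (0 <= c%:E * (hnorm ip (f t) ^+ 2)%:E)%E by rewrite mule_ge0.
rewrite esumZ//; last by move=> t; rewrite adde_ge0.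
rewrite esumD// esumZ//.
by rewrite lte_mul_pinfty// lte_add_pinfty// lte_mul_pinfty.
Qed.

HB.instance Definition _ :=
  GRing.isSubmodClosed.Build R[i] (T -> V) square_summable square_summable_submod.

(* Square summable functions from [T] to the inner product space [V]. *)
Record l2 := L2 { l2fun :> T -> V; l2funP : l2fun \in square_summable }.

HB.instance Definition _ := [isSub for l2fun].
HB.instance Definition _ := [Choice of l2 by <:].
HB.instance Definition _ := [SubChoice_isSubLmodule of l2 by <:].

Definition l2_ip (f g : l2) : R[i] := csum (fun t => ip (f t) (g t)).

Lemma l2_ip_summable (f g : l2) : csummable (fun t => ip (f t) (g t)).
Proof.
have f0 (h : l2) t : (0 <= (hnorm ip (h t) ^+ 2)%:E)%E by rewrite lee_fin sqr_ge0.
have fg : (\esum_(t in setT) (hnorm ip (f t) ^+ 2 + hnorm ip (g t) ^+ 2)%:E < +oo)%E.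
  under eq_esum do rewrite EFinD.
  by rewrite esumD// lte_add_pinfty//; [exact: (l2funP f)|exact: (l2funP g)].
apply/andP; split; apply: rsummable_le fg => t.
- exact: Re_ip_le.
- exact: Im_ip_le.
Qed.

Lemma l2_ip_linear (h : l2) : scalar (l2_ip ^~ h).
Proof.
move=> k f g; rewrite /l2_ip -csumZ ?l2_ip_summable// -csumD.
- by congr csum; apply/funext => t; rewrite linearPl.
- by apply: csummableZ; exact: l2_ip_summable.
- exact: l2_ip_summable.
Qed.

Lemma l2_ip_herm (f g : l2) : l2_ip f g = (-1) ^+ false * conjC (l2_ip g f).
Proof.
rewrite expr0 mul1r -csum_conj; congr csum.
by apply/funext => t; exact: ip_conj.
Qed.

Lemma l2_ip_bilinear : bilinear_for
  (GRing.Scale.Law.clone _ _ *%R _) (GRing.Scale.Law.clone _ _ (conjC \; *%R) _)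
  l2_ip.
Proof.
split=> [h|f] k u v /=; first exact: l2_ip_linear.
rewrite l2_ip_herm expr0 mul1r l2_ip_linear rmorphD rmorphM.
by rewrite [in RHS](l2_ip_herm f u) [in RHS](l2_ip_herm f v) expr0 !mul1r.
Qed.

HB.instance Definition _ := bilinear_isBilinear.Build R[i] l2 l2 R[i] _ _ l2_ip
  l2_ip_bilinear.
HB.instance Definition _ := isHermitianSesquilinear.Build R[i] l2 false conjC
  l2_ip l2_ip_herm.

Lemma l2_ip_pos (f : l2) : f != 0 -> 0 < l2_ip f f.
Proof.
move=> f0; have [t ft] : exists t, f t != 0.
  apply: contrapT => /forallNP h; move: f0; apply/negP; rewrite negbK.
  apply/eqP/val_inj/funext => t /=; apply/eqP; rewrite -[_ == _]negbK.
  by apply/negP; exact: h.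
have hf s : 0 <= complex.Re (ip (f s) (f s)) by exact: Re_ip_ge0.
have -> : l2_ip f f = (fine (\esum_(s in setT) (complex.Re (ip (f s) (f s)))%:E))%:C%C.
  rewrite -ge0_rsum// /l2_ip /csum; congr (_ +i* _)%C.
  rewrite ge0_rsum ?esum1// => s; rewrite Im_ip_eq0//.
rewrite ltcE/= eqxx/= fine_gt0//; apply/andP; split.
  apply: lt_le_trans (_ : (0 < (complex.Re (ip (f t) (f t)))%:E)%E) _.
    by rewrite lte_fin; have := ft; rewrite -(dnorm_gt0 ip) ltcE => /andP[].
  rewrite -(@esum_set1 _ _ t (fun s => (complex.Re (ip (f s) (f s)))%:E)) ?lee_fin//.
  rewrite [leRHS](esumID [set t])//; last by move=> s _; rewrite lee_fin.
  rewrite setTI leeDl// esum_ge0// => s _; rewrite lee_fin//.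
have := l2funP f; rewrite unfold_in.
by under eq_esum do rewrite sqr_hnorm.
Qed.

HB.instance Definition _ := isDotProduct.Build R[i] l2 l2_ip l2_ip_pos.

(* [to_l2 f] is [f] when [f] is square summable, and 0 otherwise. *)
Definition to_l2 (f : T -> V) : l2 := insubd (0 : l2) f.

End l2.

Section operators.
Variables (R : realType) (V : lmodType R[i]) (ip : {dot V for conjC}).
Implicit Types (T : V -> V) (D : set V).

Definition hilbert_complete : Prop := forall u : nat -> V,
  (forall e : R, 0 < e -> exists N, forall m n, (N <= m)%N -> (N <= n)%N ->
    hnorm ip (u m - u n) < e) ->
  exists l, (fun n => hnorm ip (u n - l)) @ \oo --> (0 : R).

(* Operator norm of the restriction of [T] to the subspace [D]. *)
Definition opnorm D T : \bar R :=
  ereal_sup [set (hnorm ip (T x))%:E | x in [set x | D x /\ hnorm ip x <= 1]].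

Definition bounded_operator T : Prop :=
  linear T /\ (opnorm setT T < +oo)%E.

Definition adjoint T T' : Prop := forall x y, ip (T x) y = ip x (T' y).

Definition compact_operator T : Prop := linear T /\
  forall u : nat -> V, (exists M, forall n, hnorm ip (u n) <= M) ->
  exists (s : nat -> nat) (l : V), {homo s : m n / (m < n)%N} /\
    (fun n => hnorm ip (T (u (s n)) - l)) @ \oo --> (0 : R).

(* In what follows, an unbounded operator is given by its domain [dom] and a
   total function whose values outside [dom] are irrelevant. *)
Definition self_adjoint (dom : set V) T : Prop :=
  [/\ dom 0,
      (forall k x y, dom x -> dom y ->
         dom (k *: x + y) /\ T (k *: x + y) = k *: T x + T y),
      (forall x (e : R), 0 < e -> exists2 y, dom y & hnorm ip (x - y) < e) &
      (forall y w, (dom y /\ T y = w) <->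
         (forall x, dom x -> ip (T x) y = ip x w))].

Definition compact_resolvent (dom : set V) T : Prop :=
  exists (z : R[i]) (S : V -> V), [/\ compact_operator S,
    (forall x, dom (S x) /\ T (S x) - z *: S x = x) &
    (forall x, dom x -> S (T x - z *: x) = x)].

Definition norm_closure (B : set (V -> V)) : set (V -> V) :=
  [set a | bounded_operator a /\
     forall e : R, 0 < e -> exists2 b, B b & (opnorm setT (a - b)%R < e%:E)%E].

Definition star_algebra (B : set (V -> V)) : Prop :=
  [/\ B `<=` bounded_operator, B 0,
      (forall k a b, B a -> B b -> B (k *: a + b)),
      (forall a b, B a -> B b -> B (a \o b)) &
      (forall a, B a -> exists2 b, B b & adjoint a b)].

Definition unital_cstar_algebra (A : set (V -> V)) : Prop :=
  [/\ star_algebra A, A idfun & norm_closure A `<=` A].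

Definition preserves (dom : set V) T : Prop := forall x, dom x -> dom (T x).

Definition commutator T T' : V -> V := fun x => T (T' x) - T' (T x).

End operators.

Section states.
Variables (R : realType) (K : lmodType R[i]) (ipK : {dot K for conjC}).
Variable A : set (K -> K).

(* Linearity, positivity on the elements a^* a, and value 1 at the unit. *)
Definition is_state (phi : A -> R[i]) : Prop :=
  [/\ (forall k (a b c : A), \val c = k *: \val a + \val b ->
         phi c = k * phi a + phi b),
      (forall a b c : A, adjoint ipK (\val a) (\val b) ->
         \val c = \val b \o \val a -> 0 <= phi c) &
      (forall a : A, \val a = idfun -> phi a = 1)].

(* As a type, the state space carries the topology of pointwise convergence
   on [A], which is the weak-* topology. *)
Definition state_space : set {ptws A -> R[i]^o} := [set phi | is_state phi].

End states.

Arguments state_space {R K} ipK A.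

Definition is_metric (R : realType) (S : Type) (m : S -> S -> \bar R) : Prop :=
  [/\ (forall x y, (0 <= m x y < +oo)%E),
      (forall x y, m x y = 0%E <-> x = y),
      (forall x y, m x y = m y x) &
      (forall x y z, (m x z <= m x y + m y z)%E)].

Definition metrizes (R : realType) (S : topologicalType) (m : S -> S -> \bar R)
  : Prop :=
  forall U : set S, open U <->
    (forall x, U x -> exists2 e : R, 0 < e & forall y, (m x y < e%:E)%E -> U y).

Section spectral_triples.
Variables (R : realType) (K H : lmodType R[i]).
Variables (ipK : {dot K for conjC}) (ipH : {dot H for conjC}).
(* [A] is a C*-algebra of operators on [K], represented on [H] by [pi]. *)
Variables (A : set (K -> K)) (pi : (K -> K) -> (H -> H)).
Variables (dom : set H) (D : H -> H).

Definition unital_star_representation : Prop :=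
  [/\ (forall a, A a -> bounded_operator ipH (pi a)),
      (forall k a b, A a -> A b -> pi (k *: a + b) = k *: pi a + pi b),
      (forall a b, A a -> A b -> pi (a \o b) = pi a \o pi b),
      (forall a b, A a -> A b -> adjoint ipK a b -> adjoint ipH (pi a) (pi b)) &
      pi idfun = idfun].

Definition lipschitz : set (K -> K) :=
  [set a | [/\ A a, preserves dom (pi a) &
               (opnorm ipH dom (commutator D (pi a)) < +oo)%E]].

Definition spectral_triple : Prop :=
  [/\ [/\ hilbert_complete ipK, unital_cstar_algebra ipK A,
          hilbert_complete ipH & unital_star_representation],
      self_adjoint ipH dom D,
      compact_resolvent ipH dom D &
      exists2 B : set (K -> K), star_algebra ipK B &
        B `<=` lipschitz /\ A `<=` norm_closure ipK B].

(* Monge-Kantorovich extended pseudo-metric. *)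
Definition mk_metric (phi psi : A -> R[i]) : \bar R :=
  ereal_sup [set (complex.Re `|phi a - psi a|)%:E | a in
    [set a : A | preserves dom (pi (\val a)) /\
                 (opnorm ipH dom (commutator D (pi (\val a))) <= 1)%E]].

Definition metric_spectral_triple : Prop :=
  let m := fun phi psi : state_space ipK A => mk_metric (\val phi) (\val psi) in
  [/\ spectral_triple, is_metric m & metrizes m].

End spectral_triples.

Section scalar_product.
Variable R : realType.

Definition cip (x y : R[i]^o) : R[i] := x * conjC y.

Lemma cip_bilinear : bilinear_for
  (GRing.Scale.Law.clone _ _ *%R _) (GRing.Scale.Law.clone _ _ (conjC \; *%R) _)
  cip.
Proof.
split=> [z|z] k x y; rewrite /cip /= /GRing.scale /=.
  by rewrite mulrDl mulrA.
by rewrite rmorphD rmorphM mulrDr mulrCA.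
Qed.

Lemma cip_herm x y : cip x y = (-1) ^+ false * conjC (cip y x).
Proof. by rewrite expr0 mul1r /cip -{1}[x](@conjCK R[i]) mulrC -rmorphM. Qed.

Lemma cip_pos x : x != 0 -> 0 < cip x x.
Proof. by move=> x0; rewrite /cip mul_conjC_gt0. Qed.

HB.instance Definition _ := bilinear_isBilinear.Build R[i] R[i]^o R[i]^o R[i]
  _ _ cip cip_bilinear.
HB.instance Definition _ := isHermitianSesquilinear.Build R[i] R[i]^o false
  conjC cip cip_herm.
HB.instance Definition _ := isDotProduct.Build R[i] R[i]^o cip cip_pos.

End scalar_product.

Notation "''l2' ( T ; R )" := (l2 T (@cip R))
  (at level 8, format "''l2' ( T ;  R )") : type_scope.

(* For a Hermitian space [E], the Hilbert space l^2(T) (x) E is the space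
   [l2 T ipE] of square summable functions from [T] to [E], with f (x) e being
   the function t |-> f t *: e. *)
Section tensor.
Variables (R : realType) (T : choiceType).
Variables (E : vectType R[i]) (ipE : {dot E for conjC}).

Definition tensor (f : 'l2(T; R)) (e : E) : l2 T ipE :=
  to_l2 ipE (fun t => f t *: e).

(* Coordinates in a fixed basis (e_i) of [E]: psi is the sum over i of the
   [tensor (l2_coord i psi) e_i]. *)
Definition l2_coord (i : 'I_(\dim {:E})) (psi : l2 T ipE) : 'l2(T; R) :=
  to_l2 (@cip R) (fun t => coord (vbasis {:E}) i (psi t)).

(* S (x) g; for linear [S] and [g] it does not depend on the basis. *)
Definition tensor_op (S : 'l2(T; R) -> 'l2(T; R)) (g : E -> E)
    (psi : l2 T ipE) : l2 T ipE :=
  \sum_(i < \dim {:E}) tensor (S (l2_coord i psi)) (g (vbasis {:E})`_i).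

(* The algebraic tensor product of [D] and [E], when [D] is a subspace. *)
Definition tensor_dom (D : set 'l2(T; R)) : set (l2 T ipE) :=
  [set psi | forall i, D (l2_coord i psi)].

(* Multiplication by a real function [w], on the domain where [w f] is square
   summable. *)
Definition mul_op (w : T -> R) (f : 'l2(T; R)) : 'l2(T; R) :=
  to_l2 (@cip R) (fun t => (w t)%:C%C * f t).

End tensor.

Section twisted_group_algebra.
Variables (R : realType) (G : zmodType) (sigma : G -> G -> R[i]).

Definition circle_cocycle : Prop :=
  (forall g h, `|sigma g h| = 1) /\
  (forall g h k, sigma g h * sigma (g + h) k = sigma g (h + k) * sigma h k).

Definition normalized_cocycle : Prop := forall g, sigma g (- g) = 1.

Definition lambda (g : G) (xi : 'l2(G; R)) : 'l2(G; R) :=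
  to_l2 (@cip R) (fun h => sigma g (h - g) * xi (h - g)).

(* Integrated form of [lambda] on finitely supported functions. *)
Definition lambda_fs (f : {fsfun G -> R[i] with 0}) : 'l2(G; R) -> 'l2(G; R) :=
  fun xi => \sum_(g <- finsupp f) f g *: lambda g xi.

Definition twisted_cstar : set ('l2(G; R) -> 'l2(G; R)) :=
  norm_closure (@l2_ip R G _ (@cip R)) (range lambda_fs).

End twisted_group_algebra.

Section Zinv.
Variable p : nat.

Definition Zinv_pred : {pred rat} :=
  fun q => `[< exists (m : int) (n : nat), q = m%:~R / p%:R ^+ n >].

Lemma Zinv_zmod_closed : zmod_closed Zinv_pred.
Proof.
split; first by apply/asboolP; exists 0, 0%N; rewrite mul0r.
move=> x y /asboolP[m [n ->]] /asboolP[m' [n' ->]]; apply/asboolP.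
have [p0|p0] := eqVneq p 0%N; last first.
  have pn k : (p%:R ^+ k : rat) != 0 by rewrite expf_neq0// pnatr_eq0.
  exists (m * p%:Z ^+ n' - m' * p%:Z ^+ n), (n + n')%N.
  rewrite rmorphB !rmorphM !rmorphXn /= exprD -!pmulrn.
  have := pn n; have := pn n'; move: (_ ^+ n) (_ ^+ n') => a b b0 a0.
  by field; rewrite a0 b0.
subst p.
have H (k : int) (l : nat) : exists r : int, k%:~R / (0%:R : rat) ^+ l = r%:~R.
  case: l => [|l]; first by exists k; rewrite expr0 divr1.
  by exists 0; rewrite exprS mul0r invr0 mulr0.
have [r ->] := H m n; have [r' ->] := H m' n'.
by exists (r - r'), 0%N; rewrite expr0 divr1 rmorphB.
Qed.

HB.instance Definition _ :=
  GRing.isZmodClosed.Build rat Zinv_pred Zinv_zmod_closed.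

(* The additive group Z[1/p]. *)
Record Zinv := MkZinv { Zinv_val :> rat; ZinvP : Zinv_val \in Zinv_pred }.

HB.instance Definition _ := [isSub for Zinv_val].
HB.instance Definition _ := [Choice of Zinv by <:].
HB.instance Definition _ := [SubChoice_isSubZmodule of Zinv by <:].

End Zinv.

Section Ginf.
Variables (R : realType) (p d : nat).

Definition Ginf := 'rV[Zinv p]_d.
HB.instance Definition _ := GRing.Zmodule.on Ginf.

Definition clears (z : Ginf) : pred nat := fun n =>
  [forall j, p%:R ^+ n * Zinv_val (z 0 j) \is a Num.int].

Lemma clears_ex (z : Ginf) : exists n, clears z n.
Proof.
have int_ex (x : Zinv p) : exists n, p%:R ^+ n * Zinv_val x \is a Num.int.
  case: x => q /= /asboolP[m [n ->]].
  have [p0|p0] := eqVneq (p%:R ^+ n : rat) 0.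
    by exists 0%N; rewrite p0 invr0 !mulr0.
  by exists n; rewrite mulrCA mulfV// mulr1.
have /choice[f fP] j := int_ex (z 0 j).
exists (\sum_j f j)%N; apply/forallP => j.
rewrite (bigD1 j)//= addnC exprD -mulrA; apply: rpredM => //.
by apply: rpredX; apply: rpred_nat.
Qed.

Definition Fmin (z : Ginf) : nat := (p ^ ex_minn (clears_ex z))%N.

Definition xcoord (j : 'I_d) (z : Ginf) : R := ratr (Zinv_val (z 0 j)).

Definition Ffun (z : Ginf) : R := (Fmin z)%:R.

Definition Lfun (z : Ginf) : R :=
  Num.sqrt (\sum_(j < d) `|xcoord j z| ^+ 2 + Ffun z ^+ 2).

Definition Hdom : set 'l2(Ginf; R) :=
  [set f | (\esum_(z in setT) (Lfun z ^+ 2 * complex.Re `|f z| ^+ 2)%:E < +oo)%E].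

End Ginf.

Section Dirac.
Variables (R : realType) (p d : nat).
Variables (E : vectType R[i]) (ipE : {dot E for conjC}).
Variable gamma : 'I_d.+1 -> 'End(E).

Definition anticommuting_self_adjoint_unitaries : Prop :=
  [/\ (forall j x y, ipE (gamma j x) y = ipE x (gamma j y)),
      (forall j x y, ipE (gamma j x) (gamma j y) = ipE x y),
      (forall j y, exists x, gamma j x = y) &
      (forall j k, j != k -> forall x,
         gamma j (gamma k x) = - gamma k (gamma j x))].

Definition Dinf_dom : set (l2 (Ginf p d) ipE) := tensor_dom (@Hdom R p d).

Definition Dinf (psi : l2 (Ginf p d) ipE) : l2 (Ginf p d) ipE :=
  \sum_(j < d) tensor_op (mul_op (@xcoord R p d j))
                         (gamma (widen_ord (leqnSn d) j)) psi
  + tensor_op (mul_op (@Ffun R p d)) (gamma ord_max) psi.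

(* The action a |-> a (x) 1_E. *)
Definition amplification (a : 'l2(Ginf p d; R) -> 'l2(Ginf p d; R)) :
    l2 (Ginf p d) ipE -> l2 (Ginf p d) ipE :=
  tensor_op a idfun.

End Dirac.

(* Main.v *)
Require Import Defs.
From mathcomp Require Import all_boot all_order all_algebra finmap.
From mathcomp Require Import all_classical all_reals all_analysis.
From mathcomp Require Import complex ring lra zify.

Set Implicit Arguments.
Unset Strict Implicit.
Unset Printing Implicit Defensive.

Import Order.TTheory GRing.Theory Num.Theory Num.Def.
Import numFieldNormedType.Exports.
Local Open Scope classical_set_scope.
Local Open Scope ring_scope.

(** A spectral triple on a unital C*-algebra of bounded operators is metric as soon as
the Lipschitz elements are dense and, for every e > 0, each
element of the Lipschitz ball is within e of a scalar plus a combination, with bounded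
coefficients, of finitely many fixed elements ([mk_metrizes]). Density makes the
Monge-Kantorovich metric finer than the weak-* topology, and the approximation makes
it finite and coarser, because it leaves only finitely many values of a state to be
controlled. Both directions use that states are contractions ([state_contract]),
which is obtained from square roots of 1 - h in the algebra ([cstar_sqrt]).

Here the fixed elements are the translations lambda(g). Let G be the group, and let a
belong to the twisted algebra with commutator of norm at most 1. Its matrix is
sigma(x - y, y) k(x - y) for the function k given by its column at 0
([kern_twisted]), so that everything is a question about cutting off k. Pairing the
commutator with vectors v and gamma_j v, in both orders, isolates by the Clifford
relations each of the matrices (x_j(x) - x_j(y)) a(x, y) and (F(x) - F(y)) a(x, y):
all of them define contractions ([commutator_kbound]). Two cut-offs follow, both by
the same estimate on Schur multipliers ([kbound_schur]): if row x of a matrix is row x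
of T_i, i = f(x), multiplied by a vector psi_i, where the T_i have norm at most C and
the sum over i of psi_i(y)^2 is at most B for all y, then the matrix has norm at most
C times the square root of B.

- Denominators. Let G_m be the subgroup of elements with denominators dividing p^m.
From G_(m+1) minus G_m to G_m the commutator with F multiplies entries by F(x) - p^(m+1),
of size at least p^m, so this corner of a has norm at most p^(-m). Translations move
the corner to the other cosets of G_m, and p^d of these make up a coset of G_(m+1).
Hence the entries with x - y in G_(m+1) minus G_m form a matrix of norm at most
p^(d/2) / p^m ([kbound_level_step]), and summing over m at least n makes the part of k
outside G_n small ([kbound_level_tail]).

- Coordinates. On G_n the j-th coordinate takes values in a lattice, where the
reciprocals of the large values are square summable with small sum. Dividing the
commutator with x_j by the coordinate difference bounds the entries with a large
difference ([kbound_coord_tail]). The retained entries still have controlled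
commutators with the other coordinates, and the coordinates are treated one after the
other ([kbound_box]).

What remains is supported in a finite set W that does not depend on a
([twk_precompact], [box_finite]). Its coefficients at nonzero g are bounded, since the
commutator with some nonzero coordinate of g multiplies them by that coordinate; the
coefficient at 0 is the scalar ([lip_ball_precompact]).

The axioms of a spectral triple hold because the Dirac operator is fibrewise Clifford
multiplication by the vector of weights (x_1, ..., x_d, F), whose square is
multiplication by L^2. Self-adjointness is then checked at each point
([wdirac_self_adjoint]), and the inverse is compact since L has finite sublevel sets
([len_proper], [wdirac_compact_resolvent]). Translation by g changes each weight by
at most L(g), so finite sums of translations are Lipschitz ([lip_bound_lambda]). *)

(** * Moduli of complex numbers and norms of inner product spaces *)
Section modulus.
Variable R : realType.
Implicit Types z w : R[i].

Definition cabs z : R := complex.Re `|z|.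

Lemma realcM (a b : R) : ((a * b)%:C = a%:C * b%:C :> R[i])%C.
Proof. exact: rmorphM. Qed.
Lemma realcD (a b : R) : ((a + b)%:C = a%:C + b%:C :> R[i])%C.
Proof. exact: raddfD. Qed.
Lemma realcB (a b : R) : ((a - b)%:C = a%:C - b%:C :> R[i])%C.
Proof. exact: raddfB. Qed.

Lemma cabsE z : (cabs z)%:C%C = `|z|.
Proof. by rewrite /cabs normc_def. Qed.

Lemma cabs_ge0 z : 0 <= cabs z.
Proof. by rewrite /cabs normc_def /= sqrtr_ge0. Qed.

Lemma cabsM z w : cabs (z * w) = cabs z * cabs w.
Proof. by apply: complexI; rewrite rmorphM /= !cabsE normrM. Qed.

Lemma cabsD z w : cabs (z + w) <= cabs z + cabs w.
Proof. by rewrite -lecR rmorphD /= !cabsE ler_normD. Qed.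

Lemma cabsN z : cabs (- z) = cabs z.
Proof. by rewrite /cabs normrN. Qed.

Lemma cabsB z w : cabs (z - w) <= cabs z + cabs w.
Proof. by rewrite -(cabsN w) cabsD. Qed.

Lemma cabsC z w : cabs (z - w) = cabs (w - z).
Proof. by rewrite -cabsN opprB. Qed.

Lemma cabs0 : cabs 0 = 0. Proof. by rewrite /cabs normr0. Qed.

Lemma cabs1 : cabs 1 = 1. Proof. by rewrite /cabs normr1. Qed.

Lemma cabs_eq0 z : (cabs z == 0) = (z == 0).
Proof. by rewrite -(inj_eq (@complexI R)) cabsE normr_eq0. Qed.

Lemma cabs_real (x : R) : cabs x%:C%C = `|x|.
Proof. by rewrite /cabs normc_def /= expr0n addr0 sqrtr_sqr. Qed.

Lemma cabs_conj z : cabs (conjC z) = cabs z.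
Proof. by rewrite /cabs norm_conjC. Qed.

Lemma conjC_real (x : R) : conjC (x%:C%C : R[i]) = x%:C%C.
Proof. by apply/eqP; rewrite eq_complex /= oppr0 !eqxx. Qed.

Lemma mul_conj z : z * conjC z = (cabs z ^+ 2)%:C%C.
Proof. by rewrite rmorphXn /= cabsE normCK. Qed.

Lemma cabs_sqr z : cabs z ^+ 2 = complex.Re z ^+ 2 + complex.Im z ^+ 2.
Proof. by rewrite /cabs normc_def /= sqr_sqrtr// addr_ge0// sqr_ge0. Qed.

Lemma Re_le_cabs z : `|complex.Re z| <= cabs z.
Proof.
by rewrite -(ler_pXn2r (ltn0Sn 1)) ?nnegrE ?cabs_ge0// cabs_sqr real_normK ?num_real// lerDl sqr_ge0.
Qed.

Lemma Im_le_cabs z : `|complex.Im z| <= cabs z.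
Proof.
by rewrite -(ler_pXn2r (ltn0Sn 1)) ?nnegrE ?cabs_ge0// cabs_sqr real_normK ?num_real// lerDr sqr_ge0.
Qed.

Lemma cabs_le_ReIm z : cabs z <= `|complex.Re z| + `|complex.Im z|.
Proof.
rewrite -(ler_pXn2r (ltn0Sn 1)) ?nnegrE ?cabs_ge0 ?addr_ge0// cabs_sqr.
rewrite -(real_normK (num_real (complex.Re z))) -(real_normK (num_real (complex.Im z))).
have := normr_ge0 (complex.Re z); have := normr_ge0 (complex.Im z).
by move: `|_| `|_| => a b; nra.
Qed.

Lemma cabs_sum (I : Type) (r : seq I) (P : pred I) (F : I -> R[i]) :
  cabs (\sum_(i <- r | P i) F i) <= \sum_(i <- r | P i) cabs (F i).
Proof.
elim/big_rec2: _ => [|i y x _ h]; first by rewrite cabs0.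
by apply: le_trans (cabsD _ _) _; rewrite lerD2l.
Qed.

Lemma le_cabs_eq0 z : (forall e : R, 0 < e -> cabs z <= e) -> z = 0.
Proof.
move=> h; apply/eqP; rewrite -cabs_eq0 eq_le cabs_ge0 andbT.
by apply/ler_addgt0Pl => e e0; rewrite addr0 h.
Qed.

End modulus.

Section hnorm_theory.
Variables (R : realType) (V : lmodType R[i]) (ip : {dot V for conjC}).
Implicit Types x y : V.
Local Notation N := (hnorm ip).

Lemma hnorm_ge0 x : 0 <= N x. Proof. exact: sqrtr_ge0. Qed.

Lemma ipxx x : ip x x = (N x ^+ 2)%:C%C.
Proof.
rewrite sqr_hnorm; apply/eqP; rewrite eq_complex /= eqxx /=.
by rewrite Im_ip_eq0.
Qed.

Lemma hnorm0 : N 0 = 0.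
Proof. by rewrite /hnorm linear0l sqrtr0. Qed.

Lemma hnorm_eq0 x : (N x == 0) = (x == 0).
Proof.
by rewrite -(dnorm_eq0 ip) ipxx fmorph_eq0 sqrf_eq0.
Qed.

Lemma nrmZ k x : N (k *: x) = cabs k * N x.
Proof.
apply/eqP; rewrite -(eqrXn2 (ltn0Sn 1)) ?mulr_ge0 ?cabs_ge0 ?hnorm_ge0//.
apply/eqP/complexI; rewrite -ipxx dnormZ exprMn rmorphM /= -ipxx.
by rewrite rmorphXn /= cabsE.
Qed.

Lemma nrmN x : N (- x) = N x.
Proof. by rewrite -scaleN1r nrmZ cabsN cabs1 mul1r. Qed.

Lemma nrmC x y : N (x - y) = N (y - x).
Proof. by rewrite -nrmN opprB. Qed.

Lemma ipZl k x y : ip (k *: x) y = k * ip x y.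
Proof. exact: linearZl_LR. Qed.

Lemma ipZr k x y : ip x (k *: y) = conjC k * ip x y.
Proof. by rewrite linearZr_LR. Qed.

Lemma ip0l x : ip 0 x = 0. Proof. exact: linear0l. Qed.
Lemma ip0r x : ip x 0 = 0. Proof. exact: linear0r. Qed.
Lemma ipDl x y z : ip (x + y) z = ip x z + ip y z. Proof. exact: linearDl. Qed.
Lemma ipDr x y z : ip x (y + z) = ip x y + ip x z. Proof. exact: linearDr. Qed.
Lemma ipBl x y z : ip (x - y) z = ip x z - ip y z. Proof. exact: linearBl. Qed.
Lemma ipBr x y z : ip x (y - z) = ip x y - ip x z. Proof. exact: linearBr. Qed.

Lemma cauchy_schwarz x y : cabs (ip x y) <= N x * N y.
Proof.
rewrite -(ler_pXn2r (ltn0Sn 1)) ?nnegrE ?mulr_ge0 ?cabs_ge0 ?hnorm_ge0// exprMn.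
have [->|y0] := eqVneq y 0.
  by rewrite linear0r cabs0 expr0n mulr_ge0 ?sqr_ge0.
have n0 : 0 < N y ^+ 2 by rewrite exprn_gt0// lt_def hnorm_eq0 y0 hnorm_ge0.
move: (N y ^+ 2) n0 (ipxx y) => n n0 yy.
set c := ip x y; have yx : ip y x = conjC c by rewrite ip_conj.
suff : 0 <= n * (n * N x ^+ 2 - cabs c ^+ 2) by rewrite pmulr_rge0// subr_ge0 mulrC.
rewrite -ler0c; have := dnorm_ge0 ip (n%:C%C *: x - c *: y); congr (_ <= _).
rewrite ipBl !ipBr !ipZl !ipZr -/c yx ipxx yy conjC_real.
by rewrite (realcM n (_ - _)) realcB (realcM n (_ ^+ _)) -mul_conj; ring.
Qed.

Lemma nrmD x y : N (x + y) <= N x + N y.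
Proof.
rewrite -(ler_pXn2r (ltn0Sn 1)) ?nnegrE ?addr_ge0 ?hnorm_ge0//.
rewrite sqr_hnorm Re_ipD -!sqr_hnorm sqrrD.
have := cauchy_schwarz x y; have := Re_le_cabs (ip x y).
rewrite ler_norml => /andP[_ h1] h2; rewrite addrAC lerD2r lerD2l lerMn2r/=.
exact: le_trans h1 h2.
Qed.

Lemma nrmB x y : N (x - y) <= N x + N y.
Proof. by rewrite -(nrmN y) nrmD. Qed.

Lemma nrm_tri z x y : N (x - y) <= N (x - z) + N (z - y).
Proof. by apply: le_trans (nrmD _ _); rewrite addrA subrK. Qed.

Lemma nrm_sum (I : Type) (r : seq I) (P : pred I) (F : I -> V) :
  N (\sum_(i <- r | P i) F i) <= \sum_(i <- r | P i) N (F i).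
Proof.
elim/big_rec2: _ => [|i y x _ h]; first by rewrite hnorm0.
by apply: le_trans (nrmD _ _) _; rewrite lerD2l.
Qed.

Lemma hnorm_sub_eq0 x y : (forall e : R, 0 < e -> N (x - y) <= e) -> x = y.
Proof.
move=> h; apply/eqP; rewrite -subr_eq0 -hnorm_eq0 eq_le hnorm_ge0 andbT.
by apply/ler_addgt0Pl => e e0; rewrite addr0 h.
Qed.

Lemma ip_suml (I : Type) (r : seq I) (P : pred I) (F : I -> V) y :
  ip (\sum_(i <- r | P i) F i) y = \sum_(i <- r | P i) ip (F i) y.
Proof. by elim/big_rec2: _ => [|i a b _ <-]; rewrite ?ip0l ?ipDl. Qed.

Lemma ip_sumr (I : Type) (r : seq I) (P : pred I) (F : I -> V) y :
  ip y (\sum_(i <- r | P i) F i) = \sum_(i <- r | P i) ip y (F i).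
Proof. by elim/big_rec2: _ => [|i a b _ <-]; rewrite ?ip0r ?ipDr. Qed.

Lemma hnorm_cvg0 (u : nat -> R) : (forall n, 0 <= u n) ->
  u @ \oo --> (0 : R) <-> (forall e, 0 < e -> exists n, forall m, (n <= m)%N -> u m < e).
Proof.
move=> u0; split=> [/cvgrPdist_lt h e e0|h].
  have [n _ hn] := h e e0; exists n => m nm; have := hn m nm.
  by rewrite sub0r normrN ger0_norm.
apply/cvgrPdist_lt => e e0; have [n hn] := h e e0.
by exists n => // m nm /=; rewrite sub0r normrN ger0_norm// hn.
Qed.

End hnorm_theory.

(** * Bounded operators, adjoints and norm closures *)

Section operator_bounds.
Variables (R : realType) (V : lmodType R[i]) (ip : {dot V for conjC}).
Implicit Types (T a b : V -> V) (x y : V) (C e : R).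
Local Notation N := (hnorm ip).

Definition opbound T C : Prop := forall x, N (T x) <= C * N x.

Lemma opZE k a x : (k *: a) x = k *: a x. Proof. by []. Qed.
Lemma opDE a b x : (a + b) x = a x + b x. Proof. by []. Qed.
Lemma op_sumE (I : Type) (r : seq I) (F : I -> V -> V) x :
  (\sum_(i <- r) F i) x = \sum_(i <- r) F i x.
Proof. by elim/big_rec2: _ => [//|i y f _ <-]. Qed.

Lemma lin_0 T : linear T -> T 0 = 0.
Proof. by move=> l; have := l (-1) 0 0; rewrite scaler0 addr0 scaleN1r addNr. Qed.
Lemma lin_D T x y : linear T -> T (x + y) = T x + T y.
Proof. by move=> l; have := l 1 x y; rewrite !scale1r. Qed.
Lemma lin_Z T k x : linear T -> T (k *: x) = k *: T x.
Proof. by move=> l; have := l k x 0; rewrite (lin_0 l) !addr0. Qed.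
Lemma lin_N T x : linear T -> T (- x) = - T x.
Proof. by move=> l; rewrite -scaleN1r (lin_Z _ _ l) scaleN1r. Qed.
Lemma lin_B T x y : linear T -> T (x - y) = T x - T y.
Proof. by move=> l; rewrite (lin_D _ _ l) (lin_N _ l). Qed.
Lemma lin_sum T (I : Type) (r : seq I) (P : pred I) (F : I -> V) : linear T ->
  T (\sum_(i <- r | P i) F i) = \sum_(i <- r | P i) T (F i).
Proof.
by move=> l; elim/big_rec2: _ => [|i a b _ <-]; rewrite ?(lin_0 l) ?(lin_D _ _ l).
Qed.

Lemma linear_comp a b : linear a -> linear b -> linear (a \o b).
Proof. by move=> la lb k x y /=; rewrite lb la. Qed.
Lemma linear_lin k a b : linear a -> linear b -> linear (k *: a + b).
Proof.
move=> la lb c x y; rewrite !fctE la lb !scalerDr !scalerA mulrC.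
by rewrite addrACA.
Qed.
Lemma linear_sub a b : linear a -> linear b -> linear (a - b).
Proof.
by move=> la lb; have := linear_lin (-1) lb la; rewrite scaleN1r addrC.
Qed.

Lemma opbound_le T C C' : C <= C' -> opbound T C -> opbound T C'.
Proof. by move=> CC h x; apply: le_trans (h x) _; rewrite ler_wpM2r ?hnorm_ge0. Qed.

Lemma opbound_lt T C : (forall e, 0 < e -> opbound T (C + e)) -> opbound T C.
Proof.
move=> h x; apply/ler_addgt0Pr => e e0.
have n0 : 0 < N x + 1 by rewrite ltr_wpDl ?hnorm_ge0.
have := h (e / (N x + 1)) (divr_gt0 e0 n0) x => /le_trans; apply.
rewrite mulrDl lerD2l mulrAC ler_pdivrMr// ler_pM2l// lerDl ler01//.
Qed.

Lemma opbound0 : opbound 0 0. Proof. by move=> x; rewrite hnorm0 mul0r. Qed.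
Lemma opboundD a b C C' : opbound a C -> opbound b C' -> opbound (a + b) (C + C').
Proof.
by move=> ha hb x; rewrite fctE mulrDl; exact: le_trans (nrmD _ _ _) (lerD (ha x) (hb x)).
Qed.
Lemma opboundZ k a C : opbound a C -> opbound (k *: a) (cabs k * C).
Proof.
move=> ha x; rewrite fctE nrmZ -mulrA.
by rewrite ler_wpM2l ?cabs_ge0.
Qed.
Lemma opboundN a C : opbound a C -> opbound (- a) C.
Proof. by move=> ha x; rewrite fctE nrmN. Qed.
Lemma opboundB a b C C' : opbound a C -> opbound b C' -> opbound (a - b) (C + C').
Proof. by move=> ha hb; apply/opboundD/opboundN. Qed.
Lemma opbound_subC a b C : opbound (a - b) C -> opbound (b - a) C.
Proof. by move=> /opboundN; rewrite opprB. Qed.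
Lemma opbound_tri c a b C C' :
  opbound (a - c) C -> opbound (c - b) C' -> opbound (a - b) (C + C').
Proof. by move=> h h'; have := opboundD h h'; rewrite addrA subrK. Qed.
Lemma opbound_comp a b C C' : 0 <= C ->
  opbound a C -> opbound b C' -> opbound (a \o b) (C * C').
Proof.
move=> C0 ha hb x; apply: le_trans (ha _) _.
by rewrite -mulrA ler_wpM2l.
Qed.
Lemma opbound_sum (I : Type) (r : seq I) (F : I -> V -> V) (c : I -> R) :
  (forall i, opbound (F i) (c i)) ->
  opbound (\sum_(i <- r) F i) (\sum_(i <- r) c i).
Proof.
by move=> h; elim/big_rec2: _ => [|i a b _ ih]; [exact: opbound0|exact: opboundD].
Qed.

(** Rescaling to unit vectors: the supremum over the unit ball of a subspace becomes
a linear bound on the whole subspace. *)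
Lemma opnorm_leP (dom : set V) T C : 0 <= C ->
  (forall k x, dom x -> dom (k *: x) /\ T (k *: x) = k *: T x) ->
  (opnorm ip dom T <= C%:E)%E <-> (forall x, dom x -> N (T x) <= C * N x).
Proof.
move=> C0 hT; split=> [h x dx|h].
  have [x0|x0] := eqVneq x 0.
    have [_] := hT 0 x dx; rewrite !scale0r => T0.
    by rewrite x0 T0 hnorm0 mulr0.
  have n0 : 0 < N x by rewrite lt_def hnorm_eq0 x0 hnorm_ge0.
  have [d1 T1] := hT (N x)^-1%:C%C x dx.
  have ni : cabs ((N x)^-1)%:C%C = (N x)^-1.
    by rewrite cabs_real ger0_norm// invr_ge0 ltW.
  have : ((N (T ((N x)^-1%:C%C *: x)))%:E <= C%:E)%E.
    apply: le_trans h; apply: ereal_sup_ubound; exists ((N x)^-1%:C%C *: x) => //.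
    by split=> //; rewrite nrmZ ni mulVf ?gt_eqF.
  by rewrite T1 lee_fin nrmZ ni ler_pdivrMl// mulrC.
apply: ge_ereal_sup => _ [x [dx x1] <-]; rewrite lee_fin.
by apply: le_trans (h x dx) _; rewrite -[leRHS]mulr1 ler_wpM2l.
Qed.

Lemma opnormT_leP T C : 0 <= C -> linear T ->
  (opnorm ip setT T <= C%:E)%E <-> opbound T C.
Proof.
move=> C0 l; have h k x : setT x -> setT (k *: x) /\ T (k *: x) = k *: T x.
  by move=> _; split=> //; exact: lin_Z.
split=> [/(opnorm_leP C0 h) H x|H]; first exact: H.
by apply/(opnorm_leP C0 h) => x _; exact: H.
Qed.

Lemma bounded_operatorP T :
  bounded_operator ip T <-> linear T /\ exists2 C, 0 <= C & opbound T C.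
Proof.
split=> -[l]; last first.
  by move=> [C C0 h]; split=> //; apply: le_lt_trans (ltry C); apply/opnormT_leP.
move=> h; split=> //; move Ex: (opnorm ip setT T) h => x.
case: x Ex => [r|//|] Ex _; last first.
  exists 0 => //; apply/opnormT_leP => //; by rewrite Ex leNye.
exists `|r| => //; apply/opnormT_leP => //.
by rewrite Ex lee_fin ler_norm.
Qed.

Lemma norm_closureP (B : set (V -> V)) a : (forall b, B b -> linear b) ->
  norm_closure ip B a <-> bounded_operator ip a /\
    forall e, 0 < e -> exists2 b, B b & opbound (a - b) e.
Proof.
move=> lB; split=> -[ba h]; split=> // e e0.
  have [b Bb hb] := h e e0; exists b => //.
  apply/opnormT_leP; [exact: ltW|apply: linear_sub (lB _ Bb); exact: ba.1|exact: ltW].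
have [|b Bb hb] := h (e / 2); first by rewrite divr_gt0.
exists b => //; apply: (@le_lt_trans _ _ (e / 2)%:E).
  apply/opnormT_leP => //; first by rewrite ltW// divr_gt0.
  apply: linear_sub (lB _ Bb); exact: ba.1.
by rewrite lte_fin ltr_pdivrMr// ltr_pMr// ltr1n.
Qed.

Lemma adjoint_sym a b : adjoint ip a b -> adjoint ip b a.
Proof. by move=> h x y; rewrite ip_conj -h -ip_conj. Qed.

(** |b y|^2 = <a (b y), y>, by Cauchy-Schwarz at most C |b y| |y|. *)
Lemma adjoint_opbound a b C : adjoint ip a b -> opbound a C -> opbound b C.
Proof.
move=> h ha y; have [n0|n0] := eqVneq (N (b y)) 0.
  rewrite n0; have [y0|] := eqVneq (N y) 0; first by rewrite y0 mulr0.
  move=> y0; have Ny : 0 < N y by rewrite lt_def y0 hnorm_ge0.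
  by have := ha y => /(le_trans (hnorm_ge0 _ _)).
have Ny : 0 < N (b y) by rewrite lt_def n0 hnorm_ge0.
rewrite -(ler_pM2l Ny) -expr2 -[leLHS]ger0_norm ?sqr_ge0// -cabs_real -ipxx -h.
apply: le_trans (cauchy_schwarz _ _ _) _.
by rewrite mulrA ler_wpM2r ?hnorm_ge0// mulrC.
Qed.

(** Both sides of the adjunction identity are continuous in the operator norm. *)
Lemma adjoint_closed a a' :
  (forall e, 0 < e -> exists b b',
     [/\ adjoint ip b b', opbound (a - b) e & opbound (a' - b') e]) ->
  adjoint ip a a'.
Proof.
move=> h x y; apply/eqP; rewrite -subr_eq0; apply/eqP/le_cabs_eq0 => e e0.
have n0 : 0 < N x * N y + 1 by rewrite ltr_wpDl// mulr_ge0// hnorm_ge0.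
have [|b [b' [bb' ab ab']]] := h (e / 2 / (N x * N y + 1)).
  by rewrite !divr_gt0.
have -> : ip (a x) y - ip x (a' y) = ip ((a - b) x) y - ip x ((a' - b') y).
  by rewrite !fctE ipBl ipBr bb' opprB addrA subrK.
apply: le_trans (cabsB _ _) _.
apply: le_trans (lerD (cauchy_schwarz _ _ _) (cauchy_schwarz _ _ _)) _.
have := ab x; have := ab' y; set d := e / 2 / _ => h1 h2.
have nx := hnorm_ge0 ip x; have ny := hnorm_ge0 ip y.
apply: (@le_trans _ _ (d * N x * N y + N x * (d * N y))).
  by rewrite lerD// ?ler_wpM2r ?ler_wpM2l.
have -> : d * N x * N y + N x * (d * N y) = (2 * d) * (N x * N y) by ring.
have -> : 2 * d = e / (N x * N y + 1) by rewrite /d; field; rewrite gt_eqF.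
rewrite mulrAC ler_pdivrMr// ler_pM2l//.
by rewrite lerDl ler01.
Qed.

Hypothesis complete : hilbert_complete ip.

(** The limit is taken pointwise; the Cauchy estimate passes to it because it is
uniform on the unit ball. *)
Lemma op_complete (b : nat -> V -> V) :
  (forall n, bounded_operator ip (b n)) ->
  (forall e, 0 < e -> exists n, forall i j, (n <= i)%N -> (n <= j)%N ->
     opbound (b i - b j) e) ->
  exists2 a, bounded_operator ip a &
    forall e, 0 < e -> exists n, forall i, (n <= i)%N -> opbound (a - b i) e.
Proof.
move=> bb hc.
have lim x : exists l, forall e, 0 < e ->
    exists n, forall i, (n <= i)%N -> N (l - b i x) < e.
  have [|l hl] := complete (u := fun n => b n x).
    move=> e e0; have n0 : 0 < N x + 1 by rewrite ltr_wpDl ?hnorm_ge0.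
    have [n hn] := hc _ (divr_gt0 e0 n0); exists n => i j ni nj.
    apply: le_lt_trans (hn i j ni nj x) _.
    by rewrite mulrAC ltr_pdivrMr// ltr_pM2l// ltrDl.
  exists l => e e0; move: hl => /hnorm_cvg0 => /(_ (fun=> hnorm_ge0 _ _)).
  move=> /(_ e e0)[n hn]; exists n => i ni; rewrite nrmC; exact: hn.
have [a ha] := choice lim.
have hab e : 0 < e -> exists n, forall i, (n <= i)%N -> opbound (a - b i) e.
  move=> e0; have [n hn] := hc e e0; exists n => i ni x.
  apply/ler_addgt0Pl => d d0; have [m hm] := ha x d d0.
  apply: le_trans (nrm_tri ip (b (maxn n m) x) _ _) _.
  apply: lerD; first by apply/ltW/hm; rewrite leq_maxr.
  by apply: hn => //; rewrite leq_maxl.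
have la : linear a.
  move=> k x y; apply: (@hnorm_sub_eq0 _ _ ip) => e e0.
  have kp : 0 < cabs k + 1 by rewrite ltr_wpDl// cabs_ge0.
  have e3 : 0 < e / 3 by rewrite divr_gt0.
  have [n1 h1] := ha (k *: x + y) (e / 3) e3.
  have [n2 h2] := ha x (e / 3 / (cabs k + 1)) (divr_gt0 e3 kp).
  have [n3 h3] := ha y (e / 3) e3.
  pose m := maxn n1 (maxn n2 n3).
  have {}h1 := h1 m (leq_maxl _ _).
  have {}h2 : N (a x - b m x) < e / 3 / (cabs k + 1).
    by apply: h2; rewrite /m (leq_trans _ (leq_maxr _ _))// leq_maxl.
  have {}h3 : N (a y - b m y) < e / 3.
    by apply: h3; rewrite /m (leq_trans _ (leq_maxr _ _))// leq_maxr.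
  apply: le_trans (nrm_tri ip (b m (k *: x + y)) _ _) _.
  have -> : b m (k *: x + y) - (k *: a x + a y) =
     - (k *: (a x - b m x) + (a y - b m y)).
    by rewrite (bb m).1 scalerBr -opprB; congr (- _); rewrite opprD addrACA.
  rewrite nrmN; apply: le_trans (lerD (ltW h1) (nrmD _ _ _)) _.
  rewrite nrmZ.
  have : cabs k * N (a x - b m x) <= e / 3.
    rewrite ltr_pdivlMr// in h2; apply: le_trans (ltW h2).
    by rewrite mulrC ler_wpM2l ?hnorm_ge0// lerDl.
  by move=> h4; move: h3 h4; lra.
exists a => //; apply/bounded_operatorP; split=> //.
have [n hn] := hab 1 ltr01; have /bounded_operatorP[_ [C C0 hC]] := bb n.
exists (1 + C); first by rewrite addr_ge0.
by have := opboundD (hn n (leqnn n)) hC; rewrite subrK.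
Qed.

(** Only adjoints require completeness: the adjoints of an approximating sequence form
a Cauchy sequence, since passing to adjoints preserves the norm. *)
Lemma norm_closure_cstar (B : set (V -> V)) :
  star_algebra ip B -> B idfun -> unital_cstar_algebra ip (norm_closure ip B).
Proof.
move=> [Bb B0 Blin Bcomp Badj] B1.
have lB b : B b -> linear b by move=> /Bb [].
have clP a := norm_closureP a lB.
have BA : B `<=` norm_closure ip B.
  move=> b Hb; apply/clP; split; first exact: Bb.
  move=> e e0; exists b => // x; rewrite fctE subrr hnorm0.
  by rewrite mulr_ge0 ?hnorm_ge0 ?ltW.
split; last 2 first.
- exact: BA.
- have lA a : norm_closure ip B a -> linear a by move=> [] [].
  move=> a /(norm_closureP a lA)[ba h]; apply/clP; split=> // e e0.
  have e2 : 0 < e / 2 by rewrite divr_gt0.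
  have [c /clP[_ hc] ac] := h _ e2; have [b Hb cb] := hc _ e2.
  exists b => //; have := opbound_tri ac cb; congr opbound; lra.
split=> //.
- by move=> a [].
- exact: BA.
- move=> k a b /clP[/bounded_operatorP[la [C C0 hC]] ha].
  move=> /clP[/bounded_operatorP[lb [C' C0' hC']] hb]; apply/clP; split.
    apply/bounded_operatorP; split; first exact: linear_lin.
    exists (cabs k * C + C'); first by rewrite addr_ge0// mulr_ge0// cabs_ge0.
    by apply: opboundD => //; exact: opboundZ.
  move=> e e0; have kp : 0 < cabs k + 1 by rewrite ltr_wpDl// cabs_ge0.
  have e2 : 0 < e / 2 by rewrite divr_gt0.
  have [a' Ba' aa'] := ha _ (divr_gt0 e2 kp); have [b' Bb' bb'] := hb _ e2.
  exists (k *: a' + b'); first exact: Blin.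
  have -> : k *: a + b - (k *: a' + b') = k *: (a - a') + (b - b').
    by rewrite scalerBr opprD addrACA.
  apply: opbound_le (opboundD (opboundZ k aa') bb').
  suff : cabs k * (e / 2 / (cabs k + 1)) <= e / 2 by lra.
  rewrite mulrCA ler_piMr// ?(ltW e2)// ler_pdivrMr// mul1r lerDl ler01//.
- move=> a b /clP[/bounded_operatorP[la [C C0 hC]] ha].
  move=> /clP[/bounded_operatorP[lb [C' C0' hC']] hb]; apply/clP; split.
    apply/bounded_operatorP; split; first exact: linear_comp.
    by exists (C * C'); [exact: mulr_ge0|exact: opbound_comp].
  move=> e e0.
  have p1 : 0 < C + 1 by rewrite ltr_wpDl.
  have p2 : 0 < C' + 1 + 1 by rewrite ltr_wpDl// addr_ge0.
  have e2 : 0 < e / 2 by rewrite divr_gt0.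
  have [a' Ba' aa'] := ha _ (divr_gt0 e2 p2).
  pose d := Num.min 1 (e / 2 / (C + 1)).
  have d0 : 0 < d by rewrite lt_min ltr01 divr_gt0.
  have [b' Bb' bb'] := hb _ d0.
  exists (a' \o b'); first exact: Bcomp.
  have hb' : opbound b' (C' + 1).
    have := opboundD hC' (opbound_subC bb'); rewrite addrC subrK => h.
    by apply: opbound_le h; rewrite lerD2l ge_min lexx.
  have -> : (a \o b) - (a' \o b') = (a \o (b - b')) + ((a - a') \o b').
    by apply/funext => x; rewrite !fctE /= (lin_B _ _ la) addrA subrK.
  have h0 : 0 <= e / 2 / (C' + 1 + 1) by rewrite ltW// divr_gt0.
  apply: opbound_le (opboundD (opbound_comp C0 hC bb') (opbound_comp h0 aa' hb')).
  have h1 : C * d <= e / 2.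
    apply: (@le_trans _ _ (C * (e / 2 / (C + 1)))).
      by rewrite ler_wpM2l// ge_min lexx orbT.
    by rewrite mulrCA ler_piMr// ?(ltW e2)// ler_pdivrMr// mul1r lerDl ler01.
  have h2 : e / 2 / (C' + 1 + 1) * (C' + 1) <= e / 2.
    rewrite mulrAC -mulrA ler_piMr// ?(ltW e2)// ler_pdivrMr// mul1r.
    by rewrite lerDl ler01.
  by move: h1 h2; lra.
- move=> a /clP[ba ha].
  have eN n : 0 < (n.+1%:R : R)^-1 by rewrite invr_gt0 ltr0n.
  have /choice[b hb] : forall n, exists b, B b /\ opbound (a - b) n.+1%:R^-1.
    by move=> n; have [b] := ha _ (eN n); exists b.
  have /choice[b' hb'] : forall n, exists b', B b' /\ adjoint ip (b n) b'.
    by move=> n; have [b'] := Badj _ (hb n).1; exists b'.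
  have small e : 0 < e -> exists n, forall i, (n <= i)%N -> i.+1%:R^-1 <= e.
    move=> e0; have [n hn] := ltr_add_invr (y := 0) (x := e) e0.
    exists n => i ni; apply: le_trans (_ : n.+1%:R^-1 <= _).
      by rewrite lef_pV2 ?posrE ?ltr0n// ler_nat ltnS.
    by move: hn; rewrite add0r => /ltW.
  have [|e e0|a' ba' ha'] := op_complete (b := b'); first by move=> n; exact/Bb/(hb' n).1.
    have e2 : 0 < e / 2 by rewrite divr_gt0.
    have [n hn] := small _ e2.
    exists n => i j ni nj.
    have ad : adjoint ip (b i - b j) (b' i - b' j).
      by move=> x y; rewrite !fctE ipBl ipBr (hb' i).2 (hb' j).2.
    apply: adjoint_opbound ad _.
    apply: opbound_le (opbound_tri (opbound_subC (hb i).2) (hb j).2).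
    by have := lerD (hn i ni) (hn j nj); rewrite -splitr.
  exists a'.
    apply/clP; split=> // e /ha'[n hn]; exists (b' n); first exact: (hb' n).1.
    exact: hn.
  apply: adjoint_closed => e e0; have [n hn] := ha' e e0; have [m hm] := small e e0.
  exists (b (maxn n m)), (b' (maxn n m)); split; first exact: (hb' _).2.
    by apply: opbound_le (hb _).2; apply: hm; rewrite leq_maxr.
  by apply: hn; rewrite leq_maxl.
Qed.

End operator_bounds.

(** * States are contractions *)

Section states_bounded.
Variables (R : realType) (V : lmodType R[i]) (ip : {dot V for conjC}).
Variable A : set (V -> V).
Hypothesis complete : hilbert_complete ip.
Hypothesis hA : unital_cstar_algebra ip A.
Implicit Types (a b h y : V -> V) (c e : R).

Lemma cstar_linear a : A a -> linear a.
Proof. by case: hA => -[hb _ _ _ _] _ _ /hb []. Qed.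

Lemma cstar_bound a : A a -> exists2 c, 0 <= c & opbound ip a c.
Proof. by case: hA => -[hb _ _ _ _] _ _ /hb /bounded_operatorP[]. Qed.

Lemma cstar0 : A 0. Proof. by case: hA => -[]. Qed.

Lemma cstarZ k a : A a -> A (k *: a).
Proof.
by case: hA => -[_ h0 hl _ _] _ _ Aa; have := hl k a 0 Aa h0; rewrite addr0.
Qed.

Lemma cstarD a b : A a -> A b -> A (a + b).
Proof.
by case: hA => -[_ h0 hl _ _] _ _ Aa Ab; have := hl 1 a b Aa Ab; rewrite scale1r.
Qed.

Lemma cstarB a b : A a -> A b -> A (a - b).
Proof. by move=> Aa Ab; rewrite -scaleN1r; apply/cstarD/cstarZ. Qed.

Lemma cstarM a b : A a -> A b -> A (a \o b).
Proof. by case: hA => -[_ _ _ + _] _ _; apply. Qed.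

Lemma cstar1 : A idfun.
Proof. by case: hA. Qed.

Lemma cstar_limit a : bounded_operator ip a ->
  (forall e, 0 < e -> exists2 b, A b & opbound ip (a - b) e) -> A a.
Proof.
case: hA => -[hb _ _ _ _] _ hc ba h; apply: hc.
by apply/norm_closureP => // b /hb [].
Qed.

Lemma geom_small c e : 0 <= c -> c < 1 -> 0 < e ->
  exists n, forall i, (n <= i)%N -> c ^+ i < e.
Proof.
move=> c0 c1 e0; have := cvg_expr (z := c); rewrite ger0_norm// => /(_ c1).
move=> /cvgrPdist_lt /(_ e e0)[n _ hn]; exists n => i ni.
by have := hn i ni; rewrite /= sub0r normrN ger0_norm// exprn_ge0.
Qed.

(** The root is 1 - y, where y solves y = (h + y^2) / 2; on self-adjoint
contractions of norm at most c this fixed point equation is a contraction. *)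
Lemma cstar_sqrt h c : A h -> adjoint ip h h -> 0 <= c -> c < 1 ->
  opbound ip h c ->
  exists b, [/\ A b, adjoint ip b b & b \o b = idfun - h].
Proof.
move=> Ah hh c0 c1 hc.
pose phi y := (2^-1 : R)%:C%C *: (h + (y \o y)).
pose y := fix y n := if n is n'.+1 then phi (y n') else 0.
have half (a : V -> V) e : opbound ip a e ->
    opbound ip ((2^-1 : R)%:C%C *: a) (e / 2).
  by move=> /(opboundZ (2^-1 : R)%:C%C); rewrite cabs_real ger0_norm ?invr_ge0// mulrC.
have yP n : [/\ A (y n), adjoint ip (y n) (y n) & opbound ip (y n) c].
  elim: n => [|n [An an bn]] /=.
    split; first exact: cstar0.
      by move=> u v; rewrite ip0l ip0r.
    by apply: opbound_le c0 _; exact: opbound0.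
  split; first by apply/cstarZ/cstarD => //; exact: cstarM.
    by move=> u v; rewrite /phi !fctE /= ipZl ipZr conjC_real ipDl ipDr hh !an.
  apply: opbound_le (half _ _ (opboundD hc (opbound_comp c0 bn bn))); nra.
have ld n : linear (y n) by case: (yP n) => /cstar_linear.
have phiB a b : linear a ->
    phi a - phi b = (2^-1 : R)%:C%C *: ((a \o (a - b)) + ((a - b) \o b)).
  move=> la; rewrite /phi -scalerBr; congr (_ *: _); apply/funext => x.
  by rewrite !fctE /= (lin_B _ _ la) addrA subrK opprD addrACA subrr add0r.
have phi_contr a b e : linear a -> 0 <= e -> opbound ip a c -> opbound ip b c ->
    opbound ip (a - b) e -> opbound ip (phi a - phi b) (c * e).
  move=> la e0 ac bc ab; rewrite phiB//.
  have := half _ _ (opboundD (opbound_comp c0 ac ab) (opbound_comp e0 ab bc)).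
  by congr opbound; field.
have yd n : opbound ip (y n.+1 - y n) (c ^+ n.+1).
  elim: n => [|n ih]; first by rewrite subr0; case: (yP 1).
  rewrite exprS; apply: phi_contr => //; first exact: ld n.+1.
  - by rewrite exprn_ge0.
  - by case: (yP n.+1).
  - by case: (yP n).
have d0 : 0 < 1 - c by rewrite subr_gt0.
have ydk n k : opbound ip (y (n + k)%N - y n) (c ^+ n * (1 - c ^+ k) / (1 - c)).
  elim: k => [|k ih].
    rewrite addn0 subrr expr0 subrr mulr0 mul0r; exact: opbound0.
  have := opbound_tri (yd (n + k)%N) ih; rewrite addnS; apply: opbound_le.
  rewrite -[leRHS]mulrC ler_pdivlMl// mulrDr mulrCA mulfV ?gt_eqF// mulr1.
  rewrite !exprS exprD; have := exprn_ge0 n c0; have := exprn_ge0 k c0.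
  move: (c ^+ n) (c ^+ k) => u v u0 v0.
  have uv : 0 <= u * v by rewrite mulr_ge0.
  by have := mulr_ge0 (sqr_ge0 (1 - c)) uv; lra.
have [n||g bg hg] := @op_complete _ _ ip complete y.
- by have [An _ _] := yP n; case: hA => -[+ _ _ _ _] _ _; apply.
- move=> e e0; have [|n hn] := @geom_small c (e / 2 * (1 - c)) c0 c1.
    by rewrite mulr_gt0// divr_gt0.
  have key i : (n <= i)%N -> opbound ip (y i - y n) (e / 2).
    move=> ni; have := ydk n (i - n)%N; rewrite subnKC//; apply: opbound_le.
    rewrite ler_pdivrMr//; apply: le_trans (ltW (hn n (leqnn n))).
    by rewrite ler_piMr ?exprn_ge0// gerBl exprn_ge0.
  exists n => i j ni nj; rewrite [e]splitr.
  by apply: opbound_tri (key i ni) (opbound_subC (key j nj)).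
have Ag : A g.
  apply: cstar_limit => // e /hg[n hn]; exists (y n); last exact: hn.
  by case: (yP n).
have gg : adjoint ip g g.
  apply: adjoint_closed => e /hg[n /(_ _ (leqnn n)) hn].
  by exists (y n), (y n); split=> //; case: (yP n).
have gc : opbound ip g c.
  apply: opbound_lt => e /hg[n /(_ _ (leqnn n)) hn].
  by have [_ _ bn] := yP n; have := opboundD hn bn; rewrite subrK addrC.
have gfix : phi g = g.
  apply/funext => x; apply: (@hnorm_sub_eq0 _ _ ip) => e e0.
  have p0 : 0 < hnorm ip x + 1 by rewrite ltr_wpDl ?hnorm_ge0.
  have d1 : 0 < e / (hnorm ip x + 1) / 2 by rewrite !divr_gt0.
  have [n hn] := hg _ d1.
  have h1 := hn n (leqnn n); have h2 := hn n.+1 (leqnSn n).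
  have [_ _ bn] := yP n.
  have h3 := phi_contr g (y n) _ (cstar_linear Ag) (ltW d1) gc bn h1.
  have := opbound_tri h3 (opbound_subC h2) x => /le_trans; apply.
  apply: (@le_trans _ _ (e / (hnorm ip x + 1) * hnorm ip x)).
    rewrite ler_wpM2r ?hnorm_ge0// [leRHS]splitr lerD2r ler_piMl ?ltW//.
  by rewrite mulrAC ler_pdivrMr// ler_pM2l// lerDl.
exists (idfun - g); split.
- by apply: cstarB => //; exact: cstar1.
- by move=> u v; rewrite !fctE /= ipBl ipBr gg.
apply/funext => x; rewrite !fctE /= (lin_B _ _ (cstar_linear Ag)).
have : 2 *: phi g x = h x + g (g x).
  rewrite /phi !fctE scalerA; have -> : 2 * (2^-1 : R)%:C%C = 1 :> R[i].
    by rewrite fmorphV rmorphMn /= rmorph1 divff ?pnatr_eq0.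
  by rewrite scale1r.
rewrite gfix (_ : 2 = 1 + 1)// scalerDl scale1r => E.
have -> : h x = g x + g x - g (g x) by rewrite E addrK.
by rewrite !opprB opprD -addrA; congr (_ + _); rewrite addrCA.
Qed.

Definition alg_elt a (Aa : A a) : A := exist _ a (mem_set Aa).

Lemma algP (a : A) : A (\val a).
Proof. exact: set_valP. Qed.

Variable phi : A -> R[i].
Hypothesis phi_state : is_state ip phi.

Lemma state_lin k a b (Aa : A a) (Ab : A b) (Aab : A (k *: a + b)) :
  phi (alg_elt Aab) = k * phi (alg_elt Aa) + phi (alg_elt Ab).
Proof. by case: phi_state => + _ _; apply. Qed.

Lemma state_ext (a b : A) : \val a = \val b -> phi a = phi b.
Proof. by move=> /val_inj ->. Qed.

Lemma state1 : phi (alg_elt cstar1) = 1.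
Proof. by case: phi_state => _ _; apply. Qed.

Lemma stateZ k a (Aa : A a) (Aka : A (k *: a)) :
  phi (alg_elt Aka) = k * phi (alg_elt Aa).
Proof.
have A00 : A (1 *: 0 + 0) by rewrite scaler0 addr0; exact: cstar0.
have phi0 : phi (alg_elt cstar0) = 0.
  have := state_lin cstar0 cstar0 A00; rewrite mul1r.
  rewrite (@state_ext _ (alg_elt cstar0)) /=; last by rewrite scaler0 addr0.
  by move/eqP; rewrite -subr_eq0 opprD addrA subrr sub0r oppr_eq0 => /eqP.
have A1 : A (k *: a + 0) by rewrite addr0.
have -> : phi (alg_elt Aka) = phi (alg_elt A1).
  by apply: state_ext => /=; rewrite addr0.
by rewrite (state_lin Aa cstar0) phi0 addr0.
Qed.

Lemma stateD a b (Aa : A a) (Ab : A b) (Aab : A (a + b)) :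
  phi (alg_elt Aab) = phi (alg_elt Aa) + phi (alg_elt Ab).
Proof.
have A1 : A (1 *: a + b) by rewrite scale1r.
rewrite -[phi (alg_elt Aa)]mul1r -(state_lin _ _ A1).
by apply: state_ext => /=; rewrite scale1r.
Qed.

Lemma state_le1 h c (Ah : A h) : adjoint ip h h -> 0 <= c -> c < 1 ->
  opbound ip h c -> phi (alg_elt Ah) <= 1.
Proof.
move=> hh c0 c1 hc; have [b [Ab bb b2]] := cstar_sqrt Ah hh c0 c1 hc.
have A1 : A (idfun - h) by apply: cstarB => //; exact: cstar1.
have : 0 <= phi (alg_elt A1).
  by case: phi_state => _ + _ => /(_ (alg_elt Ab) (alg_elt Ab) (alg_elt A1)); apply.
have A2 : A (- 1 *: h) by exact: cstarZ.
have A3 : A (-1 *: h + idfun) by apply: cstarD => //; exact: cstar1.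
rewrite (@state_ext _ (alg_elt A3)) /=; last by rewrite scaleN1r addrC.
by rewrite (state_lin Ah cstar1) state1 mulN1r addrC subr_ge0.
Qed.

Lemma state_sa_real h (Ah : A h) : adjoint ip h h ->
  complex.Im (phi (alg_elt Ah)) = 0.
Proof.
move=> hh; have [c c0 hc] := cstar_bound Ah.
pose k := (2 * (c + 1))^-1.
have k0 : 0 < k by rewrite invr_gt0 mulr_gt0// ltr_wpDl.
have Ak : A (k%:C%C *: h) by exact: cstarZ.
have hk : adjoint ip (k%:C%C *: h) (k%:C%C *: h).
  by move=> u v; rewrite !fctE ipZl ipZr conjC_real hh.
have h2 : (0 : R) <= 2^-1 by rewrite invr_ge0.
have h3 : (2^-1 : R) < 1 by rewrite invf_lt1// ltr1n.
have : phi (alg_elt Ak) <= 1.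
  apply: (state_le1 Ak hk h2 h3); apply: opbound_le (opboundZ k%:C%C hc).
  rewrite cabs_real gtr0_norm// /k mulrC ler_pdivrMr ?mulr_gt0 ?ltr_wpDl//.
  by rewrite mulrA mulVf ?pnatr_eq0// mul1r lerDl.
rewrite lecE => /andP[/eqP /= + _]; rewrite (stateZ Ah).
case: (phi _) => x y /=; rewrite mul0r addr0 => /esym/eqP.
by rewrite mulf_eq0 gt_eqF//= => /eqP.
Qed.

Lemma state_conj a b (Aa : A a) (Ab : A b) : adjoint ip a b ->
  phi (alg_elt Ab) = conjC (phi (alg_elt Aa)).
Proof.
move=> ab; have ba := adjoint_sym ab.
have As : A (a + b) by exact: cstarD.
have Ai : A ('i%C *: b) by exact: cstarZ.
have Aj : A (- 'i%C *: a) by exact: cstarZ.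
have Aij : A ('i%C *: b + - 'i%C *: a) by exact: cstarD.
have conji : conjC ('i%C : R[i]) = - 'i%C.
  by apply/eqP; rewrite eq_complex /= oppr0 !eqxx.
have sa1 : adjoint ip (a + b) (a + b).
  by move=> u v; rewrite !fctE ipDl ipDr ab ba addrC.
have sa2 : adjoint ip ('i%C *: b + - 'i%C *: a) ('i%C *: b + - 'i%C *: a).
  move=> u v; rewrite !fctE ipDl ipDr !ipZl !ipZr rmorphN /= conji opprK ab ba.
  by rewrite addrC.
have := state_sa_real As sa1; have := state_sa_real Aij sa2.
rewrite (stateD Aa Ab) (stateD Ai Aj) (stateZ Ab) (stateZ Aa).
case: (phi (alg_elt Aa)) => x y; case: (phi (alg_elt Ab)) => x' y' /= h1 h2.
apply/eqP; rewrite eq_complex /=; apply/andP; split; apply/eqP; lra.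
Qed.

(** For self-adjoint h of norm less than 1, positivity at the square 1 - h gives
phi(h) <= 1; a phase reduces a general element to its
real part. *)
Lemma state_contract (a : A) c : 0 <= c -> opbound ip (\val a) c ->
  cabs (phi a) <= c.
Proof.
move=> c0 hc; apply/ler_addgt0Pr => e e0.
case: hA => -[_ _ _ _ /(_ _ (algP a))[b Ab ab]] _ _.
have ba := adjoint_sym ab.
have [->|p0] := eqVneq (phi a) 0; first by rewrite cabs0 addr_ge0// ltW.
have phia : phi a = phi (alg_elt (algP a)) by exact: state_ext.
have phib := state_conj (algP a) Ab ab; rewrite -phia in phib.
have P0 : 0 < cabs (phi a) by rewrite lt_def cabs_eq0 p0 cabs_ge0.
have ce : 0 < c + e by rewrite ltr_wpDl.
pose w : R[i] := (cabs (phi a))^-1%:C%C * conjC (phi a).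
have w1 : cabs w = 1.
  by rewrite cabsM cabs_real cabs_conj ger0_norm ?invr_ge0 ?cabs_ge0// mulVf ?gt_eqF.
have wphi : w * phi a = (cabs (phi a))%:C%C.
  rewrite /w -mulrA [conjC _ * _]mulrC mul_conj -realcM expr2 mulrA.
  by rewrite mulVf ?mul1r// gt_eqF.
pose k : R := (2 * (c + e))^-1.
have k0 : 0 < k by rewrite invr_gt0 mulr_gt0.
pose h := k%:C%C *: (w *: \val a + conjC w *: b).
have Awa : A (w *: \val a) by apply/cstarZ/algP.
have Awb : A (conjC w *: b) by exact: cstarZ.
have As : A (w *: \val a + conjC w *: b) by exact: cstarD.
have Ah : A h by exact: cstarZ.
have hh : adjoint ip h h.
  move=> u v; rewrite /h !fctE !ipZl !ipZr conjC_real !ipDl !ipDr !ipZl !ipZr.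
  by rewrite conjCK ab ba addrC.
have bc := adjoint_opbound ab hc.
have h0 : 0 <= c / (c + e) by rewrite divr_ge0// ltW.
have h1 : c / (c + e) < 1 by rewrite ltr_pdivrMr// mul1r ltrDl.
have hbd : opbound ip h (c / (c + e)).
  apply: opbound_le (opboundZ _ (opboundD (opboundZ w hc) (opboundZ (conjC w) bc))).
  rewrite cabs_real gtr0_norm// cabs_conj w1 !mul1r /k.
  suff -> : (2 * (c + e))^-1 * (c + c) = c / (c + e) by [].
  by field; rewrite gt_eqF.
have := state_le1 Ah hh h0 h1 hbd.
rewrite (stateZ As) (stateD Awa Awb) (stateZ (algP a)) (stateZ Ab).
rewrite -phia phib -rmorphM /= wphi conjC_real -realcD -realcM lecR /k.
by rewrite mulrC ler_pdivrMr ?mulr_gt0// mul1r; lra.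
Qed.

End states_bounded.

(** * A criterion for the Monge-Kantorovich metric to metrize the weak-* topology *)

Lemma ptws_cvg (I : Type) (V : topologicalType) (F : set_system {ptws I -> V})
    (f : {ptws I -> V}) : Filter F ->
  (forall i, (fun g : {ptws I -> V} => g i) @ F --> f i) -> F --> f.
Proof.
move=> FF h; apply/cvg_sup => i B [_ [[C oC <-] Cf sB]].
apply: filterS sB _; apply: (h i C).
exact: open_nbhs_nbhs.
Qed.

Section metric_criterion.
Variables (R : realType) (K H : lmodType R[i]).
Variables (ipK : {dot K for conjC}) (ipH : {dot H for conjC}).
Variables (A : set (K -> K)) (pi : (K -> K) -> (H -> H)).
Variables (dom : set H) (D : H -> H).
Hypothesis complete : hilbert_complete ipK.
Hypothesis hA : unital_cstar_algebra ipK A.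
Implicit Types (a b : K -> K) (e : R).

Definition lip_ball : set (K -> K) := [set a | [/\ A a, preserves dom (pi a) &
  (opnorm ipH dom (commutator D (pi a)) <= 1)%E]].

Hypothesis lip_dense : forall a e, A a -> 0 < e ->
  exists b k, [/\ A b, (0 : R) < k, lip_ball (k%:C%C *: b) & opbound ipK (a - b) e].

Variables (I : eqType) (u : I -> K -> K).
Hypothesis uA : forall i, A (u i).
Hypothesis lip_precompact : forall e, 0 < e -> exists (r : seq I) (M : R),
  0 <= M /\ forall a, lip_ball a -> exists c0 (c : I -> R[i]),
    (forall i, i \in r -> cabs (c i) <= M) /\
    opbound ipK (a - (c0 *: idfun + \sum_(i <- r) c i *: u i)) e.

Let A_0 := cstar0 hA.
Let A_1 := cstar1 hA.
Let AZ := @cstarZ _ _ _ _ hA.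
Let AD := @cstarD _ _ _ _ hA.
Let AB := @cstarB _ _ _ _ hA.

(** Extending [phi] by 0 outside [A] keeps membership proofs out of the terms, so
that linearity can be used by rewriting. *)
Definition state_val (phi : A -> R[i]) (a : K -> K) : R[i] :=
  if pselect (A a) is left Aa then phi (alg_elt Aa) else 0.

Lemma state_valE phi a (Aa : A a) : state_val phi a = phi (alg_elt Aa).
Proof.
rewrite /state_val; case: pselect => // Aa'; congr phi.
exact: val_inj.
Qed.

Lemma state_val_val phi (a : A) : state_val phi (\val a) = phi a.
Proof. by rewrite (state_valE phi (algP a)); congr phi; exact: val_inj. Qed.

Section one_state.
Variable phi : A -> R[i].
Hypothesis phiP : is_state ipK phi.
Local Notation "'phi^'" := (state_val phi).

Lemma state_valD a b : A a -> A b -> phi^ (a + b) = phi^ a + phi^ b.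
Proof.
move=> Aa Ab; have Aab := AD Aa Ab.
by rewrite !state_valE (stateD phiP Aa Ab Aab).
Qed.

Lemma state_valZ k a : A a -> phi^ (k *: a) = k * phi^ a.
Proof.
move=> Aa; have Aka := AZ k Aa.
by rewrite !state_valE (stateZ hA phiP Aa Aka).
Qed.

Lemma state_val1 : phi^ idfun = 1.
Proof. by rewrite (state_valE _ (A_1)) state1. Qed.

Lemma state_valB a b : A a -> A b -> phi^ (a - b) = phi^ a - phi^ b.
Proof.
move=> Aa Ab; rewrite -scaleN1r state_valD ?state_valZ ?mulN1r//.
exact: AZ.
Qed.

Lemma cstar_sum (r : seq I) (c : I -> R[i]) : A (\sum_(i <- r) c i *: u i).
Proof.
elim/big_ind: _ => [|x y Ax Ay|i _]; first exact: A_0; first exact: AD Ax Ay.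
exact: AZ (uA i).
Qed.

Lemma state_val_sum (r : seq I) (c : I -> R[i]) :
  phi^ (\sum_(i <- r) c i *: u i) = \sum_(i <- r) c i * phi^ (u i).
Proof.
elim: r => [|i r ih].
  by rewrite !big_nil -(scale0r 0) state_valZ ?mul0r//; exact: A_0.
rewrite !big_cons state_valD ?state_valZ ?ih//; first exact: AZ.
exact: cstar_sum.
Qed.

Lemma state_val_le a e : A a -> 0 <= e -> opbound ipK a e -> cabs (phi^ a) <= e.
Proof.
by move=> Aa e0 ae; rewrite state_valE (state_contract complete hA phiP).
Qed.

End one_state.

(** Two states can differ on the Lipschitz ball only through their values at
finitely many elements, since that ball is totally bounded modulo scalars. *)
Lemma state_diff_le e : 0 < e -> exists (r : seq I) (M : R),
  0 <= M /\ forall phi psi : A -> R[i],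
    is_state ipK phi -> is_state ipK psi -> forall a, lip_ball a ->
    cabs (state_val phi a - state_val psi a) <=
      e + M * \sum_(i <- r) cabs (state_val phi (u i) - state_val psi (u i)).
Proof.
move=> e0; have e2 : 0 < e / 2 by rewrite divr_gt0.
have [r [M [M0 h]]] := lip_precompact e2.
exists r, M; split=> // phi psi hphi hpsi a la.
have [c0 [c [cM hr]]] := h a la; have [Aa _ _] := la.
set s := \sum_(i <- r) c i *: u i in hr; set t := a - _ in hr.
have As : A s by exact: cstar_sum.
have A1 : A (c0 *: idfun) by apply: AZ => //; exact: A_1.
have A1s : A (c0 *: idfun + s) by exact: AD.
have At : A t by exact: AB.
have dec f : is_state ipK f -> state_val f a =
    state_val f t + (c0 + \sum_(i <- r) c i * state_val f (u i)).
  move=> hf; rewrite /t state_valB// state_valD// state_valZ//.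
  by rewrite state_val1// state_val_sum// mulr1 subrK.
rewrite (dec phi)// (dec psi)//.
have -> : state_val phi t + (c0 + \sum_(i <- r) c i * state_val phi (u i)) -
    (state_val psi t + (c0 + \sum_(i <- r) c i * state_val psi (u i))) =
    (state_val phi t - state_val psi t) +
    \sum_(i <- r) c i * (state_val phi (u i) - state_val psi (u i)).
  by under [in RHS]eq_bigr do rewrite mulrBr; rewrite sumrB; ring.
apply: le_trans (cabsD _ _) _; apply: lerD.
  apply: le_trans (cabsB _ _) _; rewrite [leRHS]splitr.
  by apply: lerD; apply: state_val_le => //; exact: ltW.
apply: le_trans (cabs_sum _ _ _) _; rewrite mulr_sumr big_seq [leRHS]big_seq; apply: ler_sum => i ir.
by rewrite cabsM ler_wpM2r ?cabs_ge0// cM.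
Qed.

Local Notation mk := (@mk_metric R K H ipH A pi dom D).

Lemma mk_leP phi psi (x : \bar R) :
  (mk phi psi <= x)%E <->
  forall a, lip_ball a -> ((cabs (state_val phi a - state_val psi a))%:E <= x)%E.
Proof.
split=> [h a [Aa ha na]|h].
  apply: le_trans h; apply: ereal_sup_ubound; exists (alg_elt Aa); first by split.
  by rewrite !(state_valE _ Aa).
apply: ge_ereal_sup => _ [a [ha na] <-]; rewrite -!state_val_val.
by apply: h; split=> //; exact: algP.
Qed.

Lemma mk_ge phi psi a : lip_ball a ->
  ((cabs (state_val phi a - state_val psi a))%:E <= mk phi psi)%E.
Proof. by move: a; apply/mk_leP. Qed.

Lemma lip_ball_ex : exists a, lip_ball a.
Proof.
have [b [k [_ _ lb _]]] := lip_dense (A_0) ltr01.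
by exists (k%:C%C *: b).
Qed.

Lemma mk_ge0 phi psi : (0 <= mk phi psi)%E.
Proof.
have [a la] := lip_ball_ex; apply: le_trans (mk_ge phi psi la).
by rewrite lee_fin cabs_ge0.
Qed.

Local Notation S := (state_space ipK A).

Lemma stateP (phi : S) : is_state ipK (\val phi).
Proof. exact: set_valP. Qed.

Let m := fun phi psi : S => mk (\val phi) (\val psi).

(** Approximate a by a Lipschitz element: the metric controls the difference on
that element, and contractivity of states controls the error. *)
Lemma mk_state_val_small (phi : S) a e : A a -> 0 < e ->
  exists2 d : R, 0 < d & forall psi : S, (m phi psi < d%:E)%E ->
    cabs (state_val (\val phi) a - state_val (\val psi) a) < e.
Proof.
move=> Aa e0; have e3 : 0 < e / 3 by rewrite divr_gt0.
have [b [k [Ab k0 lb ab]]] := lip_dense Aa e3.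
exists (k * (e / 3)); first by rewrite mulr_gt0.
move=> psi hpsi; have Aab := AB Aa Ab.
have h1 := le_lt_trans (mk_ge _ _ lb) hpsi.
rewrite lte_fin !state_valZ// in h1; [|exact: stateP..].
rewrite -mulrBr cabsM cabs_real gtr0_norm// ltr_pM2l// in h1.
have h2 := state_val_le (stateP phi) Aab (ltW e3) ab.
have h3 := state_val_le (stateP psi) Aab (ltW e3) ab.
rewrite !state_valB// in h2 h3; [|exact: stateP..].
move: h1 h2 h3; set x := state_val _ a; set y := state_val _ b.
set x' := state_val _ a; set y' := state_val _ b => h1 h2 h3.
have -> : x - x' = (x - y) - (x' - y') + (y - y') by ring.
apply: le_lt_trans (cabsD _ _) _.
apply: le_lt_trans (lerD (cabsB _ _) (lexx _)) _.
by move: h1 h2 h3; lra.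
Qed.

(** Weak-* neighbourhoods of a state contain balls for the Monge-Kantorovich
metric because the Lipschitz elements are dense, and balls contain weak-*
neighbourhoods because the Lipschitz ball is totally bounded modulo scalars. *)
Theorem mk_metrizes : is_metric m /\ metrizes m.
Proof.
split.
  split=> [x y|x y|x y|x y z].
  - rewrite mk_ge0 /=; have [r [M [M0 h]]] := state_diff_le ltr01.
    apply: (@le_lt_trans _ _ (1 + M * \sum_(i <- r)
      cabs (state_val (\val x) (u i) - state_val (\val y) (u i)))%:E); last exact: ltry.
    by apply/mk_leP => a la; rewrite lee_fin; apply: h => //; exact: stateP.
  - split=> [m0|->]; last first.
      apply/eqP; rewrite eq_le mk_ge0 andbT; apply/mk_leP => a _.
      by rewrite subrr cabs0.
    apply: val_inj; apply/funext => a; apply/eqP; rewrite -subr_eq0; apply/eqP.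
    rewrite -!state_val_val; apply: le_cabs_eq0 => e e0.
    have [d d0 hd] := mk_state_val_small x (algP a) e0.
    by apply/ltW/hd; rewrite m0 lte_fin.
  - apply/eqP; rewrite eq_le; apply/andP; split; apply/mk_leP => a la.
      by rewrite cabsC mk_ge.
    by rewrite cabsC mk_ge.
  - apply/mk_leP => a la; apply: le_trans (leeD (mk_ge (\val x) (\val y) la) (mk_ge (\val y) (\val z) la)).
    rewrite -EFinD lee_fin; apply: le_trans (cabsD _ _).
    by rewrite addrA subrK.
move=> U; split=> [[U' oU' <-] x Ux|hU].
  pose F : set_system S := filter_from [set e : R | 0 < e]
    (fun e => [set y | (m x y < e%:E)%E]).
  have FF : Filter F.
    apply: filter_from_filter; first by exists 1 => /=.
    move=> e e' /= e0 e0'; exists (Num.min e e'); first by rewrite /= lt_min e0.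
    move=> y /= hy; split; apply: lt_le_trans hy _; rewrite lee_fin ge_min lexx//.
    by rewrite orbT.
  have cF : (set_val @ F)%classic --> (\val x : {ptws A -> R[i]^o}).
    apply: ptws_cvg => a.
    apply/cvgrPdist_lt => -[e e'].
    rewrite ltcE /= => /andP[/eqP -> e0].
    have [d d0 hd] := mk_state_val_small x (algP a) e0.
    exists d => //= y /hd; rewrite !state_val_val => h.
    by move: h; rewrite -ltcR cabsE.
  have : nbhs (\val x : {ptws A -> R[i]^o}) U' by apply: open_nbhs_nbhs.
  by move=> /cF [e e0 he]; exists e.
rewrite openE => x /hU[e e0 he]; rewrite /interior /=.
have e2 : 0 < e / 2 by rewrite divr_gt0.
have [r [M [M0 h]]] := state_diff_le e2.
pose d := e / 2 / (M + 1) / (size r).+1%:R.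
have M1 : 0 < M + 1 by rewrite ltr_wpDl.
have d0 : 0 < d by rewrite !divr_gt0// ltr0n.
have near_u i : \forall y \near x,
    cabs (state_val (\val x) (u i) - state_val (\val y) (u i)) < d.
  have Ab := uA i.
  have : continuous (fun y : S => (\val y (alg_elt Ab) : R[i]^o)).
    move=> y; apply: (@continuous_comp _ _ _ set_val
      (fun f : {ptws A -> R[i]^o} => f (alg_elt Ab))).
      exact: initial_continuous.
    exact: proj_continuous.
  move=> /(_ x)/cvgrPdist_lt/(_ d%:C%C); rewrite ltcR => /(_ d0).
  apply: filterS => y /= h'; rewrite !(state_valE _ Ab).
  by rewrite -ltcR cabsE.
have near_all (s : seq I) : \forall y \near x, forall i, i \in s ->
    cabs (state_val (\val x) (u i) - state_val (\val y) (u i)) < d.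
  elim: s => [|j s ih]; first exact: filterE.
  apply: filterS2 (near_u j) ih => y h1 h2 i.
  by rewrite in_cons => /predU1P[->|/h2].
apply: filterS (near_all r) => y hy; apply: he.
apply: (@le_lt_trans _ _ (e / 2 + M * \sum_(i <- r) d)%:E).
  apply/mk_leP => a la; rewrite lee_fin.
  apply: le_trans (h _ _ (stateP x) (stateP y) a la) _.
  rewrite lerD2l ler_wpM2l// big_seq [leRHS]big_seq; apply: ler_sum => i ir.
  by apply/ltW/hy.
rewrite lte_fin [ltRHS]splitr ltrD2l big_const_seq count_predT iter_addr_0.
have dn : d *+ size r <= e / 2 / (M + 1).
  rewrite -mulr_natr /d mulrAC ler_pdivrMr ?ltr0n// ler_pM2l ?divr_gt0//.
  by rewrite ler_nat.
apply: le_lt_trans (ler_wpM2l M0 dn) _.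
by rewrite mulrA ltr_pdivrMr// mulrC ltr_pM2l// ltrDl.
Qed.

End metric_criterion.

(** * Square summable functions *)

Section l2_theory.
Variables (R : realType) (T : choiceType) (V : lmodType R[i]).
Variable ip : {dot V for conjC}.
Local Notation N := (hnorm ip).
Local Notation L := (l2 T ip).
Local Notation L_ip := (@l2_ip R T V ip).
Local Notation NL := (hnorm L_ip).
Implicit Types (f g : L) (S : {fset T}) (t : T) (v : V).

Lemma esum_leP (F : T -> R) (M : R) : (forall t, 0 <= F t) ->
  (\esum_(t in setT) (F t)%:E <= M%:E)%E <-> forall S, \sum_(t <- S) F t <= M.
Proof.
move=> F0; split=> [h S|h].
  rewrite -lee_fin -sumEFin; apply: le_trans h; apply: esum_ge.
  exists [set` S]; first by split.
  by rewrite fsbig_seq.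
apply: ge_ereal_sup => _ [A [finA _] <-].
by rewrite fsbig_finite// sumEFin lee_fin.
Qed.

Lemma l2_normE f : (NL f ^+ 2)%:E = (\esum_(t in setT) (N (f t) ^+ 2)%:E)%E.
Proof.
have f0 t : 0 <= N (f t) ^+ 2 by rewrite sqr_ge0.
rewrite sqr_hnorm /l2_ip /csum /= (_ : (fun t => _) = fun t => N (f t) ^+ 2).
  rewrite ge0_rsum// fineK// ge0_fin_numE; first exact: (l2funP f).
  by apply: esum_ge0 => t _; rewrite lee_fin.
by apply/funext => t; rewrite sqr_hnorm.
Qed.

Lemma l2_sum_le f S : \sum_(t <- S) N (f t) ^+ 2 <= NL f ^+ 2.
Proof.
by move: S; apply/esum_leP => [t|]; rewrite ?sqr_ge0// -l2_normE.
Qed.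

Lemma l2_pt_le f t : N (f t) <= NL f.
Proof.
rewrite -(ler_pXn2r (ltn0Sn 1)) ?nnegrE ?hnorm_ge0//.
by have := l2_sum_le f [fset t]%fset; rewrite big_seq_fset1.
Qed.

Lemma l2_norm_le f (M : R) : 0 <= M ->
  (forall S, \sum_(t <- S) N (f t) ^+ 2 <= M ^+ 2) -> NL f <= M.
Proof.
move=> M0 h; rewrite -(ler_pXn2r (ltn0Sn 1)) ?nnegrE ?hnorm_ge0//.
by rewrite -lee_fin l2_normE; apply/esum_leP => // t; rewrite sqr_ge0.
Qed.

Lemma l2_mem (f : T -> V) (M : R) :
  (forall S, \sum_(t <- S) N (f t) ^+ 2 <= M) -> f \in square_summable ip.
Proof.
move=> h; rewrite unfold_in; apply: le_lt_trans (ltry M).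
by apply/esum_leP => // t; rewrite sqr_ge0.
Qed.

Lemma to_l2E (f : T -> V) : f \in square_summable ip -> to_l2 ip f = f :> (T -> V).
Proof. by move=> h; rewrite /to_l2 /= insubdK. Qed.

Lemma l2_ext f g : (forall t, f t = g t) -> f = g.
Proof. by move=> h; apply/val_inj/funext. Qed.

Lemma l2DE f g t : (f + g) t = f t + g t. Proof. by []. Qed.
Lemma l2BE f g t : (f - g) t = f t - g t. Proof. by []. Qed.
Lemma l2ZE k f t : (k *: f) t = k *: f t. Proof. by []. Qed.
Lemma l2_0E t : (0 : L) t = 0. Proof. by []. Qed.

Lemma l2_sumE (I : Type) (r : seq I) (P : pred I) (F : I -> L) t :
  (\sum_(i <- r | P i) F i) t = \sum_(i <- r | P i) F i t.
Proof. by elim/big_rec2: _ => [|i y x _ <-]; rewrite ?l2_0E ?l2DE. Qed.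

Definition single t v : L := to_l2 ip (fun s => if s == t then v else 0).

Lemma single_sum_le t v S :
  \sum_(s <- S) N (if s == t then v else 0) ^+ 2 <= N v ^+ 2.
Proof.
case: (boolP (t \in S)) => tS.
  rewrite (big_fsetD1 t)//= eqxx big_seq big1 ?addr0// => s.
  by rewrite in_fsetD1 => /andP[/negPf -> _]; rewrite hnorm0 expr0n.
rewrite big_seq big1 ?sqr_ge0// => s sS.
by rewrite ifN ?hnorm0 ?expr0n//; apply: contraNneq tS => <-.
Qed.

Lemma singleE t v s : single t v s = if s == t then v else 0.
Proof. by rewrite /single to_l2E//; apply: l2_mem (single_sum_le t v). Qed.

Lemma singleZ k t v : single t (k *: v) = k *: single t v.
Proof.
by apply: l2_ext => s; rewrite l2ZE !singleE; case: ifP; rewrite ?scaler0.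
Qed.

Definition finvec S (x : T -> V) : L := \sum_(t <- S) single t (x t).

Lemma finvecE S x t : finvec S x t = if t \in S then x t else 0.
Proof.
rewrite l2_sumE; case: ifPn => tS.
  rewrite (big_fsetD1 t)//= singleE eqxx big_seq big1 ?addr0// => s.
  by rewrite in_fsetD1 singleE eq_sym => /andP[/negPf -> _].
rewrite big_seq big1// => s sS; rewrite singleE ifN//.
by apply: contraNneq tS => ->.
Qed.

Lemma finvec_norm S x : NL (finvec S x) ^+ 2 = \sum_(t <- S) N (x t) ^+ 2.
Proof.
have x0 : 0 <= \sum_(t <- S) N (x t) ^+ 2 by apply: sumr_ge0 => t _; exact: sqr_ge0.
apply/eqP; rewrite eq_le; apply/andP; split; last first.
  apply: le_trans (l2_sum_le _ S); rewrite big_seq [leRHS]big_seq.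
  by apply: ler_sum => t tS; rewrite finvecE tS.
have := @l2_norm_le (finvec S x) (Num.sqrt (\sum_(t <- S) N (x t) ^+ 2)).
rewrite sqr_sqrtr// => h; rewrite -[leRHS]sqr_sqrtr// ler_pXn2r ?nnegrE ?hnorm_ge0//.
apply: h => // S'; rewrite (big_fsetID _ (mem S))/= [X in _ + X]big_seq.
rewrite [X in _ + X]big1 ?addr0 => [|t]; last first.
  by rewrite !inE finvecE => /andP[_ /negPf ->]; rewrite hnorm0 expr0n.
rewrite (_ : \sum_(t <- S) _ = \sum_(t <- [fset x in S | x \in S']%fset) N (x t) ^+ 2 +
   \sum_(t <- [fset x in S | ~~ (x \in S')]%fset) N (x t) ^+ 2).
  rewrite (_ : [fset x in S' | _]%fset = [fset x in S | x \in S']%fset).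
    rewrite -[leLHS]addr0 lerD//; last by apply: sumr_ge0 => t _; exact: sqr_ge0.
    rewrite big_seq [leRHS]big_seq; apply: ler_sum => t.
    by rewrite !inE => /andP[tS _]; rewrite finvecE tS.
  by apply/fsetP => t; rewrite !inE andbC.
by rewrite [LHS](big_fsetID _ (mem S')).
Qed.

Lemma single_norm t v : NL (single t v) = N v.
Proof.
have := finvec_norm [fset t]%fset (fun=> v).
rewrite /finvec !big_seq_fset1 => /eqP.
by rewrite eqrXn2 ?hnorm_ge0// => /eqP.
Qed.

Lemma finvec_approx f (e : R) : 0 < e -> exists S, NL (f - finvec S f) <= e.
Proof.
move=> e0; have e20 : 0 < e ^+ 2 by rewrite exprn_gt0.
have [S hS] : exists S, NL f ^+ 2 - e ^+ 2 < \sum_(t <- S) N (f t) ^+ 2.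
  apply: contrapT => /forallNP h.
  have : ((NL f ^+ 2)%:E <= (NL f ^+ 2 - e ^+ 2)%:E)%E.
    rewrite l2_normE; apply/esum_leP => [t|S]; first exact: sqr_ge0.
    by rewrite leNgt; apply/negP/h.
  by rewrite lee_fin lerBrDr -lerBrDl subrr leNgt e20.
exists S; apply: l2_norm_le (ltW e0) _ => S'.
have := l2_sum_le f (S `|` S')%fset.
rewrite (big_fsetID _ (mem S))/=.
have -> : [fset x in (S `|` S')%fset | x \in S]%fset = S.
  by apply/fsetP => t; rewrite !inE; case: (t \in S) => //=; rewrite andbF.
have -> : \sum_(t <- S') N ((f - finvec S f) t) ^+ 2 =
    \sum_(t <- [fset x in (S `|` S')%fset | ~~ (x \in S)]%fset) N (f t) ^+ 2.
  have E t : (f - finvec S f) t = if t \in S then 0 else f t.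
    by rewrite l2BE finvecE; case: ifP; rewrite ?subrr ?subr0.
  under eq_bigr do rewrite E.
  rewrite [LHS](big_fsetID _ (mem S))/= big_seq big1 ?add0r => [|t]; last first.
    by rewrite !inE => /andP[_ ->]; rewrite hnorm0 expr0n.
  have -> : [fset x in (S `|` S')%fset | ~~ (x \in S)]%fset =
      [fset x in S' | ~~ (x \in S)]%fset.
    by apply/fsetP => t; rewrite !inE; case: (t \in S) => //=; rewrite ?andbF.
  rewrite big_seq [RHS]big_seq; apply: eq_bigr => t.
  by rewrite !inE => /andP[_ /negPf ->].
by move: hS; lra.
Qed.

Lemma rsum_single (x : T -> R) t : (forall s, s != t -> x s = 0) -> rsum x = x t.
Proof.
have pt (y : T -> R) : (forall s, 0 <= y s) -> (forall s, s != t -> y s = 0) ->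
    \esum_(s in setT) (y s)%:E = (y t)%:E.
  move=> y0 yt; rewrite (esumID [set t])//; last by move=> s _; rewrite lee_fin.
  rewrite setTI esum_set1 ?lee_fin// esum1 ?adde0// => s [_ /= st].
  by rewrite yt//; apply/eqP.
move=> xt.
have -> : x = fun s => Num.max (x s) 0 + - Num.max (- x s) 0.
  apply/funext => s; case: (leP 0 (x s)) => h.
    by rewrite max_r ?oppr_le0// subr0.
  by rewrite max_l ?oppr_ge0 ?ltW// sub0r opprK.
have p0 s : 0 <= Num.max (x s) 0 by rewrite le_max lexx orbT.
have n0 s : 0 <= Num.max (- x s) 0 by rewrite le_max lexx orbT.
have pt0 s : s != t -> Num.max (x s) 0 = 0 by move=> /xt ->; rewrite maxxx.
have nt0 s : s != t -> Num.max (- x s) 0 = 0 by move=> /xt ->; rewrite oppr0 maxxx.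
have sm (y : T -> R) : (forall s, 0 <= y s) -> (forall s, s != t -> y s = 0) ->
    rsummable y.
  move=> y0 yt; apply: (@rsummable_le _ _ _ y) => [s|]; first by rewrite ger0_norm.
  by rewrite pt// ltry.
rewrite rsumD ?rsummableN//; [|exact: sm..].
by rewrite rsumN !ge0_rsum// !pt.
Qed.

Lemma ip_single f t v : L_ip f (single t v) = ip (f t) v.
Proof.
rewrite /l2_ip /csum !(@rsum_single _ t) => [|s st|s st].
- by rewrite singleE eqxx; case: (ip _ _).
- by rewrite singleE (negPf st) ip0r.
- by rewrite singleE (negPf st) ip0r.
Qed.

Lemma ip_finvec f S x : L_ip f (finvec S x) = \sum_(t <- S) ip (f t) (x t).
Proof.
by rewrite /finvec ip_sumr; apply: eq_bigr => t _; exact: ip_single.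
Qed.

Lemma l2_pointwise_ip f g f' g' :
  (forall t, ip (f t) (g t) = ip (f' t) (g' t)) -> L_ip f g = L_ip f' g'.
Proof. by move=> h; rewrite /l2_ip; congr csum; apply/funext. Qed.

(** Vectors of finite support are dense. *)
Lemma opbound_finvec (a : L -> L) (C : R) : bounded_operator L_ip a -> 0 <= C ->
  (forall S x, NL (a (finvec S x)) <= C * NL (finvec S x)) -> opbound L_ip a C.
Proof.
move=> /bounded_operatorP[la [M M0 aM]] C0 h f; apply/ler_addgt0Pr => e e0.
have p : 0 < M + C + 1 by rewrite ltr_wpDl// addr_ge0.
have [S hS] := finvec_approx f (divr_gt0 e0 p).
have -> : f = (f - finvec S f) + finvec S f by rewrite subrK.
rewrite {1}(lin_D _ _ la); apply: le_trans (nrmD _ _ _) _.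
have h1 := aM (f - finvec S f); have h2 := h S f.
have h3 : NL (finvec S f) <= NL f + NL (f - finvec S f).
  by rewrite -{1}[finvec S f](subKr f); exact: nrmB.
rewrite subrK.
have h4 : C * NL (finvec S f) <= C * (NL f + NL (f - finvec S f)).
  by rewrite ler_wpM2l.
have h5 : (M + C) * NL (f - finvec S f) <= e.
  apply: le_trans (ler_wpM2l (addr_ge0 M0 C0) hS) _.
  by rewrite mulrA ler_pdivrMr// mulrC ler_pM2l// lerDl.
apply: le_trans (lerD h1 (le_trans h2 h4)) _.
by rewrite mulrDr addrCA -mulrDl lerD2l.
Qed.

(** The limit is taken pointwise. On a finite set the distance to it is a limit of
distances between terms, which the Cauchy condition bounds uniformly. *)
Lemma l2_complete : hilbert_complete ip -> hilbert_complete L_ip.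
Proof.
move=> cV u hu.
have /choice[l hl] : forall t, exists lt, forall e, 0 < e ->
    exists n, forall i, (n <= i)%N -> N (u i t - lt) < e.
  move=> t; have [|lt hlt] := cV (fun n => u n t).
    move=> e e0; have [n hn] := hu e e0; exists n => i j ni nj.
    by apply: le_lt_trans (hn i j ni nj); rewrite -l2BE; exact: l2_pt_le.
  exists lt => e e0; move: hlt => /hnorm_cvg0 => /(_ (fun=> hnorm_ge0 _ _)).
  exact.
have key e : 0 < e -> exists n, forall i, (n <= i)%N -> forall S,
    \sum_(t <- S) N (u i t - l t) ^+ 2 <= e ^+ 2.
  move=> e0; have [n hn] := hu _ e0; exists n => i ni S.
  rewrite -(finvec_norm S (fun t => u i t - l t)).
  rewrite ler_pXn2r ?nnegrE ?hnorm_ge0 ?(ltW e0)//.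
  apply/ler_addgt0Pr => d d0.
  have [m hm] : exists m, (n <= m)%N /\ \sum_(t <- S) N (u m t - l t) <= d.
    have p : 0 < (size S).+1%:R :> R by rewrite ltr0n.
    have /choice[M hM] t := hl t _ (divr_gt0 d0 p).
    exists (maxn n (\max_(t <- S) M t)); rewrite leq_maxl; split=> //.
    apply: (@le_trans _ _ (\sum_(t <- S) (d / (size S).+1%:R))).
      rewrite big_seq [leRHS]big_seq; apply: ler_sum => t tS.
      apply/ltW/hM; apply: leq_trans (leq_maxr _ _).
      exact: (@leq_bigmax_seq _ _ xpredT M).
    rewrite big_const_seq count_predT iter_addr_0.
    rewrite -[leLHS]mulr_natr mulrAC.
    by rewrite ler_pdivrMr// ler_pM2l// ler_nat.
  have -> : finvec S (fun t => u i t - l t) =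
      finvec S (u i - u m) + finvec S (fun t => u m t - l t).
    apply: l2_ext => t; rewrite l2DE !finvecE; case: ifP; rewrite ?addr0// => _.
    by rewrite l2BE addrA subrK.
  apply: le_trans (nrmD _ _ _) _; apply: lerD.
    rewrite -(ler_pXn2r (ltn0Sn 1)) ?nnegrE ?hnorm_ge0 ?(ltW e0)// finvec_norm.
    apply: le_trans (l2_sum_le _ _) _.
    rewrite ler_pXn2r ?nnegrE ?hnorm_ge0 ?(ltW e0)//.
    by apply/ltW/hn => //; exact: hm.1.
  apply: le_trans (nrm_sum _ _ _ _) _; apply: le_trans hm.2.
  by apply: ler_sum => t _; rewrite single_norm.
have [n0 hn0] := key 1 ltr01.
have ls : (fun t => u n0 t - l t) \in square_summable ip.
  by apply: (@l2_mem _ (1 ^+ 2)) => S; exact: hn0.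
pose w : L := u n0 - L2 ls.
have wE t : w t = l t by rewrite /w l2BE /= subKr.
exists w; apply/hnorm_cvg0 => [n|e e0]; first exact: hnorm_ge0.
have e2 : 0 < e / 2 by rewrite divr_gt0.
have [n hn] := key _ e2; exists n => i ni.
apply: (@le_lt_trans _ _ (e / 2)); last by rewrite ltr_pdivrMr// ltr_pMr// ltr1n.
apply: l2_norm_le => [|S]; first exact: ltW.
by apply: le_trans (hn i ni S); apply: ler_sum => t _; rewrite l2BE wE.
Qed.

End l2_theory.

(** * Inner products in finite dimension *)

Section finite_dimension.
Variables (R : realType) (E : vectType R[i]) (ip : {dot E for conjC}).
Local Notation N := (hnorm ip).

Lemma real_cauchy_lim (u : nat -> R) :
  (forall e, 0 < e -> exists n, forall i j, (n <= i)%N -> (n <= j)%N ->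
     `|u i - u j| < e) ->
  exists l, forall e, 0 < e -> exists n, forall i, (n <= i)%N -> `|u i - l| < e.
Proof.
move=> hu; have : cvg (u @ \oo).
  apply/cauchy_cvgP/cauchy_exP => e e0; have [n hn] := hu e e0.
  by exists (u n), n => // i /= ni; apply: hn.
move=> /cvg_ex[l /cvgrPdist_lt hl]; exists l => e /hl[n _ hn].
by exists n => i ni; rewrite distrC; exact: hn.
Qed.

Lemma complex_cauchy_lim (u : nat -> R[i]) :
  (forall e, 0 < e -> exists n, forall i j, (n <= i)%N -> (n <= j)%N ->
     cabs (u i - u j) < e) ->
  exists l, forall e, 0 < e -> exists n, forall i, (n <= i)%N -> cabs (u i - l) < e.
Proof.
move=> hu.
have reB (z w : R[i]) : complex.Re (z - w) = complex.Re z - complex.Re w.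
  by case: z w => [? ?] [].
have imB (z w : R[i]) : complex.Im (z - w) = complex.Im z - complex.Im w.
  by case: z w => [? ?] [].
have [|x hx] := @real_cauchy_lim (fun n => complex.Re (u n)).
  move=> e /hu[n hn]; exists n => i j ni nj; rewrite -reB.
  exact: le_lt_trans (Re_le_cabs _) (hn i j ni nj).
have [|y hy] := @real_cauchy_lim (fun n => complex.Im (u n)).
  move=> e /hu[n hn]; exists n => i j ni nj; rewrite -imB.
  exact: le_lt_trans (Im_le_cabs _) (hn i j ni nj).
exists (x +i* y)%C => e e0; have e2 : 0 < e / 2 by rewrite divr_gt0.
have [n hn] := hx _ e2; have [m hm] := hy _ e2.
exists (maxn n m) => i; rewrite geq_max => /andP[ni mi].
apply: le_lt_trans (cabs_le_ReIm _) _; rewrite reB imB /= [e]splitr.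
by apply: ltrD; [exact: hn|exact: hm].
Qed.

(** Gram-Schmidt, phrased through the orthogonal projection it produces. *)
Lemma span_projection (X : seq E) : exists U : seq E,
  (forall u, u \in U -> u \in <<X>>%VS) /\
  (forall v, v \in <<X>>%VS -> \sum_(u <- U) ip v u *: u = v).
Proof.
elim: X => [|x X [U [UX hU]]].
  exists [::]; split=> // v; rewrite span_nil memv0 => /eqP ->.
  by rewrite big_nil.
pose P v := \sum_(u <- U) ip v u *: u.
have PD v w : P (v + w) = P v + P w.
  rewrite /P -big_split /=; apply: eq_bigr => u _.
  by rewrite ipDl scalerDl.
have PZ k v : P (k *: v) = k *: P v.
  by rewrite /P scaler_sumr; apply: eq_bigr => u _; rewrite ipZl scalerA.
have Psa v w : ip (P v) w = ip v (P w).
  rewrite /P ip_suml ip_sumr; apply: eq_bigr => u _.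
  by rewrite ipZl ipZr -ip_conj mulrC.
have PX v : P v \in <<X>>%VS.
  by rewrite /P big_seq; apply: memv_suml => u uU; apply/memvZ/UX.
have sX v : v \in <<X>>%VS -> v \in <<x :: X>>%VS.
  by move=> vX; rewrite span_cons (subvP (addvSr _ _)).
have xX : x \in <<x :: X>>%VS by rewrite memv_span// mem_head.
pose w := x - P x.
have dec v : v \in <<x :: X>>%VS -> exists c v', v' \in <<X>>%VS /\ v = c *: w + v'.
  rewrite span_cons => /memv_addP[_ /vlineP[c ->] [v' v'X ->]].
  exists c, (c *: P x + v'); split; first by rewrite memvD ?memvZ.
  by rewrite /w scalerBr addrA subrK.
have PP : P (P x) = P x by exact: hU (PX x).
have Pw : P w = 0 by rewrite /w PD -scaleN1r PZ scaleN1r PP subrr.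
have orth v : v \in <<X>>%VS -> ip v w = 0.
  by move=> vX; rewrite -(hU v vX) -/(P v) Psa Pw ip0r.
have [w0|w0] := eqVneq w 0.
  exists U; split=> [u /UX /sX//|v /dec[c [v' [v'X ->]]]].
  by rewrite -/(P _) w0 scaler0 add0r; exact: hU.
pose n := N w; have n0 : n != 0 by rewrite hnorm_eq0.
have nc0 : n%:C%C != 0 by rewrite fmorph_eq0.
exists (n^-1%:C%C *: w :: U); split=> [u|v].
  rewrite in_cons => /predU1P[->|/UX/sX//].
  by apply: memvZ; rewrite memvB// sX.
move=> /dec[c [v' [v'X ->]]].
have Pv' : P v' = v' by exact: hU.
rewrite big_cons -/(P _) PD PZ Pw scaler0 add0r Pv'; congr (_ + _).
rewrite ipZr conjC_real ipDl ipZl (orth v')// addr0 ipxx -/n scalerA.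
by congr (_ *: _); rewrite expr2 realcM fmorphV /=; field.
Qed.

(** Expanding v in the family provided by Gram-Schmidt bounds its coordinates by
Cauchy-Schwarz; the inner product of E is thereby compared with the basis. *)
Lemma coord_bound : exists2 C : R, 0 <= C &
  forall i v, cabs (coord (vbasis {:E}) i v) <= C * N v.
Proof.
have [U [_ hU]] := span_projection (vbasis {:E}).
exists (\sum_i \sum_(u <- U) N u * cabs (coord (vbasis {:E}) i u)).
  by apply: sumr_ge0 => i _; apply: sumr_ge0 => u _; rewrite mulr_ge0 ?hnorm_ge0 ?cabs_ge0.
move=> i v; have vE : v \in <<vbasis {:E}>>%VS.
  by rewrite (span_basis (vbasisP _)) memvf.
rewrite -{1}(hU v vE) linear_sum /= (bigD1 i)//= mulrDl -[leLHS]addr0.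
apply: lerD; last first.
  rewrite mulr_ge0 ?hnorm_ge0//; apply: sumr_ge0 => j _; apply: sumr_ge0 => u _.
  by rewrite mulr_ge0 ?hnorm_ge0 ?cabs_ge0.
apply: le_trans (cabs_sum _ _ _) _; rewrite mulr_suml; apply: ler_sum => u _.
rewrite linearZ /= cabsM mulrAC ler_wpM2r ?cabs_ge0//.
by rewrite mulrC; exact: cauchy_schwarz.
Qed.

Lemma fin_dim_complete : hilbert_complete ip.
Proof.
move=> u hu; have [C C0 hC] := coord_bound.
pose c i v := coord (vbasis {:E}) i v.
have hlim i : exists l, forall e, 0 < e -> exists n, forall k, (n <= k)%N ->
    cabs (c i (u k) - l) < e.
  apply: complex_cauchy_lim => e e0.
  have p : 0 < C + 1 by rewrite ltr_wpDl.
  have [n hn] := hu _ (divr_gt0 e0 p); exists n => j k nj nk.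
  rewrite /c -linearB /=; apply: le_lt_trans (hC _ _) _.
  have := hn j k nj nk; rewrite ltr_pdivlMr// => /le_lt_trans; apply.
  by rewrite mulrC ler_wpM2l ?hnorm_ge0// lerDl.
have [l hl] := choice hlim.
exists (\sum_(i < \dim {:E}) l i *: (vbasis {:E})`_i).
apply/hnorm_cvg0 => [n|e e0]; first exact: hnorm_ge0.
pose B := \sum_(i < \dim {:E}) N (vbasis {:E})`_i + 1.
have B0 : 0 < B by rewrite ltr_wpDl// sumr_ge0// => i _; exact: hnorm_ge0.
have /choice[n hn] i := hl i _ (divr_gt0 e0 B0).
exists (\max_i n i) => m nm.
rewrite {1}(coord_vbasis (memvf (u m))) -sumrB.
apply: le_lt_trans (nrm_sum _ _ _ _) _.
apply: (@le_lt_trans _ _ (\sum_(i < \dim {:E}) e / B * N (vbasis {:E})`_i)).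
  apply: ler_sum => i _; rewrite -scalerBl nrmZ ler_wpM2r ?hnorm_ge0//.
  apply/ltW/hn; apply: leq_trans nm; exact: (leq_bigmax i).
rewrite -mulr_sumr mulrAC ltr_pdivrMr// ltr_pM2l//.
by rewrite /B ltrDl.
Qed.

End finite_dimension.

Lemma cip_complete (R : realType) : hilbert_complete (@cip R).
Proof. exact: (@fin_dim_complete R R[i]^o (@cip R)). Qed.

(** * Bounds for infinite matrices and Schur multipliers *)

Section kernels.
Variables (R : realType) (T : choiceType).
Implicit Types (K : T -> T -> R[i]) (S : {fset T}) (xi eta : T -> R[i]) (C : R).

(** The kernel [K] defines an operator of norm at most [C]. The arithmetic mean on
the right, in place of the product of the norms, makes estimates over disjoint
blocks additive; only finite sections are tested, so no convergence is involved. *)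
Definition kbound K C : Prop := forall S S' xi eta,
  cabs (\sum_(x <- S) \sum_(y <- S') K x y * xi y * eta x) <=
  C / 2 * (\sum_(y <- S') cabs (xi y) ^+ 2 + \sum_(x <- S) cabs (eta x) ^+ 2).

Lemma kbound_ext K K' C : (forall x y, K x y = K' x y) -> kbound K C -> kbound K' C.
Proof.
move=> e h S S' xi eta; apply: le_trans (h S S' xi eta).
rewrite le_eqVlt; apply/orP; left; apply/eqP; congr cabs.
by apply: eq_bigr => x _; apply: eq_bigr => y _; rewrite e.
Qed.

Lemma kbound_local K C :
  (forall S S', exists2 K', kbound K' C &
     forall x y, x \in S -> y \in S' -> K x y = K' x y) -> kbound K C.
Proof.
move=> h S S' xi eta; have [K' hK' e] := h S S'.
apply: le_trans (hK' S S' xi eta).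
rewrite le_eqVlt; apply/orP; left; apply/eqP; congr cabs.
rewrite big_seq [RHS]big_seq; apply: eq_bigr => x xS.
by rewrite big_seq [RHS]big_seq; apply: eq_bigr => y yS; rewrite e.
Qed.

(** Rescaling both vectors turns the arithmetic mean into any weighted mean, and so
recovers the bound by the product of the norms. *)
Lemma kbound_scaled K C S S' xi eta (t : R) : 0 < t -> kbound K C ->
  cabs (\sum_(x <- S) \sum_(y <- S') K x y * xi y * eta x) <=
  C / 2 * (t ^+ 2 * \sum_(y <- S') cabs (xi y) ^+ 2 +
           t ^- 2 * \sum_(x <- S) cabs (eta x) ^+ 2).
Proof.
move=> t0 h.
have := h S S' (fun y => t%:C%C * xi y) (fun x => t^-1%:C%C * eta x).
under [X in _ <= _ * (X + _)]eq_bigr => y _ do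
  rewrite cabsM cabs_real gtr0_norm// exprMn.
under [X in _ <= _ * (_ + X)]eq_bigr => x _ do
  rewrite cabsM cabs_real gtr0_norm ?invr_gt0// exprMn exprVn.
rewrite -!mulr_sumr; apply: le_trans.
rewrite le_eqVlt; apply/orP; left; apply/eqP; congr cabs.
apply: eq_bigr => x _; apply: eq_bigr => y _.
have tt : t%:C%C * t^-1%:C%C = 1 :> R[i] by rewrite -realcM mulfV ?gt_eqF.
by rewrite -[LHS]mulr1 -tt; ring.
Qed.

Lemma kbound_le K C C' : C <= C' -> kbound K C -> kbound K C'.
Proof.
move=> CC h S S' xi eta; apply: le_trans (h S S' xi eta) _.
rewrite ler_wpM2r ?ler_pM2r ?invr_gt0//.
by apply: addr_ge0; apply: sumr_ge0 => i _; exact: sqr_ge0.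
Qed.

Lemma kbound0 C : 0 <= C -> kbound (fun _ _ => 0) C.
Proof.
move=> C0 S S' xi eta; rewrite big1 ?cabs0 => [|x _].
  apply: mulr_ge0; first by rewrite divr_ge0.
  by apply: addr_ge0; apply: sumr_ge0 => i _; exact: sqr_ge0.
by rewrite big1// => y _; rewrite !mul0r.
Qed.

Lemma kboundD K K' C C' : kbound K C -> kbound K' C' ->
  kbound (fun x y => K x y + K' x y) (C + C').
Proof.
move=> h h' S S' xi eta; rewrite !mulrDl -!mulrDl.
have -> : \sum_(x <- S) \sum_(y <- S') (K x y + K' x y) * xi y * eta x =
    \sum_(x <- S) \sum_(y <- S') K x y * xi y * eta x +
    \sum_(x <- S) \sum_(y <- S') K' x y * xi y * eta x.
  rewrite -big_split; apply: eq_bigr => x _ /=; rewrite -big_split.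
  by apply: eq_bigr => y _ /=; rewrite !mulrDl.
apply: le_trans (cabsD _ _) _; rewrite mulrDl mulrDl.
by apply: lerD; [exact: h|exact: h'].
Qed.

Lemma kbound_diag K C (u v : T -> R[i]) : 0 <= C ->
  (forall x, cabs (u x) <= 1) -> (forall y, cabs (v y) <= 1) ->
  kbound K C -> kbound (fun x y => u x * v y * K x y) C.
Proof.
move=> C0 u1 v1 h S S' xi eta.
apply: le_trans (_ : _ <= C / 2 * (\sum_(y <- S') cabs (v y * xi y) ^+ 2 +
   \sum_(x <- S) cabs (u x * eta x) ^+ 2)) _.
  apply: le_trans (h S S' (fun y => v y * xi y) (fun x => u x * eta x)).
  rewrite le_eqVlt; apply/orP; left; apply/eqP; congr cabs.
  by apply: eq_bigr => x _; apply: eq_bigr => y _; ring.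
rewrite ler_wpM2l ?divr_ge0//; apply: lerD; apply: ler_sum => i _.
  by rewrite cabsM exprMn ler_piMl ?sqr_ge0// expr_le1// cabs_ge0.
by rewrite cabsM exprMn ler_piMl ?sqr_ge0// expr_le1// cabs_ge0.
Qed.

Lemma kboundZ K C (c : R[i]) : kbound K C ->
  kbound (fun x y => c * K x y) (cabs c * C).
Proof.
move=> h S S' xi eta.
have -> : \sum_(x <- S) \sum_(y <- S') c * K x y * xi y * eta x =
    c * \sum_(x <- S) \sum_(y <- S') K x y * xi y * eta x.
  rewrite mulr_sumr; apply: eq_bigr => x _; rewrite mulr_sumr.
  by apply: eq_bigr => y _; rewrite !mulrA.
by rewrite cabsM -!mulrA ler_wpM2l ?cabs_ge0// mulrA; exact: h.
Qed.

Lemma kbound_relabel K C (h h' : T -> T) : cancel h h' -> cancel h' h ->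
  kbound K C -> kbound (fun x y => K (h x) (h y)) C.
Proof.
move=> hh' h'h hK S S' xi eta.
have re (V : nmodType) (A : {fset T}) (F : T -> V) :
    \sum_(x <- A) F x = \sum_(x <- [fset h x | x in A]%fset) F (h' x).
  rewrite big_imfset /=; last by move=> x y _ _; exact: (can_inj hh').
  by apply: eq_bigr => x _; rewrite hh'.
rewrite [X in _ * (X + _)]re [X in _ * (_ + X)]re.
apply: le_trans (hK _ _ (xi \o h') (eta \o h')).
rewrite le_eqVlt; apply/orP; left; apply/eqP; congr cabs.
rewrite re; apply: eq_bigr => x _; rewrite re; apply: eq_bigr => y _.
by rewrite /= !h'h.
Qed.

(** If row x of [K'] is row x of
[T_i], i = f x, multiplied by [psi_i], and the psi_i(y) are square summable in i
uniformly in y, apply the bound for [T_i] to the vectors psi_i xi and 1_(f = i) eta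
and sum over i. *)
Lemma kbound_schur (I : choiceType) (f : T -> I) K' (Tk : I -> T -> T -> R[i])
    (psi : I -> T -> R) C (B : R) : 0 <= C -> 0 < B ->
  (forall i, kbound (Tk i) C) ->
  (forall x y, K' x y = Tk (f x) x y * (psi (f x) y)%:C%C) ->
  (forall (J : {fset I}) y, \sum_(i <- J) psi i y ^+ 2 <= B) ->
  kbound K' (C * Num.sqrt B).
Proof.
move=> C0 B0 hT eK hpsi S S' xi eta.
pose J := [fset f x | x in S]%fset.
pose e i x : R[i] := if f x == i then eta x else 0.
have -> : \sum_(x <- S) \sum_(y <- S') K' x y * xi y * eta x =
    \sum_(i <- J) \sum_(x <- S) \sum_(y <- S')
      Tk i x y * ((psi i y)%:C%C * xi y) * e i x.
  rewrite [RHS]exchange_big /= big_seq [RHS]big_seq; apply: eq_bigr => x xS.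
  have fJ : f x \in J by apply/imfsetP; exists x.
  rewrite (big_fsetD1 (f x))//= [X in _ + X]big_seq [X in _ + X]big1 ?addr0 => [|i].
    by apply: eq_bigr => y _; rewrite /e eqxx eK; ring.
  rewrite in_fsetD1 => /andP[iN _]; rewrite big1// => y _.
  by rewrite /e eq_sym (negPf iN) mulr0.
pose s := Num.sqrt B; have s0 : 0 < s by rewrite sqrtr_gt0.
have ss : s ^+ 2 = B by rewrite sqr_sqrtr// ltW.
(* The weight t balances the two halves of the mean, whose sums carry the factors
   B and 1. *)
pose t := Num.sqrt s^-1; have t0 : 0 < t by rewrite sqrtr_gt0 invr_gt0.
have tt : t ^+ 2 = s^-1 by rewrite sqr_sqrtr// invr_ge0 ltW.
apply: le_trans (cabs_sum _ _ _) _.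
apply: (@le_trans _ _ (\sum_(i <- J) C / 2 * (t ^+ 2 *
   \sum_(y <- S') cabs ((psi i y)%:C%C * xi y) ^+ 2 +
   t ^- 2 * \sum_(x <- S) cabs (e i x) ^+ 2))).
  by apply: ler_sum => i _; exact: kbound_scaled.
rewrite -mulr_sumr big_split /= -!mulr_sumr.
rewrite [X in _ * (_ * X + _) <= _]exchange_big [X in _ * (_ + _ * X) <= _]exchange_big /=.
have h1 : \sum_(y <- S') \sum_(i <- J) cabs ((psi i y)%:C%C * xi y) ^+ 2 <=
    B * \sum_(y <- S') cabs (xi y) ^+ 2.
  rewrite mulr_sumr; apply: ler_sum => y _.
  under eq_bigr do rewrite cabsM exprMn cabs_real real_normK ?num_real//.
  by rewrite -mulr_suml ler_wpM2r ?sqr_ge0.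
have h2 : \sum_(x <- S) \sum_(i <- J) cabs (e i x) ^+ 2 <=
    \sum_(x <- S) cabs (eta x) ^+ 2.
  rewrite big_seq [leRHS]big_seq; apply: ler_sum => x xS.
  have fJ : f x \in J by apply/imfsetP; exists x.
  rewrite (big_fsetD1 (f x))//= [X in _ + X]big_seq [X in _ + X]big1 ?addr0 => [|i].
    by rewrite /e eqxx.
  by rewrite in_fsetD1 /e eq_sym => /andP[/negPf -> _]; rewrite cabs0 expr0n.
rewrite -/s (mulrAC C s) -[leRHS]mulrA ler_wpM2l ?divr_ge0//.
rewrite tt invrK.
rewrite mulrDr; apply: lerD; last by rewrite ler_wpM2l// ltW.
rewrite ler_pdivrMl// mulrA -expr2 ss//.
Qed.

End kernels.

(** * Sums over integers and the filtration of Z[1/p]^d by denominators *)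

Section sums_over_images.
Variables (R : realType).

Lemma sum_uniq_le (Z : eqType) (w : Z -> R) (s s' : seq Z) : (forall z, 0 <= w z) ->
  uniq s -> {subset s <= s'} -> \sum_(z <- s) w z <= \sum_(z <- s') w z.
Proof.
move=> w0; elim: s s' => [|x s ih] s' /=.
  by move=> _ _; rewrite big_nil sumr_ge0.
move=> /andP[xs us] ss'; have xs' : x \in s' by apply: ss'; rewrite mem_head.
rewrite (perm_big _ (perm_to_rem xs')) !big_cons lerD2l ih// => y ys.
have := ss' y; rewrite in_cons ys orbT => /(_ isT).
rewrite (perm_mem (perm_to_rem xs')) in_cons => /predU1P[yx|//].
by rewrite -yx ys in xs.
Qed.

Lemma sum_inj_le (I Z : eqType) (J : seq I) (h : I -> Z) (w : Z -> R) (s : seq Z) :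
  (forall z, 0 <= w z) -> uniq J -> {in J &, injective h} ->
  (forall i, i \in J -> h i \in s) ->
  \sum_(i <- J) w (h i) <= \sum_(z <- s) w z.
Proof.
move=> w0 uJ hi hs; rewrite -(big_map h xpredT w); apply: sum_uniq_le => //.
  by rewrite map_inj_in_uniq.
by move=> z /mapP[i iJ ->]; exact: hs.
Qed.

(** 1/k^2 is at most 1/(k-1) - 1/k, and the bound telescopes. *)
Lemma sum_inv_sqr_le (M n : nat) : (2 <= M)%N ->
  \sum_(0 <= k < n) (if (M <= k)%N then ((k%:R : R) ^+ 2)^-1 else 0) <= M.-1%:R^-1.
Proof.
move=> M2; have M0 : 0 < M.-1%:R :> R by rewrite ltr0n; case: M M2 => [|[]].
suff : \sum_(0 <= k < n) (if (M <= k)%N then ((k%:R : R) ^+ 2)^-1 else 0) <=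
    if (M <= n)%N then M.-1%:R^-1 - n.-1%:R^-1 else 0.
  move=> /le_trans; apply; case: ifP => _; last by rewrite invr_ge0 ltW.
  by rewrite gerBl invr_ge0 ler0n.
elim: n => [|n ih].
  by rewrite big_nil leqn0; case: M M2 {M0} => [|[]].
rewrite big_nat_recr//=; case: (leqP M n) ih => [Mn ih|nM ih].
  rewrite leqW//; have n1 : (1 < n)%N by exact: leq_trans M2 Mn.
  apply: le_trans (lerD ih (lexx _)) _; rewrite -addrA lerD2l.
  case: n n1 {ih Mn} => // n n0 /=.
  have n0' : 0 < n%:R :> R by rewrite ltr0n.
  have n1' : 0 < n.+1%:R :> R by rewrite ltr0n.
  rewrite -subr_ge0.
  have -> : - n.+1%:R^-1 - (- n%:R^-1 + (n.+1%:R ^+ 2)^-1) =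
     (n.+1%:R ^+ 2 * n%:R)^-1 :> R.
    rewrite -natr1; field; rewrite natr1 !gt_eqF//.
  by rewrite invr_ge0 mulr_ge0 ?sqr_ge0// ltW.
rewrite addr0; apply: le_trans ih _; case: ifP => // Mn.
by rewrite (_ : M = n.+1) ?subrr//; apply/eqP; rewrite eqn_leq Mn nM.
Qed.

Definition int_code (k : int) : bool * nat := ((k < 0)%R, absz k).

Lemma int_code_inj : injective int_code.
Proof. by case=> [m|m] [n|n] [] // ->. Qed.

(** Each absolute value is taken by at most two integers. *)
Lemma sum_int_le (J : seq int) (w : nat -> R) (C : R) : (forall k, 0 <= w k) ->
  (forall n, \sum_(0 <= k < n) w k <= C) -> uniq J ->
  \sum_(k <- J) w (absz k) <= C *+ 2.
Proof.
move=> w0 wC uJ.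
have [n hn] : exists n, forall k, k \in J -> (absz k < n)%N.
  exists (\max_(k <- J) absz k).+1 => k kJ.
  by rewrite ltnS; exact: (@leq_bigmax_seq _ _ xpredT absz).
pose s := [seq (b, k) | b <- [:: false; true], k <- iota 0 n].
apply: le_trans (_ : _ <= \sum_(z <- s) w z.2) _.
  apply: (sum_inj_le (h := int_code) (w := fun z => w z.2)) => //.
    by move=> k l _ _; exact: int_code_inj.
  move=> k kJ; apply/allpairsP; exists (int_code k); split => //.
    by rewrite !inE; case: (_).1.
  by rewrite mem_iota /= add0n hn.
have wn : \sum_(k <- iota 0 n) w k <= C.
  by have := wC n; rewrite /index_iota subn0.
rewrite /s big_allpairs !big_cons big_nil /= addr0 mulr2n; exact: (lerD wn wn).
Qed.

End sums_over_images.

Lemma absz_modz_inj (p : nat) (k l : int) : (0 < p)%N ->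
  (absz (k %% p)%Z %% p)%N = (absz (l %% p)%Z %% p)%N -> exists r, l - k = r * p%:Z.
Proof.
move=> pp; have p1 : p%:Z != 0 by rewrite eqz_nat -lt0n.
have E (a : int) : (absz (a %% p)%Z %% p)%N = absz (a %% p)%Z.
  by rewrite modn_small// -ltz_nat gez0_abs ?modz_ge0// ltz_pmod// ltz_nat.
rewrite !E => /(congr1 Posz); rewrite !gez0_abs ?modz_ge0// => /eqP.
by rewrite eq_sym eqz_mod_dvd => /dvdzP.
Qed.

Section levels.
Variables (R : realType) (p d : nat).
Hypothesis hp : (2 <= p)%N.
Local Notation G := (Ginf p d).
Implicit Types (x y z g : G) (m n : nat).

Let p0 : (p%:R : rat) != 0.
Proof. by rewrite pnatr_eq0; case: p hp. Qed.

Lemma Zinv_valB (a b : Zinv p) : Zinv_val (a - b) = Zinv_val a - Zinv_val b.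
Proof. by []. Qed.

Lemma clearsP z n :
  reflect (forall j, p%:R ^+ n * Zinv_val (z 0 j) \is a Num.int) (clears z n).
Proof. exact: forallP. Qed.

Lemma clears0 n : clears (0 : G) n.
Proof. by apply/clearsP => j; rewrite mxE mulr0 rpred0. Qed.

Lemma clearsB x y n : clears x n -> clears y n -> clears (x - y) n.
Proof.
move=> /clearsP hx /clearsP hy; apply/clearsP => j.
by rewrite !mxE Zinv_valB mulrBr rpredB.
Qed.

Lemma clearsN x n : clears x n -> clears (- x) n.
Proof. by move=> hx; rewrite -sub0r clearsB// clears0. Qed.

Lemma clearsD x y n : clears x n -> clears y n -> clears (x + y) n.
Proof. by move=> hx hy; rewrite -[y]opprK clearsB// clearsN. Qed.

Lemma clears_subC x y n : clears (x - y) n = clears (y - x) n.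
Proof. by apply/idP/idP => /clearsN; rewrite opprB. Qed.

Lemma clears_tri z x y n : clears (x - z) n -> clears (z - y) n -> clears (x - y) n.
Proof. by move=> h h'; have := clearsD h h'; rewrite addrA subrK. Qed.

Lemma clears_leq z m n : (m <= n)%N -> clears z m -> clears z n.
Proof.
move=> mn /clearsP hz; apply/clearsP => j.
by rewrite -(subnK mn) exprD -mulrA rpredM// rpredX// rpred_nat.
Qed.

Definition level z := ex_minn (clears_ex z).

Lemma clears_level z n : clears z n = (level z <= n)%N.
Proof.
rewrite /level; case: ex_minnP => m hm min; apply/idP/idP; first exact: min.
by move=> mn; exact: clears_leq hm.
Qed.

Lemma Ffun_level z : Ffun R z = p%:R ^+ level z.
Proof. by rewrite /Ffun /Fmin natrX. Qed.

Lemma Ffun_ge1 z : 1 <= Ffun R z.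
Proof. by rewrite Ffun_level exprn_ege1// ler1n; case: p hp. Qed.

Lemma xcoordB j x y : xcoord R j (x - y) = xcoord R j x - xcoord R j y.
Proof. by rewrite /xcoord !mxE Zinv_valB rmorphB. Qed.

(** The elements of level at most [m] form a subgroup; its cosets are indexed by
canonical representatives, which makes the quotient a subset of the group. *)
Definition coset_rep m x : G := choose (fun y => clears (x - y) m) x.

Lemma coset_repP m x : clears (x - coset_rep m x) m.
Proof.
by apply: (@chooseP _ (fun y => clears (x - y) m)); rewrite subrr clears0.
Qed.

Lemma coset_rep_eq m x y : clears (x - y) m -> coset_rep m x = coset_rep m y.
Proof.
move=> xy; rewrite /coset_rep (@eq_choose _ _ (fun z => clears (y - z) m)) => [|z].
  by apply: choose_id; rewrite ?subrr ?clears0// clears_subC.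
by apply/idP/idP; apply: clears_tri; rewrite // clears_subC.
Qed.

Lemma coset_repE m x y : (coset_rep m x == coset_rep m y) = clears (x - y) m.
Proof.
apply/eqP/idP => [e|]; last exact: coset_rep_eq.
apply: clears_tri (coset_repP m x) _; rewrite e clears_subC; exact: coset_repP.
Qed.

Lemma coset_rep_id m x : coset_rep m (coset_rep m x) = coset_rep m x.
Proof. by apply/coset_rep_eq; rewrite clears_subC coset_repP. Qed.

(** A coset of level m inside a given coset of level m+1 is determined by d digits
modulo p. *)
Lemma count_coset_rep m y (J : {fset G}) :
  \sum_(i <- J) (if (coset_rep m i == i) && clears (y - i) m.+1 then (1 : R) else 0)
    <= (p ^ d)%:R.
Proof.
have pp : (0 < p)%N by case: p hp.
pose q i j : rat := p%:R ^+ m.+1 * Zinv_val ((y - i) 0 j).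
pose res i : {ffun 'I_d -> 'I_p} := [ffun j =>
  Ordinal (ltn_pmod (absz (Num.floor (q i j) %% p)%Z) pp)].
rewrite -big_mkcond /= -big_filter.
have -> : (p ^ d)%:R = \sum_(r <- enum {: {ffun 'I_d -> 'I_p}}) (1 : R).
  rewrite big_const_seq count_predT iter_addr_0 -cardE card_ffun !card_ord.
  by [].
apply: (sum_inj_le (h := res) (w := fun=> 1)) => [//|||i _].
- by rewrite filter_uniq// fset_uniq.
- move=> i i'; rewrite !mem_filter => /andP[/andP[/eqP ri ci] _].
  move=> /andP[/andP[/eqP ri' ci'] _] e.
  rewrite -ri -ri'; apply: coset_rep_eq; apply/clearsP => j.
  have := congr1 (fun f : {ffun 'I_d -> 'I_p} => val (f j)) e.
  rewrite !ffunE /= /q.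
  have /clearsP/(_ j) := ci; have /clearsP/(_ j) := ci'.
  set b := p%:R ^+ _ * _; set a := p%:R ^+ _ * _ => ib ia.
  have -> : p%:R ^+ m * Zinv_val ((i - i') 0 j) = (b - a) / p%:R.
    by rewrite /a /b exprS !mxE !Zinv_valB; field; exact: p0.
  move=> /(absz_modz_inj pp)[r hr].
  have -> : b - a = (Num.floor b - Num.floor a)%:~R.
    by rewrite rmorphB /= !floorK.
  by rewrite hr rmorphM /= mulfK.
- by rewrite mem_enum.
Qed.

End levels.

(** * Cutting off the denominators and the coordinates *)

Section kernel_precompactness.
Variables (R : realType) (p d : nat).
Hypothesis hp : (2 <= p)%N.
Local Notation G := (Ginf p d).
Variable sigma : G -> G -> R[i].
Hypothesis sigma1 : forall g h, cabs (sigma g h) = 1.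
Hypothesis cocycle : forall g h k,
  sigma g h * sigma (g + h) k = sigma g (h + k) * sigma h k.
Implicit Types (k : G -> R[i]) (K : G -> G -> R[i]) (x y z g i : G) (m n : nat) (C : R).

Let rc1 : (1 : R)%:C%C = 1 :> R[i]. Proof. by []. Qed.
Let rc0 : (0 : R)%:C%C = 0 :> R[i]. Proof. by []. Qed.

Let pR : 0 < (p%:R : R). Proof. by rewrite ltr0n; case: p hp. Qed.

(** The matrix, in the canonical basis, of the formal sum of the k(g) lambda(g). *)
Definition twk k x y : R[i] := sigma (x - y) y * k (x - y).

(** By the cocycle identity, right translations act on these matrices by conjugation
with diagonal unitaries. *)
Lemma twk_translate k i x y : twk k x y =
  sigma (x - i) i * (sigma (y - i) i)^-1 * twk k (x - i) (y - i).
Proof.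
have n0 : sigma (y - i) i != 0 by rewrite -cabs_eq0 sigma1 oner_eq0.
have xy : x - i - (y - i) = x - y by rewrite opprB addrA subrK.
rewrite /twk xy; have := cocycle (x - y) (y - i) i.
rewrite addrA !subrK => e.
have -> : sigma (x - y) y = sigma (x - y) (y - i) * sigma (x - i) i / sigma (y - i) i.
  by rewrite e mulfK.
by ring.
Qed.

(** Between vectors of level at most m and vectors of level exactly m+1 the
commutator with F multiplies matrix entries by numbers of size at least
p^(m+1) - p^m. Translation carries this corner to every coset of the group of
level m, and p^d cosets make up one coset of level m+1. *)
Lemma kbound_level_step k m :
  kbound (fun x y => (Ffun R x - Ffun R y)%:C%C * twk k x y) 1 ->
  kbound (fun x y => if clears (x - y) m.+1 && ~~ clears (x - y) m
                     then twk k x y else 0)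
         ((p%:R ^+ m)^-1 * Num.sqrt (p ^ d)%:R).
Proof.
move=> hK; have pm : 0 < (p%:R ^+ m : R) by rewrite exprn_gt0.
pose T i x y := if clears (x - i) m && (clears (y - i) m.+1 && ~~ clears (y - i) m)
  then twk k x y else 0.
have hT0 : kbound (T 0) (p%:R ^+ m)^-1.
  (* On this corner F(y) = p^(m+1) is constant, so dividing by F(x) - F(y) is a
     diagonal multiplication. *)
  pose u x : R[i] := if clears x m
    then (p%:R ^+ m / (Ffun R x - p%:R ^+ m.+1))%:C%C else 0.
  pose v y : R[i] := if clears y m.+1 && ~~ clears y m then 1 else 0.
  have gap x : clears x m -> p%:R ^+ m <= p%:R ^+ m.+1 - Ffun R x.
    rewrite clears_level Ffun_level => lx.
    have h1 : (p%:R ^+ level x : R) <= p%:R ^+ m.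
      by rewrite ler_weXn2l// ler1n; case: p hp.
    have h2 : 2 * (p%:R ^+ m : R) <= p%:R ^+ m.+1.
      by rewrite exprS ler_wpM2r ?(ltW pm)// ler_nat.
    rewrite lerBrDr; apply: le_trans (lerD (lexx _) h1) _.
    by rewrite -mulr2n -[leLHS]mulr_natl.
  have u1 x : cabs (u x) <= 1.
    rewrite /u; case: ifP => cx; last by rewrite cabs0.
    have g := gap x cx; have g0 := lt_le_trans pm g.
    rewrite cabs_real normrM normfV gtr0_norm// distrC gtr0_norm//.
    by rewrite ler_pdivrMr// mul1r.
  have v1 y : cabs (v y) <= 1 by rewrite /v; case: ifP; rewrite ?cabs0 ?cabs1.
  have := kboundZ ((p%:R ^+ m)^-1)%:C%C (kbound_diag ler01 u1 v1 hK).
  rewrite cabs_real gtr0_norm ?invr_gt0// mulr1; apply: kbound_ext => x y.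
  rewrite /T !subr0 /u /v.
  case: (boolP (clears x m)) => [cx|_]; last by rewrite !mul0r mulr0.
  case: ifPn => [/andP[cy ncy]|_]; last by rewrite mulr0 mul0r mulr0.
  have ly : Ffun R y = p%:R ^+ m.+1.
    rewrite Ffun_level; congr (_ ^+ _); apply/eqP; rewrite eqn_leq.
    by rewrite -clears_level cy ltnNge -clears_level.
  have g0 : Ffun R x - p%:R ^+ m.+1 != 0.
    by rewrite -oppr_eq0 opprB gt_eqF// (lt_le_trans pm)// gap.
  rewrite ly mulr1 mulrA mulrA -!realcM.
  rewrite (_ : (_ * _ * _)%:C%C = 1) ?mul1r//.
  by rewrite mulrA mulVf ?gt_eqF// mul1r mulVf.
have hT i : kbound (T i) (p%:R ^+ m)^-1.
  have ti := kbound_relabel (subrK i) (addrK i) hT0.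
  have s1 x : cabs (sigma (x - i) i) <= 1 by rewrite sigma1.
  have s2 x : cabs (sigma (x - i) i)^-1 <= 1.
    by rewrite -[leLHS]mul1r -{1}(sigma1 (x - i) i) -cabsM mulfV ?cabs1// -cabs_eq0 sigma1 oner_eq0.
  have pm' : 0 <= (p%:R ^+ m : R)^-1 by rewrite invr_ge0 ltW.
  apply: kbound_ext (kbound_diag pm' s1 s2 ti) => x y.
  rewrite /T !subr0; case: ifP => _; last by rewrite mulr0.
  by rewrite -twk_translate.
pose psi i y : R :=
  if (coset_rep m i == i) && clears (y - i) m.+1 then 1 else 0.
apply: (kbound_schur (f := coset_rep m) (Tk := T) (psi := psi)) => //.
- by rewrite ltr0n expn_gt0; case: p hp.
- move=> x y; rewrite /psi coset_rep_id eqxx /T.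
  move: (coset_rep m x) (coset_repP m x) => i xi; rewrite xi !andTb.
  have xi' := clears_leq (leqnSn m) xi.
  have e n : clears (x - i) n -> clears (x - y) n = clears (y - i) n.
    move=> h; apply/idP/idP => h'; last first.
      by apply: clears_tri h _; rewrite clears_subC.
    by apply: clears_tri h; rewrite clears_subC.
  by rewrite (e _ xi') (e _ xi); case: (clears (y - i) m.+1); rewrite ?andTb ?andFb ?rc1 ?rc0 ?mulr1 ?mulr0.
- move=> J y; apply: le_trans (count_coset_rep R hp m y J).
  rewrite le_eqVlt; apply/orP; left; apply/eqP; apply: eq_bigr => i _.
  by rewrite /psi; case: ifP; rewrite ?expr1n ?expr0n.
Qed.

(** Restriction to the cosets of a subgroup is a block diagonal compression. *)
Lemma kbound_level K C n : 0 <= C -> kbound K C ->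
  kbound (fun x y => if clears (x - y) n then K x y else 0) C.
Proof.
move=> C0 hK; rewrite -[C]mulr1 -[X in _ * X]sqrtr1.
pose psi i y : R := if coset_rep n y == i then 1 else 0.
apply: (kbound_schur (f := coset_rep n) (Tk := fun=> K) (psi := psi)) => //.
- move=> x y; rewrite /psi coset_repE clears_subC.
  by case: ifP => _; rewrite ?rc1 ?rc0 ?mulr1 ?mulr0.
- move=> J y; case: (boolP (coset_rep n y \in J)) => yJ.
    rewrite (big_fsetD1 (coset_rep n y))//= /psi eqxx expr1n.
    rewrite big_seq big1 ?addr0// => i; rewrite in_fsetD1 eq_sym.
    by move=> /andP[/negPf -> _]; rewrite expr0n.
  rewrite big_seq big1// => i iJ; rewrite /psi ifN ?expr0n//.
  by apply: contraNneq yJ => ->.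
Qed.

(** Summing the steps over the levels beyond n gives a geometric series, dominated
by powers of 1/2; a finite section meets only finitely many levels. *)
Lemma kbound_level_tail k n :
  kbound (fun x y => (Ffun R x - Ffun R y)%:C%C * twk k x y) 1 ->
  kbound (fun x y => if clears (x - y) n then 0 else twk k x y)
         (Num.sqrt (p ^ d)%:R * 2 / 2 ^+ n).
Proof.
move=> hK; set s := Num.sqrt _; have s0 : 0 <= s by exact: sqrtr_ge0.
have hm m : kbound (fun x y =>
    if clears (x - y) (n + m)%N && ~~ clears (x - y) n then twk k x y else 0)
    (s * 2 / 2 ^+ n - s * 2 / 2 ^+ (n + m)).
  elim: m => [|m ih].
    rewrite addn0 subrr; apply: kbound_ext (@kbound0 R G 0 (lexx _)) => x y.
    by case: (clears _ _).
  have st := kboundD ih (kbound_level_step (n + m) hK).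
  apply: kbound_le; last first.
    apply: kbound_ext st => x y; rewrite addnS; case: (boolP (clears (x - y) n)) => cn.
      by rewrite (clears_leq (leq_addr m n) cn) !andbF addr0.
    case: (boolP (clears (x - y) (n + m)%N)) => cm.
      by rewrite (clears_leq (leqnSn _) cm) /= addr0.
    by rewrite /= !andbT add0r.
  rewrite -/s addnS exprS; set t : R := 2 ^+ (n + m).
  have t0 : 0 < t by rewrite exprn_gt0.
  have h : (p%:R ^+ (n + m))^-1 <= t^-1.
    rewrite lef_pV2 ?posrE ?exprn_gt0//.
    by rewrite lerXn2r ?nnegrE ?ler0n ?ler_nat.
  have h2 : (p%:R ^+ (n + m))^-1 * s <= t^-1 * s by rewrite ler_wpM2r.
  have -> : s * 2 / (2 * t) = s * 2 / t - t^-1 * s by field; rewrite gt_eqF.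
  by move: h2; lra.
apply: kbound_local => S S'.
pose m := (\max_(x <- S) \max_(y <- S') level (x - y)%R)%N.
exists (fun x y =>
    if clears (x - y) (n + m)%N && ~~ clears (x - y) n then twk k x y else 0).
  apply: kbound_le (hm m); rewrite gerBl divr_ge0 ?mulr_ge0 ?exprn_ge0//.
move=> x y xS yS; have -> : clears (x - y) (n + m)%N.
  rewrite clears_level; apply: leq_trans (leq_addl _ _).
  apply: leq_trans (_ : (\max_(y <- S') level (x - y)%R <= _)%N).
    exact: (@leq_bigmax_seq _ _ xpredT (fun y => level (x - y))).
  exact: (@leq_bigmax_seq _ _ xpredT (fun x => \max_(y <- S') level (x - y)%R)%N).
by case: (clears _ n).
Qed.

(** Distinct points of a coset of the lattice (1/a)Z have distinct integer labels. *)
Lemma sum_lattice_le (a b : R) (w : nat -> R) C (J : {fset R}) : 0 < a ->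
  (forall l : nat, 0 <= w l) -> (forall n, \sum_(0 <= l < n) w l <= C) ->
  \sum_(r <- J) (if a * (r - b) \is a Num.int
                 then w (absz (Num.floor (a * (r - b)))) else 0) <= C *+ 2.
Proof.
move=> a0 w0 wC; rewrite -big_mkcond /= -big_filter.
rewrite -(big_map (fun r : R => Num.floor (a * (r - b))) xpredT (fun l : int => w (absz l))).
apply: sum_int_le => //; rewrite map_inj_in_uniq ?filter_uniq ?fset_uniq//.
move=> i i'; rewrite !mem_filter => /andP[hi _] /andP[hi' _].
move=> /(congr1 (fun l : int => l%:~R : R)); rewrite !floorK//.
by move=> /(mulfI (lt0r_neq0 a0)) /addIr.
Qed.

Lemma scaled_coord_int j g n : clears g n -> p%:R ^+ n * xcoord R j g \is a Num.int.
Proof.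
move=> /clearsP/(_ j) /intrP[q hq]; apply/intrP; exists q.
by rewrite /xcoord -(ratr_int _ q) -hq rmorphM rmorphXn /= ratr_nat.
Qed.

Let cut n j M x y := `|p%:R ^+ n * xcoord R j (x - y)| < M%:R :> R.

(** Discarding the entries with a large j-th coordinate difference divides the
commutator with the j-th coordinate by that difference; on a lattice the
reciprocals are square summable, with small tails. *)
Lemma kbound_coord_tail K C n j M : 0 <= C -> (2 <= M)%N ->
  (forall x y, ~~ clears (x - y) n -> K x y = 0) ->
  kbound (fun x y => (xcoord R j x - xcoord R j y)%:C%C * K x y) C ->
  kbound (fun x y => if cut n j M x y then 0 else K x y)
    (C * Num.sqrt ((p%:R ^+ n) ^+ 2 * (M.-1%:R^-1 *+ 2))).
Proof.
move=> C0 M2 K0 hK; have pn : 0 < (p%:R ^+ n : R) by rewrite exprn_gt0.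
pose q (i : R) y := p%:R ^+ n * (i - xcoord R j y).
pose psi (i : R) y : R := if (q i y \is a Num.int) && (M%:R <= `|q i y|)
  then p%:R ^+ n / q i y else 0.
have M0 : 0 < M%:R :> R by rewrite ltr0n (leq_trans _ M2).
apply: (kbound_schur (f := xcoord R j) (psi := psi)
  (Tk := fun _ x y => (xcoord R j x - xcoord R j y)%:C%C * K x y)) => //.
- rewrite mulr_gt0 ?exprn_gt0// mulrn_wgt0// invr_gt0 ltr0n.
  by rewrite -ltnS prednK// (leq_trans _ M2).
- move=> x y; rewrite /psi /q -xcoordB /cut.
  case: (boolP (clears (x - y) n)) => cxy; last first.
    by rewrite K0// ?mulr0 mul0r if_same.
  rewrite (scaled_coord_int j cxy) /=; case: leP => h; last by rewrite rc0 mulr0.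
  have x0 : xcoord R j (x - y) != 0.
    by apply: contraTneq h => ->; rewrite mulr0 normr0 -ltNge.
  have e (a u : R) : a != 0 -> u != 0 -> u * (a / (a * u)) = 1.
    by move=> a1 u1; field; rewrite u1 a1.
  by rewrite mulrAC -realcM e ?mul1r// gt_eqF.
- move=> J y.
  pose w (l : nat) : R := if (M <= l)%N then ((l%:R : R) ^+ 2)^-1 else 0.
  have w0 l : 0 <= w l by rewrite /w; case: ifP; rewrite ?invr_ge0 ?sqr_ge0.
  have := sum_lattice_le (xcoord R j y) J pn w0 (fun n => sum_inv_sqr_le R n M2).
  rewrite -(ler_pM2l (exprn_gt0 2 pn)) mulr_sumr; apply: le_trans.
  apply: ler_sum => i _; rewrite /psi /q; case: ifPn => [/andP[hi hM]|_]; last first.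
    rewrite expr0n /= mulr_ge0 ?sqr_ge0//.
    by case: ifP.
  rewrite hi /w; set f := Num.floor _.
  have fE : p%:R ^+ n * (i - xcoord R j y) = f%:~R by rewrite /f floorK.
  have af : `|f%:~R| = (absz f)%:R :> R by rewrite natr_absz intr_norm.
  rewrite fE af ler_nat in hM *; rewrite hM expr_div_n -af.
  by rewrite real_normK ?num_real.
Qed.

(** The discarded part is treated by the previous estimate, but the next coordinate
needs the retained part to stay bounded: at most 2M values of the j-th
coordinate survive in each column. *)
Lemma kbound_coord_cut K C n j M : 0 <= C -> (2 <= M)%N ->
  (forall x y, ~~ clears (x - y) n -> K x y = 0) ->
  kbound K C ->
  kbound (fun x y => if cut n j M x y then K x y else 0)
    (C * Num.sqrt (M%:R *+ 2)).
Proof.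
move=> C0 M2 K0 hK; have pn : 0 < (p%:R ^+ n : R) by rewrite exprn_gt0.
pose q (i : R) y := p%:R ^+ n * (i - xcoord R j y).
pose psi (i : R) y : R := if (q i y \is a Num.int) && (`|q i y| < M%:R) then 1 else 0.
have M0 : 0 < M%:R :> R by rewrite ltr0n (leq_trans _ M2).
apply: (kbound_schur (f := xcoord R j) (psi := psi) (Tk := fun=> K)) => //.
- by rewrite mulrn_wgt0.
- move=> x y; rewrite /psi /q -xcoordB /cut.
  case: (boolP (clears (x - y) n)) => cxy; last first.
    by rewrite K0// mul0r if_same.
  by rewrite (scaled_coord_int j cxy) /=; case: ifP => _; rewrite ?rc1 ?rc0 ?mulr1 ?mulr0.
- move=> J y.
  pose w (l : nat) : R := if (l < M)%N then 1 else 0.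
  have w0 l : 0 <= w l by rewrite /w; case: ifP.
  have wM l : \sum_(0 <= l' < l) w l' <= M%:R.
    have -> : M%:R = \sum_(l' <- iota 0 M) (1 : R).
      by rewrite big_const_seq count_predT iter_addr_0 size_iota.
    rewrite /w -big_mkcond -big_filter; apply: sum_uniq_le => //.
      by rewrite filter_uniq// iota_uniq.
    by move=> l'; rewrite mem_filter mem_iota add0n => /andP[].
  apply: le_trans (sum_lattice_le (xcoord R j y) J pn w0 wM).
  apply: ler_sum => i _; rewrite /psi /q; case: ifPn => [/andP[hi hM]|_]; last first.
    by rewrite expr0n /=; case: ifP.
  rewrite hi /w; set f := Num.floor _.
  have fE : p%:R ^+ n * (i - xcoord R j y) = f%:~R by rewrite /f floorK.
  have af : `|f%:~R| = (absz f)%:R :> R by rewrite natr_absz intr_norm.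
  by rewrite fE af ltr_nat in hM; rewrite hM expr1n.
Qed.

End kernel_precompactness.

(** * Approximation by kernels of finite support *)

Section finite_support_approximation.
Variables (R : realType) (p d : nat).
Hypothesis hp : (2 <= p)%N.
Local Notation G := (Ginf p d).
Variable sigma : G -> G -> R[i].
Hypothesis sigma1 : forall g h, cabs (sigma g h) = 1.
Hypothesis cocycle : forall g h k,
  sigma g h * sigma (g + h) k = sigma g (h + k) * sigma h k.
Implicit Types (K : G -> G -> R[i]) (x y g : G).
Local Notation dX j x y := ((xcoord R j x - xcoord R j y)%:C%C).

Lemma sqrt_small (a e : R) : 0 <= a -> 0 < e ->
  exists2 M, (2 <= M)%N & Num.sqrt (a * (M.-1%:R^-1 *+ 2)) <= e.
Proof.
move=> a0 e0; have e20 : 0 < e ^+ 2 by rewrite exprn_gt0.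
pose x := a * 2 / e ^+ 2; have x0 : 0 <= x by rewrite divr_ge0 ?mulr_ge0// ltW.
exists (Num.bound x).+2 => //=; rewrite -[leRHS](ger0_norm (ltW e0)) -sqrtr_sqr.
apply: ler_wsqrtr; have xb := archi_boundP x0.
have b0 : 0 < (Num.bound x).+1%:R :> R by rewrite ltr0n.
rewrite -[_ *+ 2]mulr_natr mulrCA [leLHS]mulrC ler_pdivrMr// [leRHS]mulrC -ler_pdivrMr// -/x; apply: le_trans (ltW xb) _.
by rewrite ler_nat.
Qed.

(** Cutting off the coordinates one at a time: each cut keeps the commutators
with the remaining coordinates bounded, only by a worse constant. *)
Lemma kbound_box n (s : seq 'I_d) (e : R) : 0 < e ->
  exists (m : pred G) (B : R) (N : nat), [/\ 0 <= B,
    (forall g j, m g -> j \in s -> `|p%:R ^+ n * xcoord R j g| < N%:R),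
    (forall K C, 0 <= C -> (forall x y, ~~ clears (x - y) n -> K x y = 0) ->
       kbound K C -> kbound (fun x y => if m (x - y) then K x y else 0) (C * B)) &
    (forall K, (forall x y, ~~ clears (x - y) n -> K x y = 0) ->
       (forall j, j \in s -> kbound (fun x y => dX j x y * K x y) 1) ->
       kbound (fun x y => if m (x - y) then 0 else K x y) e)].
Proof.
elim: s e => [|j s ih] e e0.
  exists predT, 1, 0%N; split=> //= [K C _ _|K _ _]; first by rewrite mulr1.
  exact/kbound0/ltW.
have e2 : 0 < e / 2 by rewrite divr_gt0.
have [m [B [N [B0 mN mB me]]]] := ih _ e2.
have B1 : 0 < B + 1 by rewrite ltr_wpDl.
have pn : 0 <= (p%:R ^+ n : R) ^+ 2 by rewrite sqr_ge0.
have [M M2 hM] := sqrt_small pn (divr_gt0 e2 B1).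
exists (fun g => m g && (`|p%:R ^+ n * xcoord R j g| < M%:R)).
exists (B * Num.sqrt (M%:R *+ 2)), (maxn N M); split.
- by rewrite mulr_ge0// sqrtr_ge0.
- move=> g i /andP[mg hg]; rewrite in_cons => /predU1P[->|/(mN g i mg) h].
    by apply: lt_le_trans hg _; rewrite ler_nat leq_maxr.
  by apply: lt_le_trans h _; rewrite ler_nat leq_maxl.
- move=> K C C0 K0 hK; rewrite mulrA.
  have h := mB K C C0 K0 hK.
  have h0 x y : ~~ clears (x - y) n -> (if m (x - y) then K x y else 0) = 0.
    by move=> c; rewrite K0// if_same.
  have CB : 0 <= C * B by rewrite mulr_ge0.
  apply: kbound_ext (kbound_coord_cut hp j CB M2 h0 h) => x y.
  by case: (m _); rewrite ?if_same.
move=> K K0 hK.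
pose K1 x y := if m (x - y) then K x y else 0.
have K10 x y : ~~ clears (x - y) n -> K1 x y = 0.
  by move=> c; rewrite /K1 K0// if_same.
have hK1 : kbound (fun x y => dX j x y * K1 x y) B.
  have := mB (fun x y => dX j x y * K x y) 1 ler01 _ (hK j (mem_head _ _)).
  rewrite mul1r => h; apply: kbound_ext (h _) => [x y|x y c].
    by rewrite /K1; case: ifP; rewrite ?mulr0.
  by rewrite K0// mulr0.
have h1 := kbound_coord_tail hp B0 M2 K10 hK1.
have h2 := me K K0 (fun i si => hK i (mem_behead (s := j :: s) si)).
apply: kbound_le (kbound_ext _ (kboundD h2 h1)) => [|x y]; last first.
  by rewrite /K1; case: (m _) => /=; rewrite ?add0r// if_same addr0.
rewrite [leRHS]splitr lerD2l; apply: le_trans (ler_wpM2l B0 hM) _.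
by rewrite mulrA ler_pdivrMr// mulrC ler_pM2l// lerDl.
Qed.

Lemma box_finite n (N : nat) : exists W : {fset G}, forall g, clears g n ->
  (forall j, `|p%:R ^+ n * xcoord R j g| < N%:R) -> g \in W.
Proof.
have p0 : (p%:R ^+ n : rat) != 0 by rewrite expf_neq0// pnatr_eq0; case: p hp.
pose gr (r : {ffun 'I_d -> 'I_N.*2}) : G :=
  \row_j insubd (0 : Zinv p) (((r j)%:R - N%:R) / p%:R ^+ n).
exists [fset x | x in map gr (enum {: {ffun 'I_d -> 'I_N.*2}})]%fset.
move=> g /clearsP cg hg; rewrite inE /=.
have /choice[r hr] : forall j, exists o : 'I_N.*2,
    Zinv_val (g 0 j) = ((o : nat)%:R - N%:R) / p%:R ^+ n.
  move=> j; have /intrP[q hq] := cg j.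
  have qN : `|q| < N%:Z.
    have := hg j; rewrite /xcoord.
    have -> : p%:R ^+ n * ratr (Zinv_val (g 0 j)) = q%:~R :> R.
      by rewrite -(ratr_int _ q) -hq rmorphM rmorphXn /= ratr_nat.
    by rewrite -intr_norm -[N%:R]/(N%:Z%:~R) ltr_int.
  have qN0 : 0 <= q + N%:Z by move: qN; rewrite ltr_norml; lia.
  have qlt : (absz (q + N%:Z)%R < N.*2)%N.
    by move: qN; rewrite ltr_norml -addnn; lia.
  exists (Ordinal qlt) => /=.
  rewrite natr_absz (ger0_norm qN0) rmorphD /= addrK -hq mulrC mulKf//.
apply/mapP; exists (finfun r); first by rewrite mem_enum.
apply/rowP => j; rewrite mxE ffunE -hr; apply: val_inj.
by rewrite /= insubdK// ZinvP.
Qed.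

(** The commutator with F allows to cut off the denominators, the commutators with the
coordinates then allow to cut these off, and the resulting box is finite. *)
Theorem twk_precompact (e : R) : 0 < e -> exists W : {fset G}, forall k : G -> R[i],
  kbound (fun x y => (Ffun R x - Ffun R y)%:C%C * twk sigma k x y) 1 ->
  (forall j, kbound (fun x y => dX j x y * twk sigma k x y) 1) ->
  kbound (fun x y => if x - y \in W then 0 else twk sigma k x y) e.
Proof.
move=> e0; have e2 : 0 < e / 2 by rewrite divr_gt0.
pose s : R := Num.sqrt (p ^ d)%:R * 2.
have s0 : 0 <= s by rewrite mulr_ge0// sqrtr_ge0.
have [n hn] : exists n, s / 2 ^+ n <= e / 2.
  have p1 : 0 < s + 1 by rewrite ltr_wpDl.
  have h0 : (0 : R) <= 2^-1 by rewrite invr_ge0.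
  have h1 : (2^-1 : R) < 1 by rewrite invf_lt1// ltr1n.
  have [n hn] := geom_small h0 h1 (divr_gt0 e2 p1); exists n.
  have := hn n (leqnn n); rewrite exprVn ltr_pdivlMr// => /ltW; apply: le_trans.
  by rewrite mulrC ler_wpM2l ?invr_ge0 ?exprn_ge0// lerDl.
have [m [B [N [B0 mN mB me]]]] := kbound_box n (enum 'I_d) e2.
have [W hW] := box_finite n N.
exists [fset g in W | clears g n && m g]%fset => k hF hX.
pose K x y := if clears (x - y) n then twk sigma k x y else 0.
have K0 x y : ~~ clears (x - y) n -> K x y = 0 by rewrite /K => /negPf ->.
have h1 := kbound_level_tail hp sigma1 cocycle n hF.
have h2 : kbound (fun x y => if m (x - y) then 0 else K x y) (e / 2).
  apply: me => // j _; have := kbound_level n ler01 (hX j).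
  by apply: kbound_ext => x y; rewrite /K; case: ifP; rewrite ?mulr0.
apply: kbound_le (kbound_ext _ (kboundD h1 h2)) => [|x y].
  by rewrite [leRHS]splitr lerD2r.
rewrite /K !inE /=; case: (boolP (clears (x - y) n)) => c /=; last first.
  by rewrite if_same addr0 andbF.
rewrite add0r; case: (boolP (m (x - y))) => mxy; last by rewrite andbF.
by rewrite hW// => j; apply: mN => //; rewrite mem_enum.
Qed.

End finite_support_approximation.

(** * The twisted group algebra *)

Section twisted_algebra.
Variables (R : realType) (G : zmodType) (sigma : G -> G -> R[i]).
Hypothesis hsigma : circle_cocycle sigma.
Hypothesis hnormal : normalized_cocycle sigma.
Local Notation L := ('l2(G; R)).
Local Notation ipL := (@l2_ip R G _ (@cip R)).
Local Notation N := (hnorm ipL).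
Local Notation lam := (lambda sigma).
Implicit Types (g h x y : G) (xi eta : L) (a b : L -> L) (S : {fset G}).

Lemma hnorm_cip (z : R[i]) : hnorm (@cip R) z = cabs z.
Proof.
apply/eqP; rewrite -(eqrXn2 (ltn0Sn 1)) ?hnorm_ge0 ?cabs_ge0//.
by rewrite sqr_hnorm; change (complex.Re (z * conjC z) == cabs z ^+ 2); rewrite mul_conj.
Qed.

Lemma sigma_abs g h : cabs (sigma g h) = 1.
Proof. by apply: complexI; rewrite cabsE hsigma.1. Qed.

Lemma sigma_mul_conj g h : sigma g h * conjC (sigma g h) = 1.
Proof. by rewrite mul_conj sigma_abs expr1n. Qed.

Lemma sigma_neq0 g h : sigma g h != 0.
Proof. by rewrite -cabs_eq0 sigma_abs oner_eq0. Qed.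

Lemma sigma0l h : sigma 0 h = 1.
Proof.
have e : sigma 0 0 = 1 by rewrite -{2}oppr0 hnormal.
have := hsigma.2 0 0 h; rewrite !add0r e mul1r => /esym.
by rewrite -{3}[sigma 0 h]mul1r => /(mulIf (sigma_neq0 _ _)).
Qed.

Lemma sigma0r g : sigma g 0 = 1.
Proof.
have := hsigma.2 g 0 0; rewrite !addr0 sigma0l mulr1.
by rewrite -{3}[sigma g 0]mulr1 => /(mulfI (sigma_neq0 _ _)).
Qed.

(** Normalization makes lambda(-g) the inverse of lambda(g), hence its adjoint. *)
Lemma sigma_inv g h : sigma (- g) (g + h) = conjC (sigma g h).
Proof.
have := hsigma.2 (- g) g h.
have -> : sigma (- g) g = 1 by rewrite -{2}[g]opprK hnormal.
rewrite addNr sigma0l mul1r => e.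
by rewrite -[LHS]mulr1 -(sigma_mul_conj g h) mulrA -e mul1r.
Qed.

Lemma shift_sum_le xi g S :
  \sum_(h <- S) hnorm (@cip R) (sigma g (h - g) * xi (h - g)) ^+ 2 <= N xi ^+ 2.
Proof.
under eq_bigr do rewrite hnorm_cip cabsM sigma_abs mul1r -hnorm_cip.
apply: le_trans (l2_sum_le xi [fset h - g | h in S]%fset).
by rewrite big_imfset //= => x y _ _ /addIr.
Qed.

Lemma lambdaE g xi h : lam g xi h = sigma g (h - g) * xi (h - g).
Proof. by rewrite /lambda to_l2E//; apply: l2_mem (shift_sum_le xi g). Qed.

Lemma lambda_linear g : linear (lam g).
Proof.
move=> k xi eta; apply: l2_ext => h.
by rewrite l2DE l2ZE !lambdaE l2DE l2ZE /GRing.scale /= mulrDr mulrCA.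
Qed.

Lemma lambda_bound g : opbound ipL (lam g) 1.
Proof.
move=> xi; rewrite mul1r; apply: l2_norm_le; first exact: hnorm_ge0.
move=> S; under eq_bigr do rewrite lambdaE.
exact: shift_sum_le.
Qed.

Lemma lambda_comp g h : lam g \o lam h = sigma g h *: lam (g + h).
Proof.
apply/funext => xi; apply: l2_ext => x; rewrite opZE l2ZE !lambdaE.
rewrite /GRing.scale /= opprD addrA !mulrA; congr (_ * _).
by rewrite hsigma.2 [h + _]addrC subrK.
Qed.

Lemma lambda0 : lam 0 = idfun.
Proof.
by apply/funext => xi; apply: l2_ext => x; rewrite lambdaE subr0 sigma0l mul1r.
Qed.

Lemma csum_shift (F : G -> R[i]) g : csum (fun h => F (h - g)) = csum F.
Proof.
have re (f : G -> \bar R) : (\esum_(h in setT) f (h - g)%R = \esum_(h in setT) f h)%E.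
  apply/esym; apply: (@reindex_esum R G G setT setT (fun h => h - g) f).
  split=> //; first by move=> x y _ _ /addIr.
  by move=> y _; exists (y + g) => //; rewrite addrK.
have rs (f : G -> R) : rsum (fun h => f (h - g)) = rsum f.
  rewrite /rsum; congr (fine (_ - _)%E).
    by rewrite -(re (EFin \o f)^\+%E); apply: eq_esum => h _; rewrite !funeposE.
  by rewrite -(re (EFin \o f)^\-%E); apply: eq_esum => h _; rewrite !funenegE.
rewrite /csum; congr (_ +i* _)%C.
  exact: (rs (fun h => complex.Re (F h))).
exact: (rs (fun h => complex.Im (F h))).
Qed.

Lemma lambda_adjoint g : adjoint ipL (lam g) (lam (- g)).
Proof.
move=> xi eta; rewrite /= /l2_ip -[RHS](csum_shift _ g); congr csum.
apply/funext => h; rewrite !lambdaE opprK subrK.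
change (sigma g (h - g) * xi (h - g) * conjC (eta h) =
  xi (h - g) * conjC (sigma (- g) h * eta h)); rewrite rmorphM /=.
have -> : sigma (- g) h = conjC (sigma g (h - g)) by rewrite -sigma_inv addrC subrK.
by rewrite conjCK; ring.
Qed.

(** Coefficients are arbitrary functions, so that one support serves several sums. *)
Definition fsum_lambda S (c : G -> R[i]) : L -> L := \sum_(g <- S) c g *: lam g.

Lemma fsum_lambdaE S c xi : fsum_lambda S c xi = \sum_(g <- S) c g *: lam g xi.
Proof.
by rewrite /fsum_lambda op_sumE.
Qed.

Lemma range_lambda_fs a :
  range (lambda_fs sigma) a <-> exists S c, a = fsum_lambda S c.
Proof.
split=> [[f _ <-]|[S [c ->]]].
  by exists (finsupp f), f; apply/funext => xi; rewrite fsum_lambdaE.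
exists [fsfun g in S => c g | 0]%fset => //; apply/funext => xi.
rewrite fsum_lambdaE /lambda_fs; set f := fsfun_of_fun _ _ _ _.
have fE g : f g = if g \in S then c g else 0 by rewrite /f fsfunE.
have sub : (finsupp f `<=` S)%fset.
  by apply/fsubsetP => g; rewrite mem_finsupp fE; case: ifP => //; rewrite eqxx.
rewrite [RHS](big_fsetID _ (mem (finsupp f)))/= addrC.
rewrite [X in _ = X + _]big_seq [X in _ = X + _]big1 ?add0r => [|g].
  have -> : [fset x in S | x \in finsupp f]%fset = finsupp f.
    apply/fsetP => g; rewrite !inE /= andb_idl// => gf.
    exact: (fsubsetP sub).
  rewrite big_seq [RHS]big_seq; apply: eq_bigr => g gf.
  by rewrite fE (fsubsetP sub).
rewrite !inE /= mem_finsupp fE => /andP[gS]; rewrite gS negbK => /eqP ->.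
by rewrite scale0r.
Qed.

Local Notation B := (range (lambda_fs sigma)).

Lemma fs_lambda c g : B (c *: lam g).
Proof.
apply/range_lambda_fs; exists [fset g]%fset, (fun=> c).
by rewrite /fsum_lambda big_seq_fset1.
Qed.

Lemma fs_lin k a b : B a -> B b -> B (k *: a + b).
Proof.
move=> /range_lambda_fs[S [c ->]] /range_lambda_fs[S' [c' ->]].
have ext (A A' : {fset G}) (e : G -> R[i]) : (A `<=` A')%fset ->
    fsum_lambda A e = fsum_lambda A' (fun g => if g \in A then e g else 0).
  move=> sA; rewrite /fsum_lambda [RHS](big_fsetID _ (mem A))/=.
  rewrite [X in _ = _ + X]big_seq [X in _ = _ + X]big1 ?addr0 => [|g]; last first.
    by rewrite !inE /= => /andP[_ /negPf ->]; rewrite scale0r.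
  have -> : [fset x in A' | x \in A]%fset = A.
    by apply/fsetP => g; rewrite !inE /= andb_idl// => /(fsubsetP sA).
  by rewrite big_seq [RHS]big_seq; apply: eq_bigr => g ->.
rewrite (ext _ _ c (fsubsetUl S S')) (ext _ _ c' (fsubsetUr S S')).
apply/range_lambda_fs; exists (S `|` S')%fset.
exists (fun g => k * (if g \in S then c g else 0) + (if g \in S' then c' g else 0)).
rewrite /fsum_lambda scaler_sumr -big_split; apply: eq_bigr => g _ /=.
by rewrite scalerA scalerDl.
Qed.

Lemma fs_0 : B 0.
Proof. by apply/range_lambda_fs; exists fset0, (fun=> 0); rewrite /fsum_lambda big_seq_fset0. Qed.

Lemma fs_sum (I : Type) (r : seq I) (F : I -> L -> L) :
  (forall i, B (F i)) -> B (\sum_(i <- r) F i).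
Proof.
move=> h; elim/big_rec: _ => [|i x _ Bx]; first exact: fs_0.
by rewrite -[F i]scale1r; exact: fs_lin.
Qed.

Lemma fsum_lambda_linear S c : linear (fsum_lambda S c).
Proof.
move=> k xi eta; rewrite !fsum_lambdaE scaler_sumr -big_split.
apply: eq_bigr => g _ /=; rewrite lambda_linear scalerDr !scalerA.
by rewrite mulrC.
Qed.

Lemma fs_bounded : B `<=` bounded_operator ipL.
Proof.
move=> a /range_lambda_fs[S [c ->]]; apply/bounded_operatorP; split.
  exact: fsum_lambda_linear.
exists (\sum_(g <- S) cabs (c g) * 1).
  by apply: sumr_ge0 => g _; rewrite mulr1 cabs_ge0.
by apply: opbound_sum => g; apply: opboundZ; exact: lambda_bound.
Qed.

Lemma fs_star_algebra : star_algebra ipL B.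
Proof.
split; [exact: fs_bounded|exact: fs_0|exact: fs_lin|..].
- move=> a b /range_lambda_fs[S [c ->]] /range_lambda_fs[S' [c' ->]].
  rewrite (_ : _ \o _ = \sum_(g <- S) \sum_(h <- S') (c g * c' h * sigma g h) *: lam (g + h)).
    by apply: fs_sum => g; apply: fs_sum => h; exact: fs_lambda.
  apply/funext => xi /=; rewrite !fsum_lambdaE op_sumE; apply: eq_bigr => g _.
  rewrite (lin_sum _ _ _ (lambda_linear g)) scaler_sumr op_sumE.
  apply: eq_bigr => h _; rewrite (lin_Z _ _ (lambda_linear g)) !opZE.
  rewrite -[lam g (lam h xi)]/((lam g \o lam h) xi) lambda_comp opZE !scalerA.
  by rewrite mulrA.
- move=> a /range_lambda_fs[S [c ->]].
  exists (\sum_(g <- S) conjC (c g) *: lam (- g)).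
    by apply: fs_sum => g; exact: fs_lambda.
  move=> xi eta; rewrite fsum_lambdaE op_sumE ip_suml ip_sumr.
  apply: eq_bigr => g _; rewrite opZE ipZl ipZr conjCK; congr (_ * _).
  exact: lambda_adjoint.
Qed.

Local Notation A := (twisted_cstar sigma).

Lemma twisted_cstar_alg : unital_cstar_algebra ipL A.
Proof.
apply: norm_closure_cstar; first exact: l2_complete (@cip_complete R).
  exact: fs_star_algebra.
by rewrite -lambda0 -[lam 0]scale1r; exact: fs_lambda.
Qed.

Lemma twisted_cstarP a : A a <-> bounded_operator ipL a /\
  forall e : R, 0 < e -> exists2 b, B b & opbound ipL (a - b) e.
Proof. by apply: norm_closureP => b /fs_bounded []. Qed.

Lemma fs_twisted_cstar a : B a -> A a.
Proof.
move=> Ba; apply/twisted_cstarP; split; first exact: fs_bounded.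
move=> e e0; exists a => //; rewrite subrr.
by apply: opbound_le (ltW e0) _; exact: opbound0.
Qed.

Definition delta y : L := single (@cip R) y 1.
Definition kern a x y : R[i] := a (delta y) x.

Lemma kern_le a C x y : opbound ipL a C -> cabs (kern a x y) <= C.
Proof.
move=> h; rewrite -hnorm_cip; apply: le_trans (l2_pt_le _ _) _.
by apply: le_trans (h _) _; rewrite /delta single_norm hnorm_cip cabs1 mulr1.
Qed.

Lemma kernB a b x y : kern (a - b) x y = kern a x y - kern b x y.
Proof. by []. Qed.

Lemma kern_fsum S c x y :
  kern (fsum_lambda S c) x y = if x - y \in S then sigma (x - y) y * c (x - y) else 0.
Proof.
rewrite /kern fsum_lambdaE l2_sumE.
have E g : (c g *: lam g (delta y)) x = if g == x - y then sigma (x - y) y * c (x - y) else 0.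
  rewrite l2ZE lambdaE singleE.
  have -> : (x - g == y) = (g == x - y) by apply/eqP/eqP => [<-|->]; rewrite subKr.
  case: eqP => [->|_]; last by rewrite mulr0 scaler0.
  by rewrite subKr mulr1 /GRing.scale /= mulrC.
under eq_bigr do rewrite E.
case: ifPn => xS.
  rewrite (big_fsetD1 (x - y))//= eqxx big_seq big1 ?addr0// => g.
  by rewrite in_fsetD1 => /andP[/negPf -> _].
by rewrite big_seq big1// => g gS; rewrite ifN//; apply: contraNneq xS => <-.
Qed.

(** The identity holds for finite sums and passes to norm limits entrywise. *)
Lemma kern_twisted a x y : A a -> kern a x y = sigma (x - y) y * kern a (x - y) 0.
Proof.
move=> /twisted_cstarP[_ h]; apply/eqP; rewrite -subr_eq0; apply/eqP/le_cabs_eq0.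
move=> e e0; have e2 : 0 < e / 2 by rewrite divr_gt0.
have [b /range_lambda_fs[S [c ->]] hb] := h _ e2.
have := kern_le x y hb; have := kern_le (x - y) 0 hb.
rewrite !kernB !kern_fsum subr0 sigma0r mul1r.
set u := kern a x y; set v := kern a (x - y) 0.
set cg := (if _ then c _ else 0) => h1.
have -> : (if x - y \in S then sigma (x - y) y * c (x - y) else 0) =
  sigma (x - y) y * cg by rewrite /cg; case: ifP; rewrite ?mulr0.
move=> h2; have -> : u - sigma (x - y) y * v =
  (u - sigma (x - y) y * cg) - sigma (x - y) y * (v - cg) by ring.
apply: le_trans (cabsB _ _) _; rewrite [leRHS]splitr; apply: lerD => //.
by rewrite cabsM sigma_abs mul1r.
Qed.

Lemma finvec_delta S (xi : G -> R[i]) :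
  finvec (@cip R) S xi = \sum_(y <- S) xi y *: delta y.
Proof.
apply: eq_bigr => y _; rewrite /delta -singleZ; congr single.
by rewrite /GRing.scale /= mulr1.
Qed.

Lemma kern_finvec a S (xi : G -> R[i]) x : linear a ->
  a (finvec (@cip R) S xi) x = \sum_(y <- S) kern a x y * xi y.
Proof.
move=> la; rewrite finvec_delta (lin_sum _ _ _ la) l2_sumE.
apply: eq_bigr => y _; rewrite (lin_Z _ _ la) l2ZE mulrC.
by [].
Qed.

(** Test the kernel bound on a finitely supported f and on the conjugate of a finite
section of a(f), with the weights that balance the mean. *)
Lemma opbound_kern a C : 0 < C -> bounded_operator ipL a ->
  kbound (kern a) C -> opbound ipL a C.
Proof.
move=> C0 ba hK; apply: opbound_finvec => //; first exact: ltW.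
move=> S' xi; apply: l2_norm_le => [|S].
  by rewrite mulr_ge0 ?hnorm_ge0 ?ltW.
rewrite exprMn finvec_norm.
under eq_bigr do rewrite hnorm_cip.
under [X in _ <= _ * X]eq_bigr do rewrite hnorm_cip.
set f := finvec _ _ _; set n := \sum_(t <- S) _; set m := \sum_(t <- S') _.
have := kbound_scaled S S' xi (fun x => conjC (a f x)) (t := Num.sqrt C) _ hK.
rewrite sqrtr_gt0 sqr_sqrtr ?(ltW C0)// => /(_ C0).
have -> : \sum_(x <- S) \sum_(y <- S') kern a x y * xi y * conjC (a f x) = n%:C%C.
  have -> : n%:C%C = \sum_(x <- S) (cabs (a f x) ^+ 2)%:C%C.
    by rewrite /n; elim/big_rec2: _ => [//|x u v _ <-]; rewrite realcD.
  apply: eq_bigr => x _; rewrite -mul_conj.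
  have E : \sum_(y <- S') kern a x y * xi y = a f x by rewrite /f (kern_finvec S' xi x ba.1).
  by rewrite -[in RHS]E mulr_suml E.
have n0 : 0 <= n by apply: sumr_ge0 => x _; exact: sqr_ge0.
have -> : \sum_(x <- S) cabs (conjC (a f x)) ^+ 2 = n.
  by apply: eq_bigr => x _; rewrite cabs_conj.
rewrite cabs_real ger0_norm//.
have -> : C / 2 * (C * m + C^-1 * n) = C ^+ 2 * m / 2 + n / 2.
  by field; rewrite gt_eqF.
by move=> h; move: h; lra.
Qed.

End twisted_algebra.

(** * Amplification to vector-valued functions *)

Section amplification.
Variables (R : realType) (T : choiceType) (E : vectType R[i]).
Variable ipE : {dot E for conjC}.
Local Notation N := (hnorm ipE).
Local Notation K := ('l2(T; R)).
Local Notation H := (l2 T ipE).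
Local Notation ipK := (@l2_ip R T _ (@cip R)).
Local Notation ipH := (@l2_ip R T E ipE).
Local Notation e_ := (fun i : 'I_(\dim {:E}) => (vbasis {:E})`_i).
Local Notation amp := (fun a : K -> K => tensor_op (ipE := ipE) a idfun).
Implicit Types (f : K) (psi chi : H) (a b : K -> K).

Lemma square_summable_le (V V' : lmodType R[i]) (ip : {dot V for conjC})
    (ip' : {dot V' for conjC}) (u : T -> V) (u' : T -> V') (C : R) :
  u' \in square_summable ip' -> (forall t, hnorm ip (u t) <= C * hnorm ip' (u' t)) ->
  u \in square_summable ip.
Proof.
move=> hu' h; pose v := L2 hu'.
apply: (@l2_mem _ _ _ _ _ (C ^+ 2 * hnorm (@l2_ip R T V' ip') v ^+ 2)) => S.
apply: le_trans (ler_wpM2l (sqr_ge0 C) (l2_sum_le v S)).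
rewrite mulr_sumr; apply: ler_sum => t _; rewrite -exprMn.
rewrite -[leLHS]ger0_norm ?sqr_ge0// -[leRHS]ger0_norm ?sqr_ge0// !normrX.
rewrite ler_pXn2r ?nnegrE// ger0_norm ?hnorm_ge0// (le_trans (h t))//.
exact: ler_norm.
Qed.

Lemma l2_norm_pt_le (V V' : lmodType R[i]) (ip : {dot V for conjC})
    (ip' : {dot V' for conjC}) (u : l2 T ip) (u' : l2 T ip') (C : R) : 0 <= C ->
  (forall t, hnorm ip (u t) <= C * hnorm ip' (u' t)) ->
  hnorm (@l2_ip R T V ip) u <= C * hnorm (@l2_ip R T V' ip') u'.
Proof.
move=> C0 h; apply: l2_norm_le => [|S]; first by rewrite mulr_ge0// hnorm_ge0.
rewrite exprMn; apply: le_trans (ler_wpM2l (sqr_ge0 C) (l2_sum_le u' S)).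
rewrite mulr_sumr; apply: ler_sum => t _; rewrite -exprMn.
by rewrite ler_pXn2r ?nnegrE ?mulr_ge0 ?hnorm_ge0.
Qed.

Lemma coord_e i j : coord (vbasis {:E}) i (e_ j) = (i == j)%:R.
Proof. by rewrite coord_free ?(basis_free (vbasisP _))// eq_sym. Qed.

Lemma coord_sum_e (c : 'I_(\dim {:E}) -> R[i]) i :
  coord (vbasis {:E}) i (\sum_j c j *: e_ j) = c i.
Proof.
rewrite linear_sum (bigD1 i)//= linearZ /= coord_e eqxx mulr1 big1 ?addr0// => j ji.
by rewrite linearZ /= coord_e eq_sym (negPf ji) mulr0.
Qed.

Lemma l2_coordE i psi t : l2_coord i psi t = coord (vbasis {:E}) i (psi t).
Proof.
have [C C0 hC] := coord_bound ipE.
rewrite /l2_coord to_l2E//.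
apply: (square_summable_le (C := C) (l2funP psi)) => s.
by rewrite hnorm_cip.
Qed.

Lemma l2_coord_norm : exists2 C : R, 0 <= C &
  forall i psi, hnorm ipK (l2_coord i psi) <= C * hnorm ipH psi.
Proof.
have [C C0 hC] := coord_bound ipE; exists C => // i psi.
by apply: l2_norm_pt_le => // t; rewrite hnorm_cip l2_coordE.
Qed.

Lemma tensorE f v t : tensor ipE f v t = f t *: v.
Proof.
rewrite /tensor to_l2E//.
apply: (square_summable_le (C := N v) (l2funP f)) => s.
by rewrite nrmZ hnorm_cip mulrC.
Qed.

Lemma tensor_norm f v : hnorm ipH (tensor ipE f v) <= N v * hnorm ipK f.
Proof.
apply: l2_norm_pt_le => [|t]; first exact: hnorm_ge0.
by rewrite tensorE nrmZ hnorm_cip mulrC.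
Qed.

Lemma tensor_opE a (g : E -> E) psi t :
  tensor_op a g psi t = \sum_(i < \dim {:E}) a (l2_coord i psi) t *: g (e_ i).
Proof. by rewrite /tensor_op l2_sumE; apply: eq_bigr => i _; rewrite tensorE. Qed.

Lemma vec_coord (v : E) : \sum_(i < \dim {:E}) coord (vbasis {:E}) i v *: e_ i = v.
Proof. by apply/esym; exact: (coord_vbasis (memvf v)). Qed.

Lemma l2_coord_lin i k psi chi :
  l2_coord i (k *: psi + chi) = k *: l2_coord i psi + l2_coord i chi.
Proof.
apply: l2_ext => t; rewrite l2DE l2ZE !l2_coordE l2DE l2ZE linearP.
by [].
Qed.

Lemma l2_coord_amp i a psi : l2_coord i (amp a psi) = a (l2_coord i psi).
Proof. by apply: l2_ext => t; rewrite l2_coordE tensor_opE coord_sum_e. Qed.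

Lemma amp_linear a : linear a -> linear (amp a).
Proof.
move=> la k psi chi; apply: l2_ext => t.
have ampE x : amp a x t = \sum_i a (l2_coord i x) t *: e_ i := tensor_opE a idfun x t.
apply: etrans (ampE _) _.
apply: etrans _ (esym (congr2 (fun u v => k *: u + v) (ampE psi) (ampE chi))).
rewrite scaler_sumr -big_split; apply: eq_bigr => i _ /=.
by rewrite l2_coord_lin la l2DE l2ZE scalerDl scalerA.
Qed.

Lemma amp_bounded a : bounded_operator ipK a -> bounded_operator ipH (amp a).
Proof.
move=> /bounded_operatorP[la [C C0 hC]]; apply/bounded_operatorP.
split; first exact: amp_linear.
have [M M0 hM] := l2_coord_norm.
exists (\sum_(i < \dim {:E}) N (e_ i) * (C * M)).
  by apply: sumr_ge0 => i _; rewrite !mulr_ge0 ?hnorm_ge0.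
move=> psi; apply: le_trans (nrm_sum _ _ _ _) _; rewrite mulr_suml.
apply: ler_sum => i _; apply: le_trans (tensor_norm _ _) _.
rewrite -mulrA ler_wpM2l ?hnorm_ge0//; apply: le_trans (hC _) _.
by rewrite -mulrA ler_wpM2l.
Qed.

Lemma tensor_ip f f' v v' :
  ipH (tensor ipE f v) (tensor ipE f' v') = ipE v v' * ipK f f'.
Proof.
rewrite /l2_ip -csumZ; last exact: l2_ip_summable.
congr csum; apply/funext => t; rewrite !tensorE ipZl ipZr.
by change (f t * (conjC (f' t) * ipE v v') = ipE v v' * (f t * conjC (f' t))); ring.
Qed.

Lemma l2_tensor psi : psi = \sum_(i < \dim {:E}) tensor ipE (l2_coord i psi) (e_ i).
Proof.
apply: l2_ext => t; rewrite l2_sumE -[LHS]vec_coord; apply: eq_bigr => i _.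
by rewrite tensorE l2_coordE.
Qed.

(** By bilinearity it suffices to treat elementary tensors. *)
Lemma amp_adjoint a b : adjoint ipK a b -> adjoint ipH (amp a) (amp b).
Proof.
move=> ab psi chi; rewrite {1}[chi]l2_tensor {2}[psi]l2_tensor.
rewrite !ip_suml; apply: eq_bigr => i _; rewrite !ip_sumr; apply: eq_bigr => j _.
by rewrite [LHS]tensor_ip [RHS]tensor_ip; congr (_ * _); exact: ab.
Qed.

Lemma amp_representation (A : set (K -> K)) : A `<=` bounded_operator ipK ->
  unital_star_representation ipK ipH A amp.
Proof.
move=> hA; split=> [a /hA/amp_bounded//|k a b _ _|a b _ _|a b _ _|].
- apply/funext => psi; apply: l2_ext => t.
  rewrite [RHS]l2DE [X in _ = X + _]l2ZE !tensor_opE scaler_sumr -big_split.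
  apply: eq_bigr => i _; rewrite opDE opZE l2DE l2ZE scalerDl /=.
  by rewrite scalerA.
- apply/funext => psi; apply: l2_ext => t; rewrite [RHS]tensor_opE tensor_opE.
  by apply: eq_bigr => i _; rewrite l2_coord_amp.
- exact: amp_adjoint.
- apply/funext => psi; apply: l2_ext => t; rewrite tensor_opE.
  rewrite -[RHS]vec_coord; apply: eq_bigr => i _.
  by rewrite l2_coordE.
Qed.

End amplification.

(** * Clifford multiplication operators *)

Section subsequences.
Variable R : realType.

Definition infinitely (P : set nat) : Prop := forall n, exists2 m, (n <= m)%N & P m.

Lemma pigeonhole (P : set nat) (f : nat -> nat) k : infinitely P ->
  (forall i, P i -> (f i <= k)%N) -> exists c, infinitely (P `&` [set i | f i = c]).
Proof.
move=> iP fk; apply: contrapT => /forallNP h.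
have /choice[n hn] c : exists n, forall m, (n <= m)%N -> P m -> f m != c.
  have /existsNP[n hn] := h c; exists n => m nm Pm; apply/eqP => fm.
  by apply: hn; exists m.
have [m hm Pm] := iP (\max_(c < k.+1) n c)%N.
have fm : (f m < k.+1)%N by rewrite ltnS fk.
have := hn (f m) m _ Pm; rewrite eqxx => /(_ _)/notF; apply.
by apply: leq_trans hm; exact: (leq_bigmax (Ordinal fm)).
Qed.

(** Pigeonhole on the cells of a subdivision of [-B, B] into intervals of length e. *)
Lemma close_subsequence (P : set nat) (x : nat -> R) (B e : R) : infinitely P ->
  (forall i, `|x i| <= B) -> 0 < e ->
  exists P', [/\ infinitely P', P' `<=` P & forall i j, P' i -> P' j -> `|x i - x j| <= e].
Proof.
move=> iP xB e0; pose f i := Num.truncn ((x i + B) / e).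
have p0 i : 0 <= (x i + B) / e.
  rewrite divr_ge0 ?(ltW e0)// -lerBlDr sub0r.
  by have := xB i; rewrite ler_norml => /andP[].
have [|c hc] := @pigeonhole P f (Num.truncn ((B + B) / e)) iP.
  move=> i _; apply: le_truncn; rewrite ler_pM2r ?invr_gt0// lerD2r.
  by have := xB i; rewrite ler_norml => /andP[].
exists (P `&` [set i | f i = c]); split=> [//|i []//|i j [_ /= fi] [_ /= fj]].
have := truncn_itv (p0 i); have := truncn_itv (p0 j).
rewrite -/(f i) -/(f j) fi fj => /andP[h1 h2] /andP[h3 h4].
rewrite ler_pdivlMr// in h1; rewrite ler_pdivlMr// in h3.
rewrite ltr_pdivrMr// in h2; rewrite ltr_pdivrMr// in h4.
rewrite -natr1 mulrDl mul1r in h2; rewrite -natr1 mulrDl mul1r in h4.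
by rewrite ler_norml; apply/andP; split; move: h1 h2 h3 h4; lra.
Qed.

Lemma close_subsequences (I : eqType) (s : seq I) (P : set nat) (x : I -> nat -> R)
    (B e : R) : infinitely P ->
  (forall k i, `|x k i| <= B) -> 0 < e ->
  exists P', [/\ infinitely P', P' `<=` P &
    forall k i j, k \in s -> P' i -> P' j -> `|x k i - x k j| <= e].
Proof.
move=> iP xB e0; elim: s P iP => [|k s ih] P iP; first by exists P; split.
have [P1 [iP1 P1P h1]] := close_subsequence iP (xB k) e0.
have [P2 [iP2 P21 h2]] := ih P1 iP1; exists P2; split=> [//|i /P21/P1P//|l i j].
by rewrite in_cons => /predU1P[-> /P21 ? /P21 ?|ls]; [exact: h1|exact: h2].
Qed.

(** Diagonal extraction along a decreasing chain of index sets whose diameters tend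
to 0. *)
Lemma cauchy_subsequence (dist : nat -> nat -> R) :
  (forall P e, infinitely P -> 0 < e -> exists P', [/\ infinitely P', P' `<=` P &
     forall i j, P' i -> P' j -> dist i j <= e]) ->
  exists s : nat -> nat, {homo s : m n / (m < n)%N} /\
    forall e, 0 < e -> exists n, forall i j, (n <= i)%N -> (n <= j)%N ->
      dist (s i) (s j) <= e.
Proof.
move=> h.
have /choice[nxt hnxt] : forall Pk : set nat * nat, exists P', infinitely Pk.1 ->
    [/\ infinitely P', P' `<=` Pk.1 &
      forall i j, P' i -> P' j -> dist i j <= Pk.2.+1%:R^-1].
  move=> [P k]; have [iP|niP] := pselect (infinitely P); last by exists P.
  have [|P' hP'] := h P k.+1%:R^-1 iP; first by rewrite invr_gt0 ltr0n.
  by exists P'.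
pose Ps := fix Ps k := if k is k'.+1 then nxt (Ps k', k') else setT.
have iPs k : infinitely (Ps k).
  elim: k => [n|k ih]; first by exists n.
  by have [] := hnxt (Ps k, k) ih.
have sub k l : (k <= l)%N -> Ps l `<=` Ps k.
  elim: l => [|l ih]; first by rewrite leqn0 => /eqP ->.
  rewrite leq_eqVlt => /predU1P[->//|]; rewrite ltnS => /ih; apply: subset_trans.
  by have [_ + _] := hnxt (Ps l, l) (iPs l).
have /choice[g hg] : forall kn : nat * nat, exists m, (kn.2 < m)%N /\ Ps kn.1 m.
  by move=> [k n]; have [m nm Pm] := iPs k n.+1; exists m.
pose s := fix s k := if k is k'.+1 then g (k'.+2, s k') else g (1%N, 0%N).
have sP k : Ps k.+1 (s k) by case: k => [|k]; [exact: (hg (1%N, 0%N)).2|exact: (hg (k.+2, s k)).2].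
exists s; split; first by apply: homo_ltn => [x y z|k]; [exact: ltn_trans|exact: (hg (k.+2, s k)).1].
move=> e e0; have [n hn] := ltr_add_invr (y := 0) (x := e) e0.
exists n => i j ni nj.
have [_ _ hd] := hnxt (Ps n, n) (iPs n).
have Pi : Ps n.+1 (s i) by apply: sub (sP i); rewrite ltnS.
have Pj : Ps n.+1 (s j) by apply: sub (sP j); rewrite ltnS.
apply: le_trans (hd _ _ Pi Pj) _.
by move: hn; rewrite add0r => /ltW.
Qed.

End subsequences.

Section clifford_multiplication.
Variables (R : realType) (T : choiceType) (d : nat) (E : vectType R[i]).
Variables (ipE : {dot E for conjC}) (gamma : 'I_d.+1 -> 'End(E)).
Hypothesis hgamma : anticommuting_self_adjoint_unitaries ipE gamma.
Variable w : 'I_d.+1 -> T -> R.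
Local Notation N := (hnorm ipE).
Local Notation H := (l2 T ipE).
Local Notation ipH := (@l2_ip R T E ipE).
Local Notation NH := (hnorm ipH).
Implicit Types (t : T) (u v : E) (psi chi : H).

Lemma ip_inj u v : (forall x, ipE x u = ipE x v) -> u = v.
Proof.
move=> h; apply/eqP; rewrite -subr_eq0 -(hnorm_eq0 ipE) -sqrf_eq0.
by rewrite sqr_hnorm ipBr h subrr.
Qed.

Lemma gamma_sqr j v : gamma j (gamma j v) = v.
Proof. by case: hgamma => sa un _ _; apply: ip_inj => x; rewrite -sa un. Qed.

Lemma gamma_anticomm j k v :
  gamma j (gamma k v) + gamma k (gamma j v) = (2 * (j == k)%:R) *: v.
Proof.
have [->|jk] := eqVneq j k.
  by rewrite gamma_sqr mulr1 scaler_nat mulr2n.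
by case: hgamma => _ _ _ ac; rewrite ac// addNr mulr0 scale0r.
Qed.

(** Clifford multiplication by the vector of weights at t, which is the value at t of
the Dirac operator. *)
Definition cl t v : E := \sum_j (w j t)%:C%C *: gamma j v.
Definition wlen t : R := Num.sqrt (\sum_j w j t ^+ 2).

Lemma wlen_ge0 t : 0 <= wlen t. Proof. exact: sqrtr_ge0. Qed.

Lemma wlen_sqr t : wlen t ^+ 2 = \sum_j w j t ^+ 2.
Proof. by rewrite sqr_sqrtr// sumr_ge0// => j _; exact: sqr_ge0. Qed.

Lemma w_le_wlen j t : `|w j t| <= wlen t.
Proof.
rewrite -(ler_pXn2r (ltn0Sn 1)) ?nnegrE ?wlen_ge0// wlen_sqr (bigD1 j)//=.
rewrite real_normK ?num_real// lerDl sumr_ge0// => i _; exact: sqr_ge0.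
Qed.

Lemma cl_linear t : linear (cl t).
Proof.
move=> k u v; rewrite /cl scaler_sumr -big_split; apply: eq_bigr => j _ /=.
by rewrite linearP scalerDr !scalerA mulrC.
Qed.

Lemma cl_sa t u v : ipE (cl t u) v = ipE u (cl t v).
Proof.
rewrite /cl ip_suml ip_sumr; apply: eq_bigr => j _; rewrite ipZl ipZr conjC_real.
by case: hgamma => -> _ _ _.
Qed.

(** The cross terms cancel by anticommutation. *)
Lemma cl_sqr t v : cl t (cl t v) = (wlen t ^+ 2)%:C%C *: v.
Proof.
have two : (2 : R[i]) != 0 by rewrite pnatr_eq0.
apply: (scalerI two); rewrite [in LHS](_ : 2 = 1 + 1)// scalerDl scale1r.
pose c j k := (w j t)%:C%C * (w k t)%:C%C : R[i].
have e1 : cl t (cl t v) = \sum_j \sum_k c j k *: gamma j (gamma k v).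
  rewrite {1}/cl; apply: eq_bigr => j _; rewrite /cl linear_sum scaler_sumr.
  by apply: eq_bigr => k _; rewrite linearZ scalerA.
have e2 : cl t (cl t v) = \sum_j \sum_k c j k *: gamma k (gamma j v).
  rewrite e1 exchange_big; apply: eq_bigr => j _; apply: eq_bigr => k _ /=.
  by rewrite /c mulrC.
rewrite {1}e1 e2 -big_split wlen_sqr.
have -> : (\sum_j w j t ^+ 2)%:C%C = \sum_j c j j :> R[i].
  elim/big_rec2: _ => [//|j x y _ <-]; rewrite realcD; congr (_ + _).
  by rewrite /c -realcM -expr2.
rewrite scalerA mulr_sumr scaler_suml; apply: eq_bigr => j _ /=.
rewrite -big_split (bigD1 j)//= big1 ?addr0 => [|k kj].
  by rewrite -scalerDr gamma_anticomm eqxx mulr1 scalerA mulrC.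
by rewrite -scalerDr gamma_anticomm eq_sym (negPf kj) mulr0 scale0r scaler0.
Qed.

Lemma cl_norm t v : N (cl t v) = wlen t * N v.
Proof.
apply/eqP; rewrite -(eqrXn2 (ltn0Sn 1)) ?mulr_ge0 ?wlen_ge0 ?hnorm_ge0//.
have := ipxx ipE (cl t v); rewrite cl_sa cl_sqr ipZr conjC_real ipxx -realcM.
by move=> /complexI <-; rewrite exprMn.
Qed.

Definition wdom : set H :=
  [set psi | (fun t => (wlen t)%:C%C *: psi t) \in square_summable ipE].
Definition wdirac psi : H := \sum_j tensor_op (mul_op (w j)) (gamma j) psi.

Lemma wlenZ_norm t v : N ((wlen t)%:C%C *: v) = wlen t * N v.
Proof. by rewrite nrmZ cabs_real ger0_norm ?wlen_ge0. Qed.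

Lemma wdiracE psi t : wdom psi -> wdirac psi t = cl t (psi t).
Proof.
move=> dpsi; rewrite /wdirac l2_sumE; apply: eq_bigr => j _.
rewrite tensor_opE.
have mE i : mul_op (w j) (l2_coord i psi) t =
    (w j t)%:C%C * coord (vbasis {:E}) i (psi t).
  rewrite /mul_op to_l2E ?l2_coordE//.
  have [C C0 hC] := coord_bound ipE.
  apply: (square_summable_le (C := C) dpsi) => s.
  rewrite hnorm_cip cabsM cabs_real l2_coordE wlenZ_norm mulrCA.
  by apply: ler_pM; rewrite ?cabs_ge0// w_le_wlen.
rewrite -[in RHS](vec_coord (psi t)) linear_sum scaler_sumr.
by apply: eq_bigr => i _; rewrite mE linearZ scalerA.
Qed.

Lemma wdom_finvec S (x : T -> E) : wdom (finvec ipE S x).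
Proof.
rewrite /wdom /mkset; have -> : (fun t => (wlen t)%:C%C *: finvec ipE S x t) =
    finvec ipE S (fun t => (wlen t)%:C%C *: x t).
  by apply/funext => t; rewrite !finvecE; case: ifP; rewrite ?scaler0.
exact: l2funP.
Qed.

Lemma finvec1 t v : finvec ipE [fset t]%fset (fun=> v) = single ipE t v.
Proof. by rewrite /finvec big_seq_fset1. Qed.

Lemma wdom_lin k psi chi : wdom psi -> wdom chi -> wdom (k *: psi + chi).
Proof.
rewrite /wdom /mkset => h1 h2.
have -> : (fun t => (wlen t)%:C%C *: (k *: psi + chi) t) =
    k *: (fun t => (wlen t)%:C%C *: psi t) + (fun t => (wlen t)%:C%C *: chi t).
  apply/funext => t; rewrite !fctE l2DE l2ZE scalerDr !scalerA.
  by rewrite mulrC.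
by rewrite rpredD// rpredZ.
Qed.

Lemma wdirac_lin k psi chi : wdom psi -> wdom chi ->
  wdirac (k *: psi + chi) = k *: wdirac psi + wdirac chi.
Proof.
move=> h1 h2; apply: l2_ext => t.
transitivity (cl t (k *: psi t + chi t)); first exact: (wdiracE t (wdom_lin k h1 h2)).
rewrite cl_linear.
exact: (congr2 (fun x y => k *: x + y) (esym (wdiracE t h1)) (esym (wdiracE t h2))).
Qed.

Lemma cl_pairing psi chi psi' chi' : (forall t, psi' t = cl t (psi t)) ->
  (forall t, chi' t = cl t (chi t)) -> ipH psi' chi = ipH psi chi'.
Proof. by move=> e e'; apply: l2_pointwise_ip => t; rewrite e e' cl_sa. Qed.

(** Maximality of the domain: testing against vectors supported at one point
shows that the adjoint acts by the same pointwise formula. *)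
Lemma wdirac_self_adjoint : self_adjoint ipH wdom wdirac.
Proof.
split.
- rewrite /wdom /mkset; have -> : (fun t => (wlen t)%:C%C *: (0 : H) t) = 0.
    by apply/funext => t; rewrite l2_0E scaler0.
  exact: rpred0.
- by move=> k x y dx dy; split; [exact: wdom_lin|exact: wdirac_lin].
- move=> x e e0; have e2 : 0 < e / 2 by rewrite divr_gt0.
  have [S hS] := finvec_approx x e2; exists (finvec ipE S x).
    exact: wdom_finvec.
  by apply: le_lt_trans hS _; rewrite ltr_pdivrMr// ltr_pMr// ltr1n.
move=> y z; split=> [[dy <-] x dx|h].
  exact: (cl_pairing (fun t => wdiracE t dx) (fun t => wdiracE t dy)).
have key t : cl t (y t) = z t.
  apply: ip_inj => v; rewrite -cl_sa.
  have sw (u : E) (x : H) : ipH (single ipE t u) x = ipE u (x t).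
    apply: etrans (ip_conj ipH _ _) _; rewrite [RHS]ip_conj; congr conjC.
    exact: ip_single.
  have dv : wdom (single ipE t v) by rewrite -finvec1; exact: wdom_finvec.
  have := h _ dv.
  have -> : wdirac (single ipE t v) = single ipE t (cl t v).
    apply: l2_ext => s; rewrite wdiracE// !singleE; case: eqP => [->//|_].
    exact: (lin_0 (cl_linear s)).
  move=> hv; exact: etrans (esym (sw (cl t v) y)) (etrans hv (sw v z)).
have dy : wdom y.
  apply: (square_summable_le (C := 1) (l2funP z)) => t.
  by rewrite wlenZ_norm -cl_norm key mul1r.
by split=> //; apply: l2_ext => t; rewrite wdiracE.
Qed.

Hypothesis wlen_ge1 : forall t, 1 <= wlen t.
Hypothesis wlen_proper : forall r : R, exists W : {fset T},
  forall t, t \notin W -> r <= wlen t.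

(** The square of the Dirac operator is multiplication by the squared length, so this
is its inverse. *)
Definition winv psi : H := to_l2 ipE (fun t => (wlen t ^- 2)%:C%C *: cl t (psi t)).

Let wlen_gt0 t : 0 < wlen t.
Proof. exact: lt_le_trans (wlen_ge1 t). Qed.

Lemma winv_pt_norm psi t :
  N ((wlen t ^- 2)%:C%C *: cl t (psi t)) = (wlen t)^-1 * N (psi t).
Proof.
rewrite nrmZ cl_norm cabs_real ger0_norm ?invr_ge0 ?sqr_ge0// mulrA.
by congr (_ * _); field; rewrite gt_eqF.
Qed.

Lemma winvE psi t : winv psi t = (wlen t ^- 2)%:C%C *: cl t (psi t).
Proof.
rewrite /winv to_l2E//; apply: (square_summable_le (C := 1) (l2funP psi)) => s.
by rewrite winv_pt_norm ler_wpM2r ?hnorm_ge0// invf_le1.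
Qed.

Lemma winv_linear : linear winv.
Proof.
move=> k psi chi; apply: l2_ext => t; rewrite l2DE l2ZE !winvE l2DE l2ZE cl_linear.
by rewrite scalerDr !scalerA mulrC.
Qed.

Lemma winv_pt psi t : N (winv psi t) = (wlen t)^-1 * N (psi t).
Proof. by rewrite winvE winv_pt_norm. Qed.

(** The inverse is a norm limit of multiplications supported on the finite sets
where the length is small. *)
Lemma winv_compact : compact_operator ipH winv.
Proof.
split=> [|u [M0 uM0]]; first exact: winv_linear.
pose M := `|M0|; have M_ge0 : 0 <= M by exact: normr_ge0.
have uM n : NH (u n) <= M by apply: le_trans (uM0 n) (ler_norm _).
have [|s [smono hs]] := @cauchy_subsequence R (fun i j => NH (winv (u i) - winv (u j))).
  move=> P e iP e0.
  (* Over the points of length at least r, the images of two vectors of norm at most M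
     differ by at most e / 2. *)
  pose r := (M + M + 1) * 2 / e.
  have m1 : 0 < M + M + 1 by rewrite ltr_wpDl// addr_ge0.
  have r0 : 0 < r by rewrite divr_gt0// mulr_gt0.
  have [W hW] := wlen_proper r.
  have [C C0 hC] := coord_bound ipE.
  pose I := (T * 'I_(\dim {:E}) * bool)%type.
  pose x (k : I) n : R := let z := coord (vbasis {:E}) k.1.2 (winv (u n) k.1.1) in
    if k.2 then complex.Re z else complex.Im z.
  have NwM n t : N (winv (u n) t) <= M.
    rewrite winv_pt; apply: le_trans (uM n); apply: le_trans (l2_pt_le (u n) t).
    by rewrite ler_piMl ?hnorm_ge0// invf_le1.
  have xB k n : `|x k n| <= C * M.
    apply: (@le_trans _ _ (cabs (coord (vbasis {:E}) k.1.2 (winv (u n) k.1.1)))).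
      by rewrite /x; case: ifP => _; [exact: Re_le_cabs|exact: Im_le_cabs].
    by apply: le_trans (hC _ _) _; rewrite ler_wpM2l.
  pose Q : R := \sum_(t <- W) \sum_(i < \dim {:E}) N (vbasis {:E})`_i + 1.
  have Q0 : 0 < Q.
    by rewrite ltr_wpDl// sumr_ge0// => t _; rewrite sumr_ge0// => i _; exact: hnorm_ge0.
  pose dl := e / 2 / 2 / Q; have dl0 : 0 < dl by rewrite !divr_gt0.
  pose ks : seq I := [seq (ti, b) | ti <- [seq (t, i) | t <- enum_fset W,
     i <- enum 'I_(\dim {:E})], b <- [:: true; false]].
  have [P' [iP' P'P hP']] := close_subsequences ks iP xB dl0.
  exists P'; split=> // i j Pi Pj.
  set dv := winv (u i) - winv (u j).
  have -> : dv = (dv - finvec ipE W dv) + finvec ipE W dv by rewrite subrK.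
  apply: le_trans (nrmD _ _ _) _; rewrite [leRHS]splitr; apply: lerD.
    have t1 : NH (dv - finvec ipE W dv) <= r^-1 * NH (u i - u j).
      apply: l2_norm_pt_le => [|t]; first by rewrite invr_ge0 ltW.
      rewrite l2BE finvecE; case: ifPn => tW.
        by rewrite subrr hnorm0 mulr_ge0 ?hnorm_ge0// invr_ge0 ltW.
      rewrite subr0 /dv -(lin_B _ _ winv_linear) winv_pt ler_wpM2r ?hnorm_ge0//.
      by rewrite lef_pV2 ?posrE// hW.
    apply: le_trans t1 _; apply: (@le_trans _ _ (r^-1 * (M + M))).
      by rewrite ler_wpM2l ?invr_ge0 ?(ltW r0)// (le_trans (nrmB _ _ _))// lerD.
    have -> : r^-1 * (M + M) = e / 2 * ((M + M) / (M + M + 1)).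
      by rewrite /r; field; rewrite !gt_eqF.
    by rewrite ler_piMr ?(ltW (divr_gt0 _ _))// ler_pdivrMr// mul1r lerDl.
  have reB (z z' : R[i]) : complex.Re (z - z') = complex.Re z - complex.Re z'.
    by case: z z' => [? ?] [].
  have imB (z z' : R[i]) : complex.Im (z - z') = complex.Im z - complex.Im z'.
    by case: z z' => [? ?] [].
  have cdv t k : t \in W -> cabs (coord (vbasis {:E}) k (dv t)) <= dl + dl.
    move=> tW; apply: le_trans (cabs_le_ReIm _) _.
    rewrite /dv l2BE linearB reB imB; apply: lerD.
      apply: (hP' (t, k, true)) => //.
      apply/allpairsP; exists ((t, k), true); split=> //.
      by apply/allpairsP; exists (t, k); split; rewrite ?mem_enum.
    apply: (hP' (t, k, false)) => //.
    apply/allpairsP; exists ((t, k), false); split=> //.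
    by apply/allpairsP; exists (t, k); split; rewrite ?mem_enum.
  apply: le_trans (nrm_sum _ _ _ _) _.
  apply: (@le_trans _ _ ((dl + dl) * (Q - 1))); last first.
    apply: (@le_trans _ _ ((dl + dl) * Q)).
      by rewrite ler_wpM2l ?addr_ge0 ?(ltW dl0)// gerBl.
    suff -> : (dl + dl) * Q = e / 2 by [].
    by rewrite /dl; field; rewrite gt_eqF.
  rewrite /Q addrK mulr_sumr big_seq [leRHS]big_seq; apply: ler_sum => t tW.
  rewrite single_norm -[X in N X](vec_coord (dv t)) mulr_sumr.
  apply: le_trans (nrm_sum _ _ _ _) _; apply: ler_sum => k _.
  by rewrite nrmZ ler_wpM2r ?hnorm_ge0// cdv.
have [|l hl] := l2_complete (@fin_dim_complete R E ipE) (u := fun n => winv (u (s n))).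
  move=> e e0; have e2 : 0 < e / 2 by rewrite divr_gt0.
  have [n hn] := hs _ e2; exists n => i j ni nj.
  by apply: le_lt_trans (hn i j ni nj) _; rewrite ltr_pdivrMr// ltr_pMr// ltr1n.
by exists s, l.
Qed.

Lemma winv_wdom psi : wdom (winv psi).
Proof.
apply: (square_summable_le (C := 1) (l2funP psi)) => t.
by rewrite wlenZ_norm winv_pt mulrA mulfV ?gt_eqF.
Qed.

Lemma wdirac_compact_resolvent : compact_resolvent ipH wdom wdirac.
Proof.
exists 0, winv; split; first exact: winv_compact.
- move=> psi; split; first exact: winv_wdom.
  rewrite scale0r subr0; apply: l2_ext => t; rewrite wdiracE; last exact: winv_wdom.
  rewrite winvE (lin_Z _ _ (cl_linear t)) cl_sqr scalerA -realcM.
  by rewrite mulVf ?scale1r// gt_eqF// exprn_gt0.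
- move=> psi dpsi; rewrite scale0r subr0; apply: l2_ext => t.
  rewrite winvE wdiracE// cl_sqr scalerA -realcM.
  by rewrite mulVf ?scale1r// gt_eqF// exprn_gt0.
Qed.

End clifford_multiplication.

(** * The Dirac operator and its commutators with translations *)

Section dirac.
Variables (R : realType) (p d : nat).
Hypothesis hp : (2 <= p)%N.
Local Notation G := (Ginf p d).
Variable sigma : G -> G -> R[i].
Hypothesis hsigma : circle_cocycle sigma.
Hypothesis hnormal : normalized_cocycle sigma.
Variables (E : vectType R[i]) (ipE : {dot E for conjC}).
Hypothesis hE : (0 < \dim {:E})%N.
Variable gamma : 'I_d.+1 -> 'End(E).
Hypothesis hgamma : anticommuting_self_adjoint_unitaries ipE gamma.
Local Notation N := (hnorm ipE).
Local Notation K := ('l2(G; R)).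
Local Notation H := (l2 G ipE).
Local Notation ipK := (@l2_ip R G _ (@cip R)).
Local Notation ipH := (@l2_ip R G E ipE).
Local Notation NH := (hnorm ipH).
Local Notation lam := (lambda sigma).
Local Notation amp := (@amplification R p d E ipE).
Local Notation A := (twisted_cstar sigma).

(** One family of weights for all d+1 Clifford generators, so that the Dirac operator
is a single sum. *)
Definition weight (j : 'I_d.+1) (z : G) : R :=
  if insub (val j) is Some i then xcoord R i z else Ffun R z.

Local Notation dom := (@wdom R G d E ipE weight).
Local Notation D := (@wdirac R G d E ipE gamma weight).
Local Notation len := (wlen weight).

Lemma weight_widen i : weight (widen_ord (leqnSn d) i) = @xcoord R p d i.
Proof. by apply/funext => z; rewrite /weight /= valK. Qed.

Lemma weight_max : weight ord_max = @Ffun R p d.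
Proof. by apply/funext => z; rewrite /weight insubN//= ltnn. Qed.

Lemma Dinf_wdirac : @Dinf R p d E ipE gamma = D.
Proof.
apply/funext => psi; rewrite /Dinf /wdirac.
rewrite [RHS]big_ord_recr.
have e1 : tensor_op (ipE := ipE) (mul_op (@Ffun R p d)) (gamma ord_max) psi =
    tensor_op (mul_op (weight ord_max)) (gamma ord_max) psi by rewrite weight_max.
have e2 (j : 'I_d) : tensor_op (ipE := ipE) (mul_op (@xcoord R p d j)) (gamma (widen_ord (leqnSn d) j)) psi =
    tensor_op (mul_op (weight (widen_ord (leqnSn d) j))) (gamma (widen_ord (leqnSn d) j)) psi by rewrite weight_widen.
exact: (congr2 +%R (eq_bigr _ (fun j _ => e2 j)) e1).
Qed.

Lemma Lfun_wlen z : Defs.Lfun R z = len z.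
Proof.
rewrite /Defs.Lfun /wlen big_ord_recr /= weight_max; congr (Num.sqrt (_ + _)).
by apply: eq_bigr => j _; rewrite weight_widen real_normK ?num_real.
Qed.

Lemma Hdom_square_summable f : @Hdom R p d f <->
  (fun z => (len z)%:C%C * f z) \in square_summable (@cip R).
Proof.
rewrite unfold_in /Hdom /=; under [X in _ <-> is_true (X < _)%E]eq_esum => z _.
  rewrite hnorm_cip cabsM cabs_real ger0_norm ?wlen_ge0// exprMn -Lfun_wlen.
  over.
by [].
Qed.

Lemma Dinf_dom_wdom : @Dinf_dom R p d E ipE = dom.
Proof.
have [C C0 hC] := coord_bound ipE.
apply/seteqP; split=> psi /= h.
  rewrite /wdom /mkset.
  have -> : (fun z => (len z)%:C%C *: psi z) =
      \sum_(i < \dim {:E}) (fun z => ((len z)%:C%C * l2_coord i psi z) *: (vbasis {:E})`_i).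
    apply/funext => z; rewrite fct_sumE -[in LHS](vec_coord (psi z)) scaler_sumr.
    by apply: eq_bigr => i _; rewrite scalerA l2_coordE.
  apply: rpred_sum => i _; have /Hdom_square_summable hi := h i.
  apply: (square_summable_le (C := N (vbasis {:E})`_i) hi) => z.
  by rewrite nrmZ hnorm_cip mulrC.
move=> i; apply/Hdom_square_summable; apply: (square_summable_le (C := C) h) => z.
rewrite hnorm_cip cabsM cabs_real nrmZ cabs_real l2_coordE mulrCA.
by rewrite ler_wpM2l.
Qed.

Lemma len_ge1 z : 1 <= len z.
Proof.
apply: le_trans (w_le_wlen weight ord_max z); rewrite weight_max.
by apply: le_trans (ler_norm _); exact: Ffun_ge1.
Qed.

(** Balls are finite: a bound on F bounds the denominators, and then a bound on
the coordinates leaves finitely many numerators. *)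
Lemma len_proper (r : R) : exists W : {fset G}, forall z, z \notin W -> r <= len z.
Proof.
pose n := Num.bound r.
have rn : r <= n%:R.
  case: (leP 0 r) => r0; first exact: ltW (archi_boundP r0).
  by apply: le_trans (ltW r0) _; rewrite ler0n.
pose M := (p ^ n * n)%N.
have [W hW] := box_finite R d hp n M; exists W => z.
rewrite leNgt; apply: contra => zr; apply: hW => [|j].
  rewrite clears_level; case: (leqP (level z) n) => // nl; exfalso.
  have := le_lt_trans (w_le_wlen weight ord_max z) zr.
  rewrite weight_max => /(le_lt_trans (ler_norm _)); apply/negP; rewrite -leNgt.
  apply: le_trans rn _; rewrite Ffun_level -natrX ler_nat.
  by apply: leq_trans (ltnW nl) (ltnW (ltn_expl _ _)).
have := le_lt_trans (w_le_wlen weight (widen_ord (leqnSn d) j) z) zr.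
rewrite weight_widen => h; rewrite normrM ger0_norm ?exprn_ge0//.
rewrite /M natrM natrX ltr_pM2l; first exact: lt_le_trans h rn.
by rewrite exprn_gt0// ltr0n; case: p hp.
Qed.

(** The level of a sum is at most the larger of the two levels. *)
Lemma Ffun_sub_le (z g : G) : `|Ffun R z - Ffun R (z - g)| <= Ffun R g.
Proof.
have key (x y : G) : Ffun R (x + y) <= Ffun R x + Ffun R y.
  have c : clears (x + y) (maxn (level x) (level y)).
    by apply: clearsD; rewrite clears_level ?leq_maxl ?leq_maxr.
  rewrite clears_level in c; rewrite !Ffun_level.
  apply: (@le_trans _ _ (p%:R ^+ maxn (level x) (level y))).
    by rewrite ler_weXn2l// ler1n; case: p hp.
  have px n : 0 <= (p%:R ^+ n : R) by rewrite exprn_ge0.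
  by case: leqP => _; rewrite ?lerDl ?lerDr.
have FN (x : G) : Ffun R (- x) = Ffun R x.
  rewrite !Ffun_level; congr (_ ^+ _); apply/eqP; rewrite eqn_leq -!clears_level.
  apply/andP; split; first by apply: clearsN; rewrite clears_level.
  by have := @clearsN _ _ (- x) (level (- x)); rewrite opprK clears_level; apply.
rewrite ler_norml; apply/andP; split.
  by have := key z (- g); rewrite FN; move: (Ffun R z) (Ffun R (z - g)) (Ffun R g) => a b c; lra.
by rewrite lerBlDl; have := key (z - g) g; rewrite subrK.
Qed.

Lemma weight_sub_le j z g : `|weight j z - weight j (z - g)| <= len g.
Proof.
rewrite {1 2}/weight; case: insubP => [i ij hi|h].
  rewrite xcoordB subKr.
  have -> : xcoord R i g = weight j g by rewrite /weight -hi valK.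
  exact: w_le_wlen.
apply: le_trans (Ffun_sub_le z g) _.
have -> : Ffun R g = weight j g by rewrite /weight insubN.
by apply: le_trans (ler_norm _) (w_le_wlen _ _ _).
Qed.

(** Translation invariance of the domain: since the length is at least 1, the additive
error of a translation is absorbed by a factor. *)
Lemma len_shift z g : len z <= d.+1%:R * (1 + len g) * len (z - g).
Proof.
have g0 := wlen_ge0 weight g; have l1 := len_ge1 (z - g).
rewrite -mulrA; set q := (1 + len g) * len (z - g).
have q0 : 0 <= q by rewrite mulr_ge0 ?addr_ge0// wlen_ge0.
have dq : 0 <= d.+1%:R * q by rewrite mulr_ge0 ?ler0n.
rewrite -(ler_pXn2r (ltn0Sn 1)) ?nnegrE ?wlen_ge0// wlen_sqr.
have hj j : weight j z ^+ 2 <= q ^+ 2.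
  rewrite -[leLHS]real_normK ?num_real// ler_pXn2r ?nnegrE//.
  have := ler_normD (weight j z - weight j (z - g)) (weight j (z - g)).
  rewrite subrK => /le_trans; apply.
  apply: le_trans (lerD (weight_sub_le j z g) (w_le_wlen _ _ _)) _.
  rewrite /q mulrDl mul1r addrC lerD2l -[leLHS]mulr1 ler_wpM2l//.
apply: le_trans (ler_sum _ (fun j _ => hj j)) _.
rewrite sumr_const card_ord -[leLHS]mulr_natl [leRHS]exprMn ler_wpM2r ?sqr_ge0//.
by rewrite -natrX ler_nat leq_pmulr.
Qed.

Lemma gamma_norm j v : N (gamma j v) = N v.
Proof. by case: hgamma => _ un _ _; rewrite /hnorm un. Qed.

Lemma amp_lambdaE g psi z : amp (lam g) psi z = sigma g (z - g) *: psi (z - g).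
Proof.
rewrite /amplification tensor_opE -[in RHS](vec_coord (psi (z - g))) scaler_sumr.
by apply: eq_bigr => i _; rewrite lambdaE// l2_coordE scalerA.
Qed.

(** A quantitative form of [lipschitz]; explicit constants combine under linear
operations. *)
Definition lip_bound (a : K -> K) (C : R) : Prop :=
  (forall psi, dom psi -> dom (amp a psi)) /\
  (forall psi, dom psi -> NH (D (amp a psi) - amp a (D psi)) <= C * NH psi).

Lemma amp_lin k (a b : K -> K) : amp (k *: a + b) = k *: amp a + amp b.
Proof.
apply/funext => psi; apply: l2_ext => t.
rewrite [RHS]l2DE [X in _ = X + _]l2ZE !tensor_opE scaler_sumr -big_split.
apply: eq_bigr => i _; rewrite opDE opZE l2DE l2ZE scalerDl /=.
by rewrite scalerA.
Qed.

Lemma amp_lambda_bounded g : exists2 C, 0 <= C & opbound ipH (amp (lam g)) C.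
Proof.
have /amp_bounded : bounded_operator ipK (lam g).
  apply/bounded_operatorP; split; first exact: lambda_linear.
  by exists 1 => //; exact: lambda_bound.
by move=> /(_ E ipE) /bounded_operatorP[].
Qed.

(** Translation by g changes each weight by at most the length of g. *)
Lemma lip_bound_lambda g : exists2 C, 0 <= C & lip_bound (lam g) C.
Proof.
have [C C0 hC] := amp_lambda_bounded g.
have Nl (psi : H) z : N (amp (lam g) psi z) = N (psi (z - g)).
  by rewrite amp_lambdaE nrmZ sigma_abs// mul1r.
have hdom psi : dom psi -> dom (amp (lam g) psi).
  move=> dpsi; pose u := L2 dpsi.
  apply: (square_summable_le (C := d.+1%:R * (1 + len g)) (l2funP (amp (lam g) u))) => z.
  have e2 : N (amp (lam g) u z) = len (z - g) * N (psi (z - g)).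
    exact: etrans (Nl u z) (wlenZ_norm _ _ _ _).
  have e1 : N ((len z)%:C%C *: amp (lam g) psi z) = len z * N (psi (z - g)).
    exact: etrans (wlenZ_norm _ _ _ _) (congr1 _ (Nl psi z)).
  have aux (a b l l' n c : R) : a = l * n -> b = l' * n -> l <= c * l' -> 0 <= n ->
    a <= c * b by move=> -> -> h n0; rewrite mulrA ler_wpM2r.
  exact: aux e1 e2 (len_shift z g) (hnorm_ge0 _ _).
exists (d.+1%:R * len g * C); first by rewrite !mulr_ge0 ?ler0n ?wlen_ge0.
split=> // psi dpsi; rewrite -mulrA.
apply: le_trans (_ : _ <= d.+1%:R * len g * NH (amp (lam g) psi)) _; last first.
  by rewrite ler_wpM2l ?hC// mulr_ge0 ?ler0n ?wlen_ge0.
have c0 : 0 <= d.+1%:R * len g :> R by rewrite mulr_ge0 ?ler0n ?wlen_ge0.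
apply: l2_norm_pt_le => // z; rewrite l2BE.
have eD : D (amp (lam g) psi) z = cl gamma weight z (amp (lam g) psi z).
  exact: (wdiracE gamma z (hdom _ dpsi)).
have ea : amp (lam g) (D psi) z = cl gamma weight (z - g) (amp (lam g) psi z).
  apply: etrans (amp_lambdaE g (D psi) z) _.
  have e2 : cl gamma weight (z - g) (amp (lam g) psi z) =
      sigma g (z - g) *: cl gamma weight (z - g) (psi (z - g)).
    by rewrite amp_lambdaE (lin_Z _ _ (cl_linear _ _ _)).
  by rewrite e2 -(wdiracE gamma (z - g) dpsi).
have aux (x y x' y' : E) (c : R) : x = x' -> y = y' -> N (x' - y') <= c ->
  N (x - y) <= c by move=> -> ->.
apply: (aux _ _ _ _ _ eD ea).
rewrite /cl -sumrB; apply: le_trans (nrm_sum _ _ _ _) _.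
have -> : d.+1%:R * len g * N (amp (lam g) psi z) =
    \sum_(j < d.+1) len g * N (amp (lam g) psi z).
  by rewrite sumr_const card_ord -[RHS]mulr_natl mulrA.
apply: ler_sum => j _; rewrite -scalerBl -realcB nrmZ gamma_norm cabs_real.
by rewrite ler_wpM2r ?hnorm_ge0// weight_sub_le.
Qed.

Lemma lip_bound_lin k a b C C' : lip_bound a C -> lip_bound b C' ->
  lip_bound (k *: a + b) (cabs k * C + C').
Proof.
move=> [da ha] [db hb]; split=> psi dpsi.
  by rewrite amp_lin; apply: wdom_lin; [exact: da|exact: db].
rewrite amp_lin opDE opZE (wdirac_lin gamma k (da _ dpsi) (db _ dpsi)) opDE opZE.
have -> : k *: D (amp a psi) + D (amp b psi) -
    (k *: amp a (D psi) + amp b (D psi)) =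
  k *: (D (amp a psi) - amp a (D psi)) + (D (amp b psi) - amp b (D psi)).
  by rewrite scalerBr opprD addrACA.
apply: le_trans (nrmD _ _ _) _; rewrite nrmZ mulrDl -mulrA.
by apply: lerD; [rewrite ler_wpM2l ?cabs_ge0// ha|exact: hb].
Qed.

Lemma lip_bound_fs a : range (lambda_fs sigma) a -> exists2 C, 0 <= C & lip_bound a C.
Proof.
move=> /range_lambda_fs[S [c ->]]; rewrite /fsum_lambda.
elim/big_rec: _ => [|g a' _ [C C0 hC]]; last first.
  have [C' C0' hC'] := lip_bound_lambda g.
  exists (cabs (c g) * C' + C); last exact: lip_bound_lin.
  by rewrite addr_ge0// mulr_ge0// cabs_ge0.
have [C C0 hC] := lip_bound_lambda 0; exists (cabs (-1) * C + C).
  by rewrite addr_ge0// mulr_ge0// cabs_ge0.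
by have := lip_bound_lin (-1) hC hC; rewrite scaleN1r addNr.
Qed.

Lemma wdom_scale k x : dom x -> dom (k *: x) /\ D (k *: x) = k *: D x.
Proof.
have dom0 : dom (0 : H) by case: (wdirac_self_adjoint hgamma weight).
move=> dx; have := wdom_lin k dx dom0; rewrite addr0 => dkx; split=> //.
have := wdirac_lin gamma k dx dom0; rewrite addr0 => ->.
suff -> : D 0 = 0 by rewrite addr0.
have := wdirac_lin gamma (-1) dom0 dom0.
by rewrite scaler0 addr0 scaleN1r addNr.
Qed.

Lemma lip_boundZ k a C : lip_bound a C -> lip_bound (k *: a) (cabs k * C).
Proof.
have ampZ : amp (k *: a) = k *: amp a.
  have amp0 : amp 0 = 0 by have := amp_lin (-1) 0 0; rewrite !scaleN1r !addNr.
  by rewrite -[k *: a]addr0 amp_lin amp0 addr0.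
move=> [da ha]; split=> psi dpsi; rewrite ampZ opZE.
  exact: (wdom_scale k (da _ dpsi)).1.
rewrite (wdom_scale k (da _ dpsi)).2 opZE -scalerBr nrmZ -mulrA.
by rewrite ler_wpM2l ?cabs_ge0// ha.
Qed.

Lemma lip_boundP a C : linear a -> 0 <= C ->
  lip_bound a C <-> preserves dom (amp a) /\
    (opnorm ipH dom (commutator D (amp a)) <= C%:E)%E.
Proof.
move=> la C0; have lamp : linear (amp a) := amp_linear la.
have hZ := wdom_scale.
have hT : preserves dom (amp a) -> forall k x, dom x -> dom (k *: x) /\
    commutator D (amp a) (k *: x) = k *: commutator D (amp a) x.
  move=> pa k x dx; have [dkx Dkx] := hZ k x dx; split=> //.
  have e1 : D (amp a (k *: x)) = k *: D (amp a x).
    by rewrite (lin_Z k x lamp); exact: (hZ k _ (pa _ dx)).2.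
  have e2 : amp a (D (k *: x)) = k *: amp a (D x).
    by rewrite Dkx; exact: (lin_Z k (D x) lamp).
  apply: etrans (congr2 (fun u v => u - v) e1 e2) _.
  by rewrite -scalerBr.
split=> -[pa ha]; split=> //.
  by apply/(opnorm_leP ipH C0 (hT pa)) => x dx; exact: ha.
by move/(opnorm_leP ipH C0 (hT pa)) : ha => ha x dx; exact: ha.
Qed.

End dirac.

(** * Total boundedness of the Lipschitz ball *)

Lemma mul_le_half_sqrD (R : realFieldType) (b c : R) : b * c <= (b ^+ 2 + c ^+ 2) / 2.
Proof. by have := sqr_ge0 (b - c); rewrite sqrrB; lra. Qed.

Section metric.
Variables (R : realType) (p d : nat).
Hypothesis hp : (2 <= p)%N.
Local Notation G := (Ginf p d).
Variable sigma : G -> G -> R[i].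
Hypothesis hsigma : circle_cocycle sigma.
Hypothesis hnormal : normalized_cocycle sigma.
Variables (E : vectType R[i]) (ipE : {dot E for conjC}).
Hypothesis hE : (0 < \dim {:E})%N.
Variable gamma : 'I_d.+1 -> 'End(E).
Hypothesis hgamma : anticommuting_self_adjoint_unitaries ipE gamma.
Local Notation N := (hnorm ipE).
Local Notation K := ('l2(G; R)).
Local Notation H := (l2 G ipE).
Local Notation ipK := (@l2_ip R G _ (@cip R)).
Local Notation ipH := (@l2_ip R G E ipE).
Local Notation NH := (hnorm ipH).
Local Notation lam := (lambda sigma).
Local Notation amp := (@amplification R p d E ipE).
Local Notation A := (twisted_cstar sigma).
Local Notation weight := (@weight R p d).
Local Notation dom := (@wdom R G d E ipE weight).
Local Notation D := (@wdirac R G d E ipE gamma weight).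
Implicit Types (xi eta : G -> R[i]) (a : K -> K).

Definition finten (S : {fset G}) xi (v : E) : H := finvec ipE S (fun y => xi y *: v).

Lemma finten_norm S xi v : NH (finten S xi v) ^+ 2 =
  (\sum_(y <- S) cabs (xi y) ^+ 2) * N v ^+ 2.
Proof.
rewrite /finten finvec_norm mulr_suml; apply: eq_bigr => y _.
by rewrite nrmZ exprMn.
Qed.

Lemma amp_finten a S xi v z : linear a ->
  amp a (finten S xi v) z = (\sum_(y <- S) kern a z y * xi y) *: v.
Proof.
move=> la; rewrite /amplification tensor_opE.
have cE i : l2_coord i (finten S xi v) =
    coord (vbasis {:E}) i v *: finvec (@cip R) S xi.
  apply: l2_ext => t; rewrite l2_coordE l2ZE !finvecE.
  by case: ifP => _; rewrite ?linear0 ?scaler0// linearZ /= mulrC.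
rewrite -[in RHS](vec_coord v) scaler_sumr; apply: eq_bigr => i _.
rewrite cE (lin_Z _ _ la) l2ZE kern_finvec// scalerA mulrC.
by [].
Qed.

Lemma D_finten S xi v : D (finten S xi v) =
  \sum_j finten S (fun y => (weight j y)%:C%C * xi y) (gamma j v).
Proof.
apply: l2_ext => z; rewrite (wdiracE gamma z); last exact: wdom_finvec.
rewrite [RHS]l2_sumE /cl; apply: eq_bigr => j _; rewrite /finten !finvecE.
by case: ifP => _; rewrite ?linear0 ?scaler0// linearZ scalerA.
Qed.

Definition dkern a j x y : R[i] := (weight j x - weight j y)%:C%C * kern a x y.

Lemma commutator_finten a S xi v z : linear a ->
  dom (amp a (finten S xi v)) ->
  (D (amp a (finten S xi v)) - amp a (D (finten S xi v))) z =
  \sum_j (\sum_(y <- S) dkern a j z y * xi y) *: gamma j v.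
Proof.
move=> la da; rewrite l2BE.
have e1 : D (amp a (finten S xi v)) z = \sum_j ((weight j z)%:C%C *
    \sum_(y <- S) kern a z y * xi y) *: gamma j v.
  apply: etrans (wdiracE gamma z da) _; rewrite amp_finten//.
  by rewrite /cl; apply: eq_bigr => j _; rewrite linearZ scalerA.
have lamp : linear (amp a) := amp_linear la.
have e2 : amp a (D (finten S xi v)) z = \sum_j
    (\sum_(y <- S) kern a z y * ((weight j y)%:C%C * xi y)) *: gamma j v.
  rewrite D_finten (lin_sum _ _ _ lamp) l2_sumE.
  by apply: eq_bigr => j _; exact: amp_finten.
apply: etrans (congr2 (fun u w => u - w) e1 e2) _.
rewrite -sumrB; apply: eq_bigr => j _; rewrite -scalerBl; congr (_ *: _).
rewrite mulr_sumr -sumrB; apply: eq_bigr => y _.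
by rewrite /dkern realcB; ring.
Qed.

(** The Clifford relations isolate one coordinate of the commutator: pairing
with v and gamma_k v in both orders and adding leaves only the k-th term. *)
Lemma commutator_kbound a k : linear a -> lip_bound ipE gamma a 1 ->
  kbound (dkern a k) 1.
Proof.
move=> la [pa ha] S S' xi eta.
have [v v1] : exists v, N v = 1.
  pose e := (vbasis {:E})`_(Ordinal hE).
  have e0 : e != 0.
    apply/eqP => e0; have := basis_not0 (vbasisP {:E}) (_ : e \in vbasis {:E}).
    by rewrite mem_nth ?size_tuple// e0 eqxx => /(_ isT).
  have ne : N e != 0 by rewrite hnorm_eq0.
  exists ((N e)^-1%:C%C *: e).
  by rewrite nrmZ cabs_real ger0_norm ?invr_ge0 ?hnorm_ge0// mulVf.
pose F j : R[i] := \sum_(x <- S) \sum_(y <- S') dkern a j x y * xi y * eta x.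
pose Q := (\sum_(y <- S') cabs (xi y) ^+ 2 + \sum_(x <- S) cabs (eta x) ^+ 2) / 2.
have pair u u' : N u = 1 -> N u' = 1 ->
    cabs (\sum_j F j * ipE (gamma j u) u') <= Q.
  move=> u1 u'1; set X := finten S' xi u.
  have dX : dom X by exact: wdom_finvec.
  pose Y := finten S (fun x => conjC (eta x)) u'.
  have -> : \sum_j F j * ipE (gamma j u) u' = ipH (D (amp a X) - amp a (D X)) Y.
    rewrite [RHS]ip_finvec.
    have E1 x : ipE ((D (amp a X) - amp a (D X)) x) (conjC (eta x) *: u') =
        \sum_j (\sum_(y <- S') dkern a j x y * xi y * eta x) * ipE (gamma j u) u'.
      rewrite (commutator_finten _ la (pa _ dX)) ipZr conjCK ip_suml mulr_sumr.
      apply: eq_bigr => j _; rewrite ipZl mulrA mulr_sumr; congr (_ * _).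
      by apply: eq_bigr => y _; rewrite mulrC.
    rewrite (eq_bigr _ (fun x _ => E1 x)) exchange_big; apply: eq_bigr => j _ /=.
    by rewrite /F mulr_suml.
  apply: le_trans (cauchy_schwarz _ _ _) _.
  have h1 := ha X dX; rewrite mul1r in h1.
  have h2 : NH X ^+ 2 = \sum_(y <- S') cabs (xi y) ^+ 2.
    by rewrite /X finten_norm u1 expr1n mulr1.
  have h3 : NH Y ^+ 2 = \sum_(x <- S) cabs (eta x) ^+ 2.
    rewrite /Y finten_norm u'1 expr1n mulr1; apply: eq_bigr => x _.
    by rewrite cabs_conj.
  apply: le_trans (ler_wpM2r (hnorm_ge0 _ _) h1) _.
  by rewrite /Q -h2 -h3; exact: mul_le_half_sqrD.
(* For j = k the two pairings of the generators are both 1, and for j different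
   from k they cancel. *)
have gv : N (gamma k v) = 1 by rewrite (gamma_norm hgamma).
have h1 := pair v (gamma k v) v1 gv; have h2 := pair (gamma k v) v gv v1.
have sum2 : \sum_j F j * ipE (gamma j v) (gamma k v) +
    \sum_j F j * ipE (gamma j (gamma k v)) v = 2 * F k.
  rewrite -big_split /= (bigD1 k)//= big1 ?addr0 => [|j jk].
    case: hgamma => sa un _ _.
    rewrite un (gamma_sqr hgamma) ipxx v1 expr1n.
    by rewrite -[1%:C%C]/(1 : R[i]) mulr1 mulr_natl mulr2n.
  case: (hgamma) => sa _ _ _; rewrite -mulrDr -(sa k) -ipDl.
  by rewrite (gamma_anticomm hgamma) eq_sym (negPf jk) mulr0 scale0r ip0l mulr0.
have : cabs (2 * F k) <= Q + Q.
  by rewrite -sum2; apply: le_trans (cabsD _ _) (lerD h1 h2).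
have -> : cabs (2 * F k) = 2 * cabs (F k).
  rewrite cabsM; congr (_ * _).
  have -> : (2 : R[i]) = (2 : R)%:C%C by rewrite rmorphMn rmorph1.
  by rewrite cabs_real ger0_norm.
rewrite -/(F k) /Q; move: (cabs (F k)) (\sum_(y <- S') _) (\sum_(x <- S) _) => f b c.
by lra.
Qed.

Lemma kbound_entry (KK : G -> G -> R[i]) C x y : kbound KK C -> cabs (KK x y) <= C.
Proof.
move=> /(_ [fset x]%fset [fset y]%fset (fun=> 1) (fun=> 1)).
by rewrite !big_seq_fset1 !mulr1 cabs1 expr1n -[1 + 1]/(2) divfK// pnatr_eq0.
Qed.

Lemma lip_ball_bound a : lip_ball ipH A amp dom D a -> linear a /\ lip_bound ipE gamma a 1.
Proof.
case=> Aa pa na; have la : linear a by case: Aa => -[].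
by split=> //; apply/(lip_boundP hgamma la ler01).
Qed.

Lemma kern_twk a x y : A a -> kern a x y = twk sigma (fun g => kern a g 0) x y.
Proof. by move=> Aa; rewrite (kern_twisted hsigma hnormal). Qed.

(** One finite set carries all elements of the ball up to e, and the coefficients
there are bounded by the commutators, except for that of the identity. *)
Lemma lip_ball_precompact (e : R) : 0 < e -> exists (r : seq G) (M : R),
  0 <= M /\ forall a, lip_ball ipH A amp dom D a -> exists c0 (c : G -> R[i]),
    (forall g, g \in r -> cabs (c g) <= M) /\
    opbound ipK (a - (c0 *: idfun + \sum_(g <- r) c g *: lam g)) e.
Proof.
move=> e0; have [W hW] := twk_precompact hp (sigma_abs hsigma) hsigma.2 e0.
pose r := [seq g <- W | g != 0].
pose M := \sum_(g <- r) \sum_(j < d) `|xcoord R j g|^-1.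
have M0 : 0 <= M.
  by apply: sumr_ge0 => g _; apply: sumr_ge0 => j _; rewrite invr_ge0.
exists r, M; split=> // a la; have [lin_a lip_a] := lip_ball_bound la.
have [Aa _ _] := la.
pose k g := kern a g 0.
have hk j : kbound (dkern a j) 1 by exact: commutator_kbound.
have hX j : kbound (fun x y => (xcoord R j x - xcoord R j y)%:C%C * twk sigma k x y) 1.
  apply: kbound_ext (hk (widen_ord (leqnSn d) j)) => x y.
  by rewrite /dkern weight_widen kern_twk.
have hF : kbound (fun x y => (Ffun R x - Ffun R y)%:C%C * twk sigma k x y) 1.
  by apply: kbound_ext (hk ord_max) => x y; rewrite /dkern weight_max kern_twk.
have hWk := hW k hF hX.
exists (if 0 \in W then k 0 else 0), k; split=> [g|].
  rewrite mem_filter => /andP[g0 gW].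
  (* A nonzero g has a nonzero coordinate, and the commutator with it multiplies
     the g-th coefficient by that coordinate; only the scalar part is free. *)
  have [j gj] : exists j, xcoord R j g != 0.
    apply: contrapT => /forallNP h; move/eqP: g0; apply; apply/rowP => j.
    rewrite mxE; apply: val_inj; apply/eqP.
    have /negP := h j; rewrite negbK /xcoord fmorph_eq0.
    by [].
  have := kbound_entry g 0 (hX j).
  rewrite /twk !subr0 sigma0r// mul1r cabsM cabs_real.
  have -> : xcoord R j (0 : G) = 0 by rewrite /xcoord mxE rmorph0.
  rewrite subr0 => h; apply: le_trans (_ : `|xcoord R j g|^-1 <= _).
    by rewrite -[leRHS]mulr1 ler_pdivlMl// normr_gt0.
  have gr : g \in r by rewrite mem_filter g0.
  rewrite /M (big_rem g)//= (bigD1 j)//= -addrA lerDl addr_ge0 ?sumr_ge0// => i _.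
  by apply: sumr_ge0 => ? _; rewrite invr_ge0.
have eqW : (if 0 \in W then k 0 else 0) *: idfun + \sum_(g <- r) k g *: lam g =
    fsum_lambda sigma W k.
  rewrite /fsum_lambda /r big_filter; case: ifPn => W0.
    rewrite -(lambda0 hsigma hnormal) [RHS](bigD1_seq 0) ?fset_uniq//.
  rewrite scale0r add0r big_mkcond [RHS]big_seq [LHS]big_seq; apply: eq_bigr => g gW.
  by case: eqP => // g0; rewrite -g0 gW in W0.
rewrite eqW; apply: opbound_kern => //.
  apply/bounded_operatorP; split.
    by apply: linear_sub => //; exact: fsum_lambda_linear.
  have /bounded_operatorP[_ [C C0 hC]] : bounded_operator ipK a by case: Aa.
  have fsW : range (lambda_fs sigma) (fsum_lambda sigma W k).
    by apply/range_lambda_fs => //; exists W, k.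
  have /bounded_operatorP[_ [C' C0' hC']] := fs_bounded hsigma fsW.
  by exists (C + C'); [exact: addr_ge0|exact: opboundB].
apply: kbound_ext hWk => x y; rewrite kernB kern_fsum// kern_twk// /twk.
by case: ifP => _; rewrite ?subrr ?subr0.
Qed.

(** Finite sums of translations are dense and Lipschitz; a multiple of each one lies
in the Lipschitz ball. *)
Lemma lip_dense a (e : R) : A a -> 0 < e -> exists b k,
  [/\ A b, (0 : R) < k, lip_ball ipH A amp dom D (k%:C%C *: b) & opbound ipK (a - b) e].
Proof.
move=> /(twisted_cstarP hsigma)[_ ha] e0; have [b Bb hb] := ha e e0.
have Ab := fs_twisted_cstar hsigma Bb.
have [C C0 hC] := lip_bound_fs hp hsigma hgamma Bb.
have C1 : 0 < C + 1 by rewrite ltr_wpDl.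
have k0 : 0 < (C + 1)^-1 by rewrite invr_gt0.
have hA := twisted_cstar_alg hsigma hnormal.
have Akb : A ((C + 1)^-1%:C%C *: b) by exact: (cstarZ hA).
have lkb : linear ((C + 1)^-1%:C%C *: b) := cstar_linear hA Akb.
have lipkb : lip_bound ipE gamma ((C + 1)^-1%:C%C *: b) 1.
  have [db hkb] := lip_boundZ hgamma (C + 1)^-1%:C%C hC; split=> // psi dpsi.
  apply: le_trans (hkb psi dpsi) _; rewrite ler_wpM2r ?hnorm_ge0//.
  by rewrite cabs_real gtr0_norm// ler_pdivrMl// mulr1 lerDl.
have [pkb nkb] := (lip_boundP hgamma lkb ler01).1 lipkb.
by exists b, (C + 1)^-1; split.
Qed.

End metric.

Theorem theorem2p7 (R : realType) (d p : nat)
    (hd : (2 <= d)%N) (hp : (2 <= p)%N)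
    (sigma : Ginf p d -> Ginf p d -> R[i])
    (hsigma : circle_cocycle sigma) (hnorm : normalized_cocycle sigma)
    (E : vectType R[i]) (ipE : {dot E for conjC}) (hE : (0 < \dim {:E})%N)
    (gamma : 'I_d.+1 -> 'End(E))
    (hgamma : anticommuting_self_adjoint_unitaries ipE gamma) :
  metric_spectral_triple
    (@l2_ip R (Ginf p d) _ (@cip R)) (@l2_ip R (Ginf p d) E ipE)
    (twisted_cstar sigma) (@amplification R p d E ipE)
    (@Dinf_dom R p d E ipE) (@Dinf R p d E ipE gamma).
Proof.
rewrite Dinf_dom_wdom Dinf_wdirac.
have hA := twisted_cstar_alg hsigma hnorm.
have cK : hilbert_complete (@l2_ip R (Ginf p d) _ (@cip R)).
  exact: l2_complete (@cip_complete R).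
have lamA g : twisted_cstar sigma (lambda sigma g).
  by apply: fs_twisted_cstar => //; rewrite -[lambda sigma g]scale1r; exact: fs_lambda.
have [mk_dist mk_top] := mk_metrizes cK hA (lip_dense hp hsigma hnorm hgamma) lamA
  (lip_ball_precompact hp hsigma hnorm hE hgamma).
split=> //; split.
- split; [exact: cK|exact: hA| |].
    exact: l2_complete (@fin_dim_complete R E ipE).
  by apply: amp_representation => a [].
- exact: wdirac_self_adjoint hgamma (@weight R p d).
- by apply: (wdirac_compact_resolvent hgamma) => z; [exact: len_ge1|exact: len_proper].
- exists (range (lambda_fs sigma)); first exact: fs_star_algebra.
  split=> // a Ba; have Aa := fs_twisted_cstar hsigma Ba.
  have [C C0 hC] := lip_bound_fs hp hsigma hgamma Ba.
  have /(lip_boundP hgamma (cstar_linear hA Aa) C0)[pa na] := hC.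
  by split=> //; apply: le_lt_trans na (ltry _).
Qed.
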